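(* Suppose that $\sum_{i=1}^\infty\int_0^T\|Z_{i,T}(t)\|\,\mathrm dt$ is finite (hence $P_T$ exists) and $$\int_0^T\mathbb E\|\bar\Phi_w(t)\mathcal H\|^2\,\mathrm dt\ \sum_{i=1}^\infty\int_0^T\|Z_{i,T}(t)\|\,\mathrm dt<1.$$ Then the Gramian $Q_T=\sum_{i=1}^\infty\int_0^T\mathcal Z_{i,T}(t)\,\mathrm dt$ exists. Moreover, suppose that $\sigma\big(A\otimes I+I\otimes A+\sum_{k=1}^mN_k\otimes N_k\big)\subset\mathbb C_-$, that $\sum_{i=1}^\infty\int_0^\infty\|Z_{i,\infty}(t)\|\,\mathrm dt$ converges (hence $P$ exists) and that $$\int_0^\infty\mathbb E\|\bar\Phi_w(t)\mathcal H\|^2\,\mathrm dt\ \sum_{i=1}^\infty\int_0^\infty\|Z_{i,\infty}(t)\|\,\mathrm dt<1.$$ Then the infinite Gramian $Q=\sum_{i=1}^\infty\int_0^\infty\mathcal Z_{i,\infty}(t)\,\mathrm dt$ exists.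
   Context: Setting: $n,m,p\in\mathbb N$, $T>0$, $A\in\mathbb R^{n\times n}$, $B\in\mathbb R^{n\times m}$, $C\in\mathbb R^{p\times n}$, $N=[N_1\ \dots\ N_m]$, $H=[H_1\ \dots\ H_n]$ with $N_k,H_j\in\mathbb R^{n\times n}$, and block-wise transposes $\mathcal N=[N_1^\top\ \dots\ N_m^\top]$, $\mathcal H=[H_1^\top\ \dots\ H_n^\top]$; $\|\cdot\|$ is the Euclidean norm for vectors and the induced operator norm for matrices; $\otimes$ is the Kronecker product; $\sigma(\cdot)$ is the spectrum and $\mathbb C_-$ the open left half-plane. Reachability: $\mathcal L(X)=AX+XA^\top+N(I\otimes X)N^\top$. $Z_{1,T}$ solves $\dot Z_{1,T}=\mathcal L(Z_{1,T})$ on $[0,\infty)$, $Z_{1,T}(0)=BB^\top$, and for $i\ge2$, $\dot Z_{i,T}=\mathcal L(Z_{i,T})$, $Z_{i,T}(0)=H\big(\sum_{k=1}^{i-1}\int_0^TZ_{k,T}(s)\,\mathrm ds\otimes\int_0^TZ_{i-k,T}(s)\,\mathrm ds\big)H^\top$; $P_T=\sum_{i\ge1}\int_0^TZ_{i,T}(s)\,\mathrm ds$. Observability: $\mathcal L^*(X)=A^\top X+XA+\mathcal N(I\otimes X)\mathcal N^\top$. $\mathcal Z_{1,T}$ solves $\dot{\mathcal Z}_{1,T}=\mathcal L^*(\mathcal Z_{1,T})$, $\mathcal Z_{1,T}(0)=C^\top C$, and for $i\ge2$, $\dot{\mathcal Z}_{i,T}=\mathcal L^*(\mathcal Z_{i,T})$,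 $\mathcal Z_{i,T}(0)=\mathcal H\big(\sum_{k=1}^{i-1}\int_0^TZ_{k,T}(s)\,\mathrm ds\otimes\int_0^T\mathcal Z_{i-k,T}(s)\,\mathrm ds\big)\mathcal H^\top$. $Z_{i,\infty}$ and $\mathcal Z_{i,\infty}$ are defined in the same way with $T$ replaced by $\infty$ in the initial values, and $P=\sum_{i\ge1}\int_0^\infty Z_{i,\infty}(s)\,\mathrm ds$. A Gramian ''exists'' if the defining series (and improper integrals) converge. Dual stochastic fundamental solution: for an $m$-dimensional Wiener process $w$ with independent entries (Itô integral), $\bar\Phi_w(t)=I+\int_0^tA^\top\bar\Phi_w(v)\,\mathrm dv+\int_0^t\mathcal N(\mathrm dw(v)\otimes\bar\Phi_w(v))$, where $\mathcal N(\mathrm dw\otimes\bar\Phi_w)=\sum_{k=1}^mN_k^\top\bar\Phi_w\,\mathrm dw_k$. *)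

(* Defs.v *)
From HB Require Import structures.
From mathcomp Require Import all_boot all_order all_algebra.
From mathcomp Require Import all_classical all_reals all_analysis.
From mathcomp Require Import complex mxtens.

Set Implicit Arguments.
Unset Strict Implicit.
Unset Printing Implicit Defensive.
Import Order.TTheory GRing.Theory Num.Theory.
Import numFieldNormedType.Exports.

Local Open Scope classical_set_scope.
Local Open Scope ring_scope.

Section Matrices.
Variable R : realType.
Notation mu := (@lebesgue_measure R).

Definition l2norm n (x : 'cV[R]_n) : R := Num.sqrt (\sum_i x i 0 ^+ 2).

Definition opnorm m n (M : 'M[R]_(m, n)) : R :=
  sup [set l2norm (M *m x) | x in [set x : 'cV[R]_n | l2norm x <= 1]].

(* The block row [K_0 ... K_(q-1)]; [mxtens_unindex] is the indexing of the
   Kronecker product [*t], so the column (k, j) is the column j of K_k. *)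
Definition blockrow q n (K : 'I_q -> 'M[R]_n) : 'M[R]_(n, q * n) :=
  \matrix_(i, l) K (mxtens_unindex l).1 i (mxtens_unindex l).2.

(* Entrywise Lebesgue integral; the horizon D is `[0, T] or `[0, +oo[. *)
Definition mxintegral (D : set R) m n (f : R -> 'M[R]_(m, n)) : 'M[R]_(m, n) :=
  \matrix_(i, j) (\int[mu]_(t in D) f t i j).

Definition mxintegrable (D : set R) m n (f : R -> 'M[R]_(m, n)) : Prop :=
  forall i j, mu.-integrable D (fun t => (f t i j)%:E).

(* At t = 0 only right-continuity is asked for: the values of Z at negative
   times are irrelevant. *)
Definition ode_solution n (L : 'M[R]_n -> 'M[R]_n) (Z0 : 'M[R]_n)
    (Z : R -> 'M[R]_n) : Prop :=
  [/\ Z 0 = Z0,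
      {within `[0, +oo[, continuous Z}
    & forall t : R, 0 < t -> is_derive t 1 Z (L (Z t))].

End Matrices.

Section Gramians.
Variables (R : realType) (n m p : nat).
Variables (A : 'M[R]_n) (B : 'M[R]_(n, m)) (C : 'M[R]_(p, n)).
Variables (N : 'I_m -> 'M[R]_n) (H : 'I_n -> 'M[R]_n).
Notation mu := (@lebesgue_measure R).

Let Nb := blockrow N.
Let Nbt := blockrow (fun k => (N k)^T).
Let Hb := blockrow H.
Let Hbt := blockrow (fun j => (H j)^T).

Definition lyap (X : 'M[R]_n) : 'M[R]_n :=
  A *m X + X *m A^T + Nb *m ((1%:M : 'M[R]_m) *t X) *m Nb^T.

Definition lyap_dual (X : 'M[R]_n) : 'M[R]_n :=
  A^T *m X + X *m A + Nbt *m ((1%:M : 'M[R]_m) *t X) *m Nbt^T.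

(* The families are indexed from 1; Z 0 is never used. *)
Definition reach_family (D : set R) (Z : nat -> R -> 'M[R]_n) : Prop :=
  ode_solution lyap (B *m B^T) (Z 1%N) /\
  forall i : nat, (2 <= i)%N ->
    ode_solution lyap
      (Hb *m (\sum_(1 <= k < i)
                mxintegral D (Z k) *t mxintegral D (Z (i - k)%N)) *m Hb^T)
      (Z i).

Definition obs_family (D : set R) (Z Zd : nat -> R -> 'M[R]_n) : Prop :=
  ode_solution lyap_dual (C^T *m C) (Zd 1%N) /\
  forall i : nat, (2 <= i)%N ->
    ode_solution lyap_dual
      (Hbt *m (\sum_(1 <= k < i)
                 mxintegral D (Z k) *t mxintegral D (Zd (i - k)%N)) *m Hbt^T)
      (Zd i).

Definition gramian_exists (D : set R) (Z : nat -> R -> 'M[R]_n) : Prop :=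
  (forall i : nat, (1 <= i)%N -> mxintegrable D (Z i)) /\
  exists Q : 'M[R]_n,
    (fun r : nat => \sum_(1 <= i < r.+1) mxintegral D (Z i)) @ \oo --> Q.

Definition total_norm (D : set R) (Z : nat -> R -> 'M[R]_n) : \bar R :=
  (\sum_(1 <= i <oo) \int[mu]_(t in D) (opnorm (Z i t))%:E)%E.

Definition kron_generator : 'M[R]_(n * n) :=
  A *t 1%:M + 1%:M *t A + \sum_k N k *t N k.

Definition kron_generator_hurwitz : Prop :=
  forall z : R[i],
    eigenvalue (map_mx (real_complex R) kron_generator) z -> complex.Re z < 0.

End Gramians.

Section Stochastic.
Context {d : measure_display} {Omega : measurableType d} {R : realType}.
Variables (P : probability Omega R) (F : R -> set (set Omega)).
Notation mu := (@lebesgue_measure R).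

Definition filtration : Prop :=
  [/\ forall t : R, 0 <= t -> sigma_algebra setT (F t),
      forall t : R, 0 <= t -> F t `<=` measurable
    & forall s t : R, 0 <= s -> s <= t -> F s `<=` F t].

Definition sub_measurable (t : R) (X : Omega -> R) : Prop :=
  forall E : set R, measurable E -> F t (X @^-1` E).

(* The third clause says at once that the increment of w over ]s, t] is
   independent of F s, that its entries are independent of each other, and
   that each is centred Gaussian with variance t - s ([normal_prob] takes the
   standard deviation). *)
Definition wiener_process m (w : 'I_m -> R -> Omega -> R) : Prop :=
  [/\ forall k, {ae P, forall x, w k 0 x = 0},
      forall k (t : R), 0 <= t -> sub_measurable t (w k t),
      forall s t : R, 0 <= s -> s < t ->
        forall (G : set Omega) (E : 'I_m -> set R),
          F s G -> (forall k, measurable (E k)) ->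
          P (G `&` [set x | forall k, E k (w k t x - w k s x)]) =
          (P G * \prod_k normal_prob 0 (Num.sqrt (t - s)) (E k))%E
    & forall k, {ae P, forall x, {within `[0, +oo[, continuous (w k ^~ x)}}].

(* The process equal to [sp_coef j] on ]sp_grid j, sp_grid j.+1] for
   j < sp_size, and 0 elsewhere. *)
Record simple_process := SimpleProcess {
  sp_size : nat;
  sp_grid : nat -> R;
  sp_coef : nat -> Omega -> R;
  sp_grid_ge0 : 0 <= sp_grid 0%N;
  sp_grid_nd : forall j : nat, sp_grid j <= sp_grid j.+1;
  sp_coef_bounded : forall j, exists M : R, forall x, `|sp_coef j x| <= M;
  sp_coef_measurable : forall j, sub_measurable (sp_grid j) (sp_coef j) }.

Definition sp_value (S : simple_process) (t : R) (x : Omega) : R :=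
  \sum_(j < sp_size S)
    sp_coef S j x * \1_(`]sp_grid S j, sp_grid S j.+1]) t.

Definition sp_integral (b : R -> Omega -> R) (S : simple_process) (t : R)
    (x : Omega) : R :=
  \sum_(j < sp_size S) sp_coef S j x *
    (b (Num.min t (sp_grid S j.+1)) x - b (Num.min t (sp_grid S j)) x).

(* Jointly measurable, adapted, and square integrable on [0, t] x Omega. *)
Definition ito_integrand (t : R) (f : R -> Omega -> R) : Prop :=
  [/\ measurable_fun (`[0, t] `*` [set: Omega])
        (fun sx : R * Omega => f sx.1 sx.2),
      forall s : R, 0 <= s -> s <= t -> sub_measurable s (f s)
    & (\int[mu]_(s in `[0%R, t]) 'E_P[fun x => (f s x ^+ 2)%R] < +oo)%E].

(* I is a version of the Ito integral of f against b over [0, t]: the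
   mean-square limit of the integrals of simple processes approximating f. *)
Definition is_ito_integral (b : R -> Omega -> R) (f : R -> Omega -> R)
    (t : R) (I : Omega -> R) : Prop :=
  [/\ ito_integrand t f,
      measurable_fun setT I
    & exists S : nat -> simple_process,
        ((fun r => \int[mu]_(s in `[0%R, t])
                     'E_P[fun x => ((f s x - sp_value (S r) s x) ^+ 2)%R])
           @ \oo --> 0)%E /\
        ((fun r => 'E_P[fun x => ((I x - sp_integral b (S r) t x) ^+ 2)%R])
           @ \oo --> 0)%E].

(* Phi(t) = I + int_0^t A^T Phi dv + sum_k int_0^t N_k^T Phi dw_k; [J k] is the
   k-th (entrywise) stochastic integral. *)
Definition dual_fundamental_solution n m (A : 'M[R]_n) (N : 'I_m -> 'M[R]_n)
    (w : 'I_m -> R -> Omega -> R) (Phi : R -> Omega -> 'M[R]_n) : Prop :=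
  [/\ {ae P, forall x, {within `[0, +oo[, continuous (Phi ^~ x)}},
      forall t : R, 0 <= t ->
        forall i j, ito_integrand t (fun s x => Phi s x i j)
    & forall t : R, 0 <= t ->
        exists J : 'I_m -> Omega -> 'M[R]_n,
          (forall k i j,
             is_ito_integral (w k) (fun v x => ((N k)^T *m Phi v x) i j) t
               (fun x => J k x i j)) /\
          {ae P, forall x,
             Phi t x = 1%:M + mxintegral `[0, t] (fun v => A^T *m Phi v x)
                       + \sum_k J k x}].

Definition mean_square_gain (D : set R) n (H : 'I_n -> 'M[R]_n)
    (Phi : R -> Omega -> 'M[R]_n) : \bar R :=
  (\int[mu]_(t in D)
     'E_P[fun x => (opnorm (Phi t x *m blockrow (fun j => (H j)^T)) ^+ 2)%R])%E.

End Stochastic.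

(* Main.v *)
(* Ito's isometry makes the second moments E[Phi_ic(t) Phi_jd(t)] satisfy, up
   to an error O((t - s)^2) over each step [s, t], the linear equation with
   generator L^*; a function vanishing at 0 whose defects with respect to a
   linear equation are O((t - s)^2) is zero, so every solution of Z' = L^*(Z),
   Z(0) = X is Z(t) = E[Phi(t) X Phi(t)^T].
   With X = K Y K^T, K the block row of the H_j^T, this gives
   |<u, Z(t) v>| <= ||Y|| E||Phi(t) K||^2 |u| |v|, hence
   ||int Z|| <= ||Y|| g with g the mean square gain.  For the i-th dual
   equation Y = sum_k (int Z_k) * (int Zd_(i-k)) (Kronecker products), so
   q_i <= g sum_k z_k q_(i-k) with z_k = ||int Z_k||, q_i = ||int Zd_i||;
   summing over i, g sum_k z_k < 1 bounds the partial sums of the q_i.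
   On the infinite horizon the entries of Zd_i are integrable because the
   Kronecker generator G is Hurwitz: by Cayley-Hamilton, a product of factors
   G - lambda_j annihilates the solution, and each factor with
   Re lambda_j < 0 is inverted preserving exponential decay. *)
Require Import Defs.
From HB Require Import structures.
From mathcomp Require Import all_boot all_order all_algebra.
From mathcomp Require Import all_classical all_reals all_analysis.
From mathcomp Require Import measurable_realfun complex mxtens ring lra.
Set Implicit Arguments.
Unset Strict Implicit.
Unset Printing Implicit Defensive.
Import Order.TTheory GRing.Theory Num.Theory.
Import numFieldNormedType.Exports.
Local Open Scope classical_set_scope.
Local Open Scope ring_scope.

(** The stochastic equation is available time by time only: for each t the stochastic integral is a
    random variable obtained as a mean-square limit, and different times are linked only by the
    isometry between integrals up to t and up to t'. The second moments are therefore studied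
    through the two-time covariances E[phi_i(s) phi_j(t)] and E[phi_i(s) M_j(t)], M being the
    stochastic part. They obey closed linear integral equations, from which the Lipschitz bounds and
    then the O((t - s)^2) defects follow by pure analysis; even the orthogonality of the noise after
    s to the state at s is a uniqueness statement for such an equation. The other obstacle is that t
    and x enter the gain through an operator norm whose measurability is never established, and that
    the gain may be infinite when the sum of the z_k is 0. Hence matrices are tested against pairs
    of vectors, so that only measurable scalar functions have to be handled before the monotonicity
    of nonnegative integrals is applied, and the estimates are stated in the extended reals. *)

(** * Square-integrable functions and their inner product *)

Section square_integrable.
Context d (T : measurableType d) (R : realType) (mu : {measure set T -> \bar R}).
Implicit Types f g h : T -> R.

(** The measure stays general because it is used for the probability, for Lebesgue measure and for
    their product; a time horizon enters as an indicator factor, so that the domain is always the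
    whole space. *)
Definition sqint f :=
  measurable_fun setT f /\ (\int[mu]_x (f x ^+ 2)%:E < +oo)%E.

Definition dotp f g : R := \int[mu]_x (f x * g x).

Lemma sqint_sqr_integrable f :
  sqint f -> mu.-integrable setT (EFin \o (fun x => f x ^+ 2)).
Proof.
move=> [mf fy]; apply/integrableP; split.
  exact/measurable_EFinP/measurable_funX.
by under eq_integral do rewrite /= ger0_norm ?sqr_ge0//.
Qed.

Lemma integrable_sqint f : measurable_fun setT f ->
  mu.-integrable setT (EFin \o (fun x => f x ^+ 2)) -> sqint f.
Proof.
move=> mf /integrableP[_ fy]; split => //; apply: le_lt_trans fy.
by under [leRHS]eq_integral do rewrite /= ger0_norm ?sqr_ge0//.
Qed.

Lemma sqint_mul f g : sqint f -> sqint g ->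
  mu.-integrable setT (EFin \o (fun x => f x * g x)).
Proof.
move=> sf sg; have [mf _] := sf; have [mg _] := sg.
apply: (@le_integrable _ _ _ _ _ measurableT _
  (fun x => (f x ^+ 2)%:E + (g x ^+ 2)%:E)%E).
- exact/measurable_EFinP/measurable_funM.
- move=> x _; rewrite /= lee_fin [leRHS]ger0_norm ?addr_ge0 ?sqr_ge0//.
  rewrite normrM -(real_normK (num_real (f x))) -(real_normK (num_real (g x))).
  have := normr_ge0 (f x); have := normr_ge0 (g x); nra.
- by apply: integrableD => //; exact: sqint_sqr_integrable.
Qed.

Lemma sqintD f g : sqint f -> sqint g -> sqint (fun x => f x + g x).
Proof.
move=> sf sg; have [mf _] := sf; have [mg _] := sg.
apply: integrable_sqint; first exact: measurable_funD.
rewrite [X in integrable _ _ X](_ : _ =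
    (fun x => (f x ^+ 2)%:E + ((2%:E * (f x * g x)%:E) + (g x ^+ 2)%:E))%E).
  apply: integrableD => //; first exact: sqint_sqr_integrable.
  apply: integrableD => //; last exact: sqint_sqr_integrable.
  by apply: integrableZl => //; exact: sqint_mul.
by apply/funext => x /=; rewrite -EFinM -!EFinD; congr EFin; ring.
Qed.

Lemma sqintZ a f : sqint f -> sqint (fun x => a * f x).
Proof.
move=> sf; have [mf _] := sf.
apply: integrable_sqint; first exact: measurable_funM.
rewrite [X in integrable _ _ X](_ : _ =
    (fun x => (a ^+ 2)%:E * (f x ^+ 2)%:E)%E).
  by apply: integrableZl => //; exact: sqint_sqr_integrable.
by apply/funext => x /=; rewrite -EFinM exprMn.
Qed.

Lemma sqintB f g : sqint f -> sqint g -> sqint (fun x => f x - g x).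
Proof.
move=> sf sg; rewrite (_ : (fun _ => _) = (fun x => f x + (-1) * g x)).
  by apply: sqintD => //; exact: sqintZ.
by apply/funext => x; rewrite mulN1r.
Qed.

Lemma sqint0 : sqint (fun=> 0).
Proof.
split; first exact: measurable_cst.
by under eq_integral do rewrite expr0n/=; rewrite integral0 ltry.
Qed.

Lemma sqint_sum I (s : seq I) (f : I -> T -> R) :
  (forall i, sqint (f i)) -> sqint (fun x => \sum_(i <- s) f i x).
Proof.
move=> sf; elim: s => [|i s ih].
  by under eq_fun do rewrite big_nil; exact: sqint0.
by under eq_fun do rewrite big_cons; exact: sqintD.
Qed.

Lemma sqint_ae f g : measurable_fun setT f -> {ae mu, forall x, f x = g x} ->
  sqint g -> sqint f.
Proof.
move=> mf fg [mg gy]; split => //.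
rewrite (ae_eq_integral (fun x => (g x ^+ 2)%:E)) => //.
- exact/measurable_EFinP/measurable_funX.
- exact/measurable_EFinP/measurable_funX.
- by apply: filterS fg => x /= -> _.
Qed.

Lemma dotpC f g : dotp f g = dotp g f.
Proof. by apply: eq_Rintegral => x _; rewrite mulrC. Qed.

Lemma dotpDl f g h : sqint f -> sqint g -> sqint h ->
  dotp (fun x => f x + g x) h = dotp f h + dotp g h.
Proof.
move=> sf sg sh; rewrite /dotp -RintegralD//; try exact: sqint_mul.
by apply: eq_Rintegral => x _; rewrite mulrDl.
Qed.

Lemma dotpZl a f g : sqint f -> sqint g ->
  dotp (fun x => a * f x) g = a * dotp f g.
Proof.
move=> sf sg; rewrite /dotp -RintegralZl//; last exact: sqint_mul.
by apply: eq_Rintegral => x _; rewrite mulrA.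
Qed.

Lemma dotpBl f g h : sqint f -> sqint g -> sqint h ->
  dotp (fun x => f x - g x) h = dotp f h - dotp g h.
Proof.
move=> sf sg sh; rewrite /dotp -RintegralB//; try exact: sqint_mul.
by apply: eq_Rintegral => x _; rewrite mulrBl.
Qed.

Lemma dotp0l f : dotp (fun=> 0) f = 0.
Proof.
by rewrite /dotp; under eq_Rintegral do rewrite mul0r; rewrite Rintegral_cst// mul0r.
Qed.

Lemma dotp_suml I (s : seq I) (f : I -> T -> R) g :
  (forall i, sqint (f i)) -> sqint g ->
  dotp (fun x => \sum_(i <- s) f i x) g = \sum_(i <- s) dotp (f i) g.
Proof.
move=> sf sg; elim: s => [|i s ih].
  by rewrite big_nil -[RHS](dotp0l g); congr dotp; apply/funext => x; rewrite big_nil.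
rewrite big_cons -ih -dotpDl//; last exact: sqint_sum.
by congr dotp; apply/funext => x; rewrite big_cons.
Qed.

Lemma dotpDr f g h : sqint f -> sqint g -> sqint h ->
  dotp h (fun x => f x + g x) = dotp h f + dotp h g.
Proof. by move=> sf sg sh; rewrite dotpC dotpDl// !(dotpC h). Qed.

Lemma dotpBr f g h : sqint f -> sqint g -> sqint h ->
  dotp h (fun x => f x - g x) = dotp h f - dotp h g.
Proof. by move=> sf sg sh; rewrite dotpC dotpBl// !(dotpC h). Qed.

Lemma dotpZr a f g : sqint f -> sqint g ->
  dotp f (fun x => a * g x) = a * dotp f g.
Proof. by move=> sf sg; rewrite dotpC dotpZl// dotpC. Qed.

Lemma dotp_sumr I (s : seq I) (f : I -> T -> R) g :
  (forall i, sqint (f i)) -> sqint g ->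
  dotp g (fun x => \sum_(i <- s) f i x) = \sum_(i <- s) dotp g (f i).
Proof.
move=> sf sg; rewrite dotpC dotp_suml//.
by apply: eq_bigr => i _; rewrite dotpC.
Qed.

Lemma dotp_ge0 f : 0 <= dotp f f.
Proof. by apply: Rintegral_ge0 => x _; rewrite -expr2 sqr_ge0. Qed.

Lemma dotp_ae f f' g : measurable_fun setT f -> measurable_fun setT f' ->
  measurable_fun setT g -> {ae mu, forall x, f x = f' x} ->
  dotp f g = dotp f' g.
Proof.
move=> mf mf' mg ff'; rewrite /dotp /Rintegral; congr fine.
apply: ae_eq_integral => //.
- exact/measurable_EFinP/measurable_funM.
- exact/measurable_EFinP/measurable_funM.
- by apply: filterS ff' => x /= -> _.
Qed.

Lemma dotp_norm_le f g : sqint f -> sqint g ->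
  `|dotp f g| <= (dotp f f + dotp g g) / 2.
Proof.
move=> sf sg.
have := dotp_ge0 (fun x => f x + g x); have := dotp_ge0 (fun x => f x - g x).
rewrite dotpBl//; last exact: sqintB.
rewrite !dotpBr// dotpDl//; last exact: sqintD.
rewrite !dotpDr// (dotpC g f) => h1 h2.
by rewrite ler_norml; apply/andP; split; lra.
Qed.

Lemma dotp_cauchy_schwarz f g : sqint f -> sqint g ->
  dotp f g ^+ 2 <= dotp f f * dotp g g.
Proof.
move=> sf sg.
have H a b : 0 <= a ^+ 2 * dotp f f + 2 * a * b * dotp f g + b ^+ 2 * dotp g g.
  have := dotp_ge0 (fun x => a * f x + b * g x).
  have sa := sqintZ a sf; have sb := sqintZ b sg.
  rewrite dotpDl//; last exact: sqintD.
  rewrite !dotpDr// !dotpZl// !dotpZr// (dotpC g f).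
  by congr (_ <= _); ring.
have g0 := dotp_ge0 g.
move: g0; rewrite le_eqVlt => /predU1P[g0|g0].
  rewrite -g0 mulr0 le_eqVlt sqrf_eq0; apply/orP; left; apply/negPn/negP => fg0.
  (* When the norm of [g] is 0 the quadratic form is affine in its second argument; this value makes
     it equal to -1. *)
  have := H 1 (- (dotp f f + 1) / (2 * dotp f g)).
  rewrite -g0 mulr0 addr0 expr1n !mul1r mulr1.
  rewrite (_ : 2 * _ * _ = - (dotp f f + 1)); last by field.
  by rewrite opprD addrA subrr add0r; apply/negP; rewrite -ltNge ltrN10.
have := H (dotp g g) (- dotp f g).
set F := dotp f f; set G := dotp g g; set D := dotp f g => h.
have {h} : 0 <= G * (F * G - D ^+ 2) by move: h; congr (_ <= _); ring.
by rewrite pmulr_rge0// subr_ge0.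
Qed.

Lemma dotp_norm_sqrt f g : sqint f -> sqint g ->
  `|dotp f g| <= Num.sqrt (dotp f f) * Num.sqrt (dotp g g).
Proof.
move=> sf sg; rewrite -sqrtr_sqr -sqrtrM ?dotp_ge0// ler_sqrt ?mulr_ge0 ?dotp_ge0//.
exact: dotp_cauchy_schwarz.
Qed.

(** Carries inner-product identities from simple processes over to Itô integrals, which are only
    known as mean-square limits. The error is expanded into products each containing a difference
    [f - f_ r] or [g - g_ r], and Cauchy-Schwarz bounds each of them. *)
Lemma cvg_dotp f g (f_ g_ : nat -> T -> R) :
  sqint f -> sqint g -> (forall r, sqint (f_ r)) -> (forall r, sqint (g_ r)) ->
  (fun r => \int[mu]_x ((f x - f_ r x) ^+ 2)%:E)%E @ \oo --> 0%E ->
  (fun r => \int[mu]_x ((g x - g_ r x) ^+ 2)%:E)%E @ \oo --> 0%E ->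
  dotp (f_ r) (g_ r) @[r --> \oo] --> dotp f g.
Proof.
move=> sf sg sf_ sg_ cf cg.
have E h : sqint h -> (\int[mu]_x (h x ^+ 2)%:E)%E = (dotp h h)%:E.
  move=> sh; rewrite /dotp /Rintegral fineK; last first.
    by apply: integrable_fin_num => //; exact: sqint_mul.
  by apply: eq_integral => x _; rewrite expr2.
have C h (h_ : nat -> T -> R) : sqint h -> (forall r, sqint (h_ r)) ->
    (fun r => \int[mu]_x ((h x - h_ r x) ^+ 2)%:E)%E @ \oo --> 0%E ->
    Num.sqrt (dotp (fun x => h x - h_ r x) (fun x => h x - h_ r x))
      @[r --> \oo] --> (0 : R).
  move=> sh sh_ ch; rewrite -[X in _ --> X]sqrtr0.
  apply: continuous_cvg; first exact: sqrt_continuous.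
  apply: (@fine_cvg _ _ _ _ _ 0).
  apply: cvg_trans ch; apply: near_eq_cvg; apply: nearW => r /=.
  by rewrite E//; exact: sqintB.
have Cf := C _ _ sf sf_ cf.
have {C} Cg := C _ _ sg sg_ cg.
rewrite -subr_cvg0.
set sF := Num.sqrt (dotp f f); set sG := Num.sqrt (dotp g g).
set df := (fun r => Num.sqrt _) in Cf; set dg := (fun r => Num.sqrt _) in Cg.
pose b r := df r * dg r + sF * dg r + df r * sG.
have b0 : b r @[r --> \oo] --> (0 : R).
  rewrite (_ : 0 = 0 * 0 + sF * 0 + 0 * sG); last by ring.
  by apply: cvgD; [apply: cvgD; [exact: cvgM|exact: cvgMr]|exact: cvgMl].
apply: (@squeeze_cvgr _ _ _ _ (fun r => - b r) b) => //; last first.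
  by rewrite -[X in _ --> X]oppr0; exact: cvgN.
apply: nearW => r; rewrite -ler_norml.
have s1 := sqintB sf (sf_ r); have s2 := sqintB sg (sg_ r).
rewrite (_ : dotp (f_ r) (g_ r) - dotp f g =
  dotp (fun x => f x - f_ r x) (fun x => g x - g_ r x)
  - dotp f (fun x => g x - g_ r x) - dotp (fun x => f x - f_ r x) g).
  rewrite (le_trans (ler_normB _ _))// lerD ?dotp_norm_sqrt//.
  by rewrite (le_trans (ler_normB _ _))// lerD ?dotp_norm_sqrt.
by rewrite !dotpBr// !dotpBl//; ring.
Qed.

End square_integrable.

(** * Fubini for real-valued functions and product functions *)

(** Fubini marginals are extended-real functions that may be infinite on a null set; this replaces
    them by real functions. *)
Lemma integrable_fine d (T : measurableType d) (R : realType)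
    (mu : {measure set T -> \bar R}) (f : T -> \bar R) :
  mu.-integrable setT f ->
  mu.-integrable setT (EFin \o (fine \o f)) /\
  (\int[mu]_x (fine (f x))%:E = \int[mu]_x f x)%E.
Proof.
move=> if_; have mf := measurable_int _ if_.
have mff : measurable_fun setT (EFin \o (fine \o f)).
  by apply/measurable_EFinP; exact: measurableT_comp.
have ff := integrable_ae measurableT if_.
split.
  apply: le_integrable if_ => //= x _; case: (f x) => [r||] //=; by rewrite normr0 leey.
apply: ae_eq_integral => //; apply: filterS ff => x /= h _.
by rewrite fineK// h.
Qed.

Section product_measures.
Context d1 d2 (T1 : measurableType d1) (T2 : measurableType d2) (R : realType).
Variable m1 : {sigma_finite_measure set T1 -> \bar R}.
Variable m2 : {sigma_finite_measure set T2 -> \bar R}.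
Implicit Types (f : T1 -> R) (g : T2 -> R).

Lemma measurable_prod_fun f g : measurable_fun setT f -> measurable_fun setT g ->
  measurable_fun setT (fun z : T1 * T2 => f z.1 * g z.2).
Proof. by move=> mf mg; apply: measurable_funM; exact: measurableT_comp. Qed.

Lemma integral_prod_abs f g :
  measurable_fun setT f -> measurable_fun setT g ->
  (\int[m1 \x m2]_z `|(f z.1 * g z.2)%:E| =
   \int[m1]_x `|(f x)%:E| * \int[m2]_y `|(g y)%:E|)%E.
Proof.
move=> mf mg.
have mfg := measurable_prod_fun mf mg.
rewrite (fubini_tonelli1 (fun z => `|(f z.1 * g z.2)%:E|%E)) => //; last first.
  by apply/measurable_EFinP; exact: measurableT_comp.
rewrite /fubini_F /=.
under eq_integral => x _.
  under eq_integral do rewrite normrM EFinM.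
  rewrite ge0_integralZl//; last first.
    by apply/measurable_EFinP; exact: measurableT_comp.
  over.
rewrite ge0_integralZr//; last exact: integral_ge0.
by apply/measurable_EFinP; exact: measurableT_comp.
Qed.

Lemma integrable_prod f g :
  m1.-integrable setT (EFin \o f) -> m2.-integrable setT (EFin \o g) ->
  (m1 \x m2)%E.-integrable setT (EFin \o (fun z => f z.1 * g z.2)).
Proof.
move=> /integrableP[mf fy] /integrableP[mg gy].
move/measurable_EFinP : mf => mf; move/measurable_EFinP : mg => mg.
apply/integrableP; split.
  by apply/measurable_EFinP; exact: measurable_prod_fun.
by rewrite integral_prod_abs// lte_mul_pinfty// ?integral_ge0// ge0_fin_numE ?integral_ge0.
Qed.

Lemma Rintegral_prod f g :
  m1.-integrable setT (EFin \o f) -> m2.-integrable setT (EFin \o g) ->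
  \int[(m1 \x m2)%E]_z (f z.1 * g z.2) =
  (\int[m1]_x f x) * (\int[m2]_y g y).
Proof.
move=> if_ ig; rewrite /Rintegral.
have ifg := integrable_prod if_ ig.
rewrite -(integral12_prod_meas1 ifg) /fubini_F /=.
transitivity (fine (\int[m1]_x ((f x)%:E * \int[m2]_y (g y)%:E))%E).
  congr fine; apply: eq_integral => x _.
  by under eq_integral do rewrite EFinM; rewrite integralZl.
rewrite -(fineK (integrable_fin_num _ ig))// integralZr//.
by rewrite fineM// (integrable_fin_num _ if_).
Qed.

Lemma sqint_prod f g : sqint m1 f -> sqint m2 g ->
  sqint (m1 \x m2)%E (fun z => f z.1 * g z.2).
Proof.
move=> sf sg; apply: integrable_sqint.
  by have [mf _] := sf; have [mg _] := sg; exact: measurable_prod_fun.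
rewrite (_ : (fun z => _) = (fun z => f z.1 ^+ 2 * g z.2 ^+ 2)).
  apply: (@integrable_prod (fun x => f x ^+ 2) (fun y => g y ^+ 2));
  exact: sqint_sqr_integrable.
by apply/funext => z; rewrite exprMn.
Qed.

Lemma dotp_prod f f' g g' : sqint m1 f -> sqint m1 f' ->
  sqint m2 g -> sqint m2 g' ->
  dotp (m1 \x m2)%E (fun z => f z.1 * g z.2) (fun z => f' z.1 * g' z.2) =
  dotp m1 f f' * dotp m2 g g'.
Proof.
move=> sf sf' sg sg'; rewrite /dotp.
rewrite -(@Rintegral_prod (fun x => f x * f' x) (fun y => g y * g' y));
  try exact: sqint_mul.
by apply: eq_Rintegral => z _; rewrite mulrACA.
Qed.

End product_measures.

(** * Time integrals of square-integrable processes *)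

Section time_integral.
Context d (Omega : measurableType d) (R : realType) (P : probability Omega R).
Notation mu := (@lebesgue_measure R).
Notation muP := (mu \x P)%E.

Lemma sqint_indic_itv (a b : R) (b0 b1 : bool) :
  sqint mu (\1_[set` Interval (BSide b0 a) (BSide b1 b)] : R -> R).
Proof.
apply: integrable_sqint; first exact: measurable_indic.
apply: eq_integrable (integrable_indic_itv a b b0 b1) => //= x _ /=.
by rewrite indicE; case: (_ \in _) => /=; rewrite ?expr1n ?expr0n.
Qed.

Variables (t : R) (g : R -> Omega -> R).
Hypothesis t0 : 0 <= t.
Hypothesis sg : sqint muP (fun z => g z.1 z.2 * \1_`[0, t] z.1).

Let gt z : R := g z.1 z.2 * \1_`[0, t] z.1.
Let u x : R := \int[mu]_(s in `[0, t]) g s x.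

Let gpatchE x s : ((g ^~ x) \_ `[0, t]) s = gt (s, x).
Proof. by rewrite /gt patchE indicE; case: ifP => _; rewrite ?mulr1 ?mulr0. Qed.

Let sx (zeta : Omega -> R) : sqint P zeta ->
  sqint muP (fun z => \1_`[0, t] z.1 * zeta z.2).
Proof. by move=> sz; apply: sqint_prod => //; exact: sqint_indic_itv. Qed.

Let mul_gt (zeta : Omega -> R) z :
  gt z * (\1_`[0, t] z.1 * zeta z.2) = gt z * zeta z.2.
Proof.
by rewrite /gt !indicE; case: (_ \in _); rewrite ?mulr1 ?mul1r ?mulr0 ?mul0r.
Qed.

Let i1 (zeta : Omega -> R) : sqint P zeta ->
  muP.-integrable setT (EFin \o (fun z => gt z * zeta z.2)).
Proof.
move=> sz; have := sqint_mul sg (sx sz).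
by congr integrable; apply/funext => z /=; rewrite -/(gt z) mul_gt.
Qed.

Lemma sqint1 : sqint P (fun=> 1).
Proof.
split; first exact: measurable_cst.
by under eq_integral do rewrite expr1n; rewrite integral_cst//= mul1e probability_setT ltry.
Qed.

Let igt : muP.-integrable setT (EFin \o gt).
Proof.
by have := i1 sqint1; congr integrable; apply/funext => z /=; rewrite mulr1.
Qed.

Let uE x : u x = fine (fubini_G mu (EFin \o gt) x).
Proof.
rewrite /u Rintegral_mkcond /Rintegral /fubini_G; congr fine.
by apply: eq_integral => s _; rewrite gpatchE.
Qed.

Lemma measurable_time_integral : measurable_fun setT u.
Proof.
rewrite (_ : u = fun x => fine (fubini_G mu (EFin \o gt) x)); last first.
  by apply/funext => x; exact: uE.
by apply: measurableT_comp => //; exact: measurable_fubini_G igt.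
Qed.

(** Fubini applies because [gt] and the product of the indicator of [0, t] with [zeta] are both
    square integrable on the product space, so that their product is integrable. *)
Lemma dotp_time_integral (zeta : Omega -> R) : sqint P zeta ->
  mu.-integrable `[0, t] (EFin \o (fun s => dotp P (g s) zeta)) /\
  dotp P u zeta = \int[mu]_(s in `[0, t]) dotp P (g s) zeta.
Proof.
move=> sz; have iz := i1 sz.
have Fz : (fun s => dotp P (g s) zeta) \_ `[0, t] =
          fine \o fubini_F P (EFin \o (fun z => gt z * zeta z.2)).
  apply/funext => s; rewrite /fubini_F /= /dotp /Rintegral patchE.
  rewrite /gt/= indicE; case: ifP => _ /=.
    by congr fine; apply: eq_integral => x _; rewrite mulr1.
  by rewrite integral0_eq// => x _; rewrite mulr0 mul0r.
have [iF FE] := integrable_fine (integrable_fubini_F iz).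
split.
  by apply/integrable_mkcond => //; rewrite restrict_EFin Fz.
rewrite [RHS]Rintegral_mkcond Fz /Rintegral [in RHS]FE integral12_prod_meas1//.
rewrite -integral21_prod_meas1//; congr fine.
apply: ae_eq_integral => //.
- have [mz _] := sz; apply/measurable_EFinP; apply: measurable_funM => //.
  exact: measurable_time_integral.
- exact: measurable_fubini_G iz.
apply: filterS (ae_integrable2 igt) => x ix _.
rewrite /fubini_G /= uE EFinM fineK; last exact: integrable_fin_num.
rewrite /fubini_G; under [RHS]eq_integral do rewrite EFinM.
by rewrite integralZr.
Qed.

(** Cauchy-Schwarz in time against the indicator of [0, t], whose squared norm is t. The bound is
    claimed for those paths that are square integrable in time, which is almost all of them. *)
Let sqr_u_le : {ae P, forall x,
  ((u x ^+ 2)%:E <= t%:E * \int[mu]_s (gt (s, x) ^+ 2)%:E)%E}.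
Proof.
have isq := sqint_sqr_integrable sg.
have [mgt _] := sg.
apply: filterS (ae_integrable2 isq) => x ix.
have sgx : sqint mu (fun s => gt (s, x)).
  apply: integrable_sqint => //.
  exact: measurableT_comp mgt (measurable_pair2 x).
have -> : u x = dotp mu (fun s => gt (s, x)) \1_`[0, t].
  rewrite /u Rintegral_mkcond; apply: eq_Rintegral => s _.
  by rewrite gpatchE /gt/= -mulrA indicE; case: (_ \in _); rewrite ?mulr1 ?mulr0.
have := dotp_cauchy_schwarz sgx (sqint_indic_itv 0 t true false).
have -> : dotp mu (\1_`[0, t] : R -> R) \1_`[0, t] = t.
  rewrite /dotp /Rintegral (_ : (fun _ => _) = (fun x => (\1_`[0, t] x)%:E)).
    rewrite integral_indic//= setIT lebesgue_measure_itv/= lte_fin.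
    have := t0; rewrite le_eqVlt => /predU1P[<-|->]; first by rewrite ltxx.
    by rewrite sube0.
  by apply/funext => s; rewrite indicE; case: (_ \in _); rewrite ?mulr1 ?mulr0.
rewrite [leRHS]mulrC -lee_fin [leRHS]EFinM => /le_trans; apply.
rewrite lee_wpmul2l ?lee_fin// /dotp /Rintegral fineK; last first.
  exact: integrable_fin_num (sqint_mul sgx sgx).
by under eq_integral do rewrite -expr2.
Qed.

Let int_sqr_u_le :
  (\int[P]_x (u x ^+ 2)%:E <= t%:E * \int[muP]_z (gt z ^+ 2)%:E)%E.
Proof.
have [mgt _] := sg.
have mg2 : measurable_fun setT (fun z => (gt z ^+ 2)%:E).
  exact/measurable_EFinP/measurable_funX.
have p2 z : (0 <= (gt z ^+ 2)%:E)%E by rewrite lee_fin sqr_ge0.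
have -> : (\int[muP]_z (gt z ^+ 2)%:E = \int[P]_x \int[mu]_s (gt (s, x) ^+ 2)%:E)%E.
  exact: (@fubini_tonelli2 _ _ _ _ R mu P (fun z => (gt z ^+ 2)%:E) mg2 p2).
rewrite -ge0_integralZl//; first last.
- by move=> x _; exact: integral_ge0.
- exact: (@measurable_fun_fubini_tonelli_G _ _ _ _ R mu (fun z => (gt z ^+ 2)%:E) mg2 p2).
apply: ae_ge0_le_integral => //.
- by move=> x _; rewrite lee_fin sqr_ge0.
- exact/measurable_EFinP/measurable_funX/measurable_time_integral.
- by move=> x _; rewrite mule_ge0//; exact: integral_ge0.
- by apply: emeasurable_funM => //; exact: (@measurable_fun_fubini_tonelli_G _ _ _ _ R mu (fun z => (gt z ^+ 2)%:E) mg2 p2).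
- by apply: filterS sqr_u_le => x + _.
Qed.

Lemma sqint_time_integral : sqint P u.
Proof.
split; first exact: measurable_time_integral.
apply: le_lt_trans int_sqr_u_le _; have [_ gy] := sg.
by rewrite lte_mul_pinfty.
Qed.

Lemma dotp_time_integral_le : dotp P u u <= t * dotp muP gt gt.
Proof.
rewrite -lee_fin EFinM /dotp /Rintegral !fineK.
- under eq_integral do rewrite -expr2.
  by under [X in (_ <= _ * X)%E]eq_integral do rewrite -expr2.
- exact: integrable_fin_num (sqint_mul sg sg).
- exact: integrable_fin_num (sqint_mul sqint_time_integral sqint_time_integral).
Qed.

End time_integral.

(** * First two moments of a centred Gaussian law *)

Section gaussian_moments.
Variables (R : realType) (s : R).
Hypothesis s0 : 0 < s.
Notation mu := (@lebesgue_measure R).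
Notation pdf := (normal_pdf 0 s).
Notation nu := (normal_prob 0 s).

Let sn0 : s != 0. Proof. exact: lt0r_neq0. Qed.

(** The Radon-Nikodym density agrees almost everywhere with [normal_pdf], both having the same
    integral over every measurable set. *)
Lemma ge0_integral_normal_prob (f : R -> \bar R) :
  measurable_fun setT f -> (forall x, (0 <= f x)%E) ->
  (\int[nu]_x f x = \int[mu]_x (f x * (pdf x)%:E))%E.
Proof.
move=> mf f0.
have dom := @normal_prob_dominates R 0 s.
rewrite -(Radon_Nikodym_SigmaFinite.change_of_variables dom)//.
have if_ := Radon_Nikodym_SigmaFinite.f_integrable dom.
have mp : measurable_fun setT (EFin \o pdf).
  by apply/measurable_EFinP; exact: measurable_normal_pdf.
apply: ae_eq_integral => //.
- by apply: emeasurable_funM => //; exact: measurable_int if_.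
- exact: emeasurable_funM.
- apply: ae_eqe_mul2l; apply: integral_ae_eq => //.
  by move=> E _ mE; rewrite -(Radon_Nikodym_SigmaFinite.f_integral dom).
Qed.

Lemma ge0_cvg_symmetric_itv (h : R -> R) : measurable_fun setT h ->
  (forall x, 0 <= h x) ->
  (\int[mu]_(x in `[(- n%:R)%R, n%:R%R]) (h x)%:E)%E @[n --> \oo] -->
  (\int[mu]_x (h x)%:E)%E.
Proof.
move=> mh h0.
rewrite (_ : setT = \bigcup_n `[- n%:R, n%:R]%classic :> set R); last first.
  apply/esym/seteqP; split => // x _; exists (Num.truncn `|x|).+1 => //=.
  by rewrite in_itv/= -ler_norml ltW// truncnS_gt.
apply: ge0_nondecreasing_set_cvg_integral => //.
- move=> n k nk; apply/subsetPset => x /=; rewrite !in_itv/= -!ler_norml => /le_trans.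
  by apply; rewrite ler_nat.
- by move=> n; apply: measurable_funTS; exact/measurable_EFinP.
- by move=> n x _; rewrite lee_fin.
Qed.

(* The two integrals are compared on [-n, n], where the difference of the
   integrands has an explicit primitive. *)
Lemma ge0_integral_eq_of_primitive (f g F : R -> R) :
  continuous f -> continuous g -> (forall x, 0 <= f x) -> (forall x, 0 <= g x) ->
  (forall x : R, is_derive x 1 F (f x - g x)) ->
  (F n%:R - F (- n%:R)) @[n --> \oo] --> (0 : R) ->
  (\int[mu]_x (g x)%:E < +oo)%E ->
  (\int[mu]_x (f x)%:E = \int[mu]_x (g x)%:E)%E.
Proof.
move=> cf cg f0 g0 dF F0 gy.
have mf : measurable_fun setT f by exact: continuous_measurable_fun.
have mg : measurable_fun setT g by exact: continuous_measurable_fun.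
have := ge0_cvg_symmetric_itv mf f0.
suff : (\int[mu]_(x in `[(- n%:R)%R, n%:R%R]) (f x)%:E)%E @[n --> \oo] -->
    (\int[mu]_x (g x)%:E)%E.
  by move=> h1 h2; rewrite -(cvg_lim _ h1)// -(cvg_lim _ h2).
have ci (k : R -> R) (a b : R) : continuous k ->
    mu.-integrable `[a, b] (EFin \o k).
  move=> ck; apply: continuous_compact_integrable; first exact: segment_compact.
  exact: continuous_subspaceT.
(* The successor keeps the interval nondegenerate, as the fundamental theorem of calculus
   requires. *)
have E n : (\int[mu]_(x in `[(- n.+1%:R)%R, n.+1%:R%R]) (f x)%:E =
    (F n.+1%:R - F (- n.+1%:R))%R%:E +
    \int[mu]_(x in `[(- n.+1%:R)%R, n.+1%:R%R]) (g x)%:E)%E.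
  rewrite EFinB -(@continuous_FTC2 _ (fun x => f x - g x) F)//.
  - rewrite -integralD//; last 2 first.
    + by apply: (ci (fun x => f x - g x)) => x; apply: cvgB; [exact: cf|exact: cg].
    + exact: ci.
    by apply: eq_integral => x _; rewrite -EFinD subrK.
  - by rewrite (@lt_trans _ _ 0)// oppr_lt0.
  - by apply: continuous_subspaceT => x; apply: cvgB; [exact: cf|exact: cg].
  - have cF x : F y @[y --> x] --> F x.
      by apply: differentiable_continuous; apply/derivable1_diffP; have [] := dF x.
    split; [by move=> x _; have [] := dF x| |].
    + exact: cvg_at_right_filter.
    + exact: cvg_at_left_filter.
  - by move=> x _; rewrite derive1E derive_val.
rewrite -(cvg_shiftS _)/=.
under eq_fun do rewrite E.
rewrite -(add0e (\int[mu]_x (g x)%:E)%E); apply: cvgeD.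
- exact: fin_num_adde_defr.
- apply: cvg_EFin; first exact: nearW.
  by have := F0; rewrite -(cvg_shiftS _).
- by have := ge0_cvg_symmetric_itv mg g0; rewrite -(cvg_shiftS _).
Qed.

Let a : R := (s ^+ 2 *+ 2)^-1.
Let k : R := normal_peak s.
Let e (y : R) : R := expR (- a * y ^+ 2).

Let a0 : 0 < a.
Proof. by rewrite invr_gt0 pmulrn_lgt0// exprn_gt0. Qed.

Let sa : s ^+ 2 * a = 2^-1.
Proof. by rewrite /a -mulr_natr invfM mulrA divff ?mul1r// expf_neq0. Qed.

Let pdfE : pdf = fun y => k * e y.
Proof.
rewrite normal_pdfE//; apply/funext => y; rewrite /normal_fun /e /k /a.
by rewrite subr0 !mulNr [(_ *+ 2)^-1 * _]mulrC.
Qed.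

Let de (y : R) : is_derive y 1 e (- a * (2 * y) * e y).
Proof.
rewrite /e.
have d1 : is_derive y 1 (fun y : R => - a * y ^+ 2) (- a * (2 * y)).
  apply: is_derive_eq; rewrite /GRing.scale/=; ring.
rewrite mulrC; exact: is_derive1_comp.
Qed.

Let ce : continuous e.
Proof.
by move=> y; apply: differentiable_continuous; apply/derivable1_diffP; have [] := de y.
Qed.

Let k0 : 0 <= k. Proof. exact: normal_peak_ge0. Qed.

Let e0 y : 0 <= e y. Proof. exact: expR_ge0. Qed.

Let cvg_e : n%:R * e n%:R @[n --> \oo] --> (0 : R).
Proof.
(* From exp(y) >= 1 + y with y = a n^2, one gets n exp(- a n^2) <= 1 / (a n). *)
apply: (@squeeze_cvgr _ _ _ _ (fun=> 0) (fun n => a^-1 * n%:R^-1)).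
- near=> n; have n0 : 0 < n%:R :> R by rewrite ltr0n; near: n; exact: nbhs_infty_gt.
  rewrite mulr_ge0//= -invfM -[leRHS]div1r ler_pdivlMr ?mulr_gt0//.
  rewrite (_ : _ * _ * _ = e n%:R * (a * n%:R ^+ 2)); last by ring.
  rewrite /e mulNr expRN mulrC ler_pdivrMr ?expR_gt0// mul1r.
  by apply: le_trans (expR_ge1Dx _); rewrite lerDr.
- exact: cvg_cst.
- rewrite -[X in _ --> X](mulr0 a^-1); apply: cvgMr.
  by rewrite -(cvg_shiftS (fun n => n%:R^-1 : R)); exact: cvg_harmonic.
Unshelve. all: by end_near. Qed.

Let cX2 : continuous (fun x : R => x ^+ 2).
Proof. by move=> x; exact: exprn_continuous. Qed.

Let int_pdf (c : R) : 0 <= c -> (\int[mu]_x (c * pdf x)%:E = c%:E)%E.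
Proof.
move=> c0; under eq_integral do rewrite EFinM.
rewrite ge0_integralZl//; last 2 first.
- by apply/measurable_EFinP; exact: measurable_normal_pdf.
- by move=> x _; rewrite lee_fin normal_pdf_ge0.
by rewrite integral_normal_pdf mule1.
Qed.

Let cpdf : continuous pdf.
Proof. exact: continuous_normal_pdf. Qed.

Lemma normal_prob_sqr : (\int[nu]_x (x ^+ 2)%:E = (s ^+ 2)%:E)%E.
Proof.
rewrite ge0_integral_normal_prob; first last.
- by move=> x; rewrite lee_fin sqr_ge0.
- exact/measurable_EFinP/measurable_funX.
under eq_integral do rewrite -EFinM.
rewrite -(int_pdf (sqr_ge0 s)).
(* The primitive is - s^2 x pdf(x), with derivative (x^2 - s^2) pdf(x). *)
apply: (@ge0_integral_eq_of_primitive (fun x => x ^+ 2 * pdf x)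
  (fun x => s ^+ 2 * pdf x) (fun x => - (s ^+ 2 * k) * (x * e x))).
- by move=> x; apply: cvgM; [exact: cX2|exact: cpdf].
- by move=> x; apply: cvgM; [exact: cvg_cst|exact: cpdf].
- by move=> x; rewrite mulr_ge0 ?sqr_ge0 ?normal_pdf_ge0.
- by move=> x; rewrite mulr_ge0 ?sqr_ge0 ?normal_pdf_ge0.
- move=> x; have d := de x; apply: is_derive_eq.
  rewrite /GRing.scale/= pdfE.
  transitivity (- (s ^+ 2 * k) * e x + (s ^+ 2 * a) * 2 * (x ^+ 2 * (k * e x))).
    by ring.
  by rewrite sa mulVf// mul1r mulrA; ring.
- rewrite (_ : (fun n => _) = fun n => - (s ^+ 2 * k) * 2 * (n%:R * e n%:R)).
    by rewrite -[X in _ --> X](mulr0 (- (s ^+ 2 * k) * 2)); exact: cvgMr.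
  by apply/funext => n; rewrite /e sqrrN; ring.
- by rewrite int_pdf ?sqr_ge0 ?ltry.
Qed.

Lemma sqint_normal_prob : sqint nu idfun.
Proof. by split; [exact: measurable_id|rewrite normal_prob_sqr ltry]. Qed.

Lemma Rintegral_normal_prob_sqr : \int[nu]_x x ^+ 2 = s ^+ 2.
Proof. by rewrite /Rintegral normal_prob_sqr. Qed.

Lemma Rintegral_normal_prob_id : \int[nu]_x x = 0.
Proof.
have i2 : nu.-integrable setT (EFin \o (fun x : R => x ^+ 2)).
  exact: sqint_sqr_integrable sqint_normal_prob.
have i1 : nu.-integrable setT (EFin \o (idfun : R -> R)).
  have := sqint_mul sqint_normal_prob (sqint1 nu).
  by congr integrable; apply/funext => x /=; rewrite mulr1.
have ic : nu.-integrable setT (EFin \o (fun x : R => 1 + x ^+ 2)).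
  rewrite (_ : EFin \o _ = ((cst 1%:E : R -> \bar R) \+ (EFin \o (fun x : R => (x ^+ 2)%R)))%E)//.
  apply: integrableD => //.
  exact: finite_measure_integrable_cst.
have h x : 0 <= 1 + x ^+ 2 :> R by rewrite addr_ge0 ?sqr_ge0.
have h' x : 0 <= x + (1 + x ^+ 2) :> R by nra.
(* The comparison by primitives is for nonnegative integrands, so 1 + x^2 is added to x. The
   difference x pdf(x) has the even primitive - s^2 pdf(x), whose values at n and -n cancel. *)
suff E : (\int[nu]_x (x + (1 + x ^+ 2))%:E = \int[nu]_x (1 + x ^+ 2)%:E)%E.
  have := congr1 fine E; rewrite -/(Rintegral _ _ _) -/(Rintegral _ _ _).
  by rewrite RintegralD// => /eqP; rewrite -subr_eq0 addrK => /eqP.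
have mx2 : measurable_fun setT (fun x : R => 1 + x ^+ 2).
  by apply: measurable_funD => //; exact: measurable_funX.
rewrite !ge0_integral_normal_prob; first last.
- by move=> x; rewrite lee_fin.
- by apply/measurable_EFinP; exact: measurable_funD.
- by move=> x; rewrite lee_fin.
- exact/measurable_EFinP.
under eq_integral do rewrite -EFinM.
under [RHS]eq_integral do rewrite -EFinM.
have c1 : continuous (fun x : R => 1 + x ^+ 2).
  by move=> x; apply: cvgD; [exact: cvg_cst|exact: cX2].
apply: (@ge0_integral_eq_of_primitive (fun x => (x + (1 + x ^+ 2)) * pdf x)
  (fun x => (1 + x ^+ 2) * pdf x) (fun x => - (s ^+ 2 * k) * e x)).
- move=> x; apply: cvgM; last exact: cpdf.
  by apply: cvgD; [exact: cvg_id|exact: c1].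
- by move=> x; apply: cvgM; [exact: c1|exact: cpdf].
- by move=> x; rewrite mulr_ge0 ?normal_pdf_ge0.
- by move=> x; rewrite mulr_ge0 ?normal_pdf_ge0.
- move=> x; have d := de x; apply: is_derive_eq.
  rewrite /GRing.scale/= pdfE.
  transitivity ((s ^+ 2 * a) * 2 * (x * (k * e x))); first by ring.
  by rewrite sa mulVf// mul1r; ring.
- rewrite (_ : (fun n => _) = fun=> 0); first exact: cvg_cst.
  by apply/funext => n; rewrite /e sqrrN subrr.
under eq_integral do rewrite EFinM.
rewrite -ge0_integral_normal_prob; last 2 first.
- exact/measurable_EFinP.
- by move=> x; rewrite lee_fin.
case/integrableP : ic => _; congr (_ < _)%E.
by apply: eq_integral => x _; rewrite /= ger0_norm.
Qed.

End gaussian_moments.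

(** * Expectation of a product of independent variables *)

Section independence.
Context d (Omega : measurableType d) (R : realType) (P : probability Omega R).
Variables (X Y : Omega -> R) (nu : probability (measurableTypeR R) R).
Hypotheses (mX : measurable_fun setT X) (mY : measurable_fun setT Y).
Hypothesis XY : forall A B : set R, measurable A -> measurable B ->
  P (X @^-1` A `&` Y @^-1` B) = (P (X @^-1` A) * nu B)%E.

(** The joint law of [X] and [Y] is the product of the law of [X] with [nu], because the two agree
    on rectangles; Fubini then factors the expectation. *)
Lemma indep_integral (h : R -> R) :
  P.-integrable setT (EFin \o X) -> nu.-integrable setT (EFin \o h) ->
  P.-integrable setT (EFin \o (fun x => X x * h (Y x))) /\
  \int[P]_x (X x * h (Y x)) = (\int[P]_x X x) * (\int[nu]_y h y).
Proof.
move=> iX ih.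
have mh : measurable_fun setT h by apply/measurable_EFinP; exact: measurable_int ih.
pose T := measurableTypeR R.
have mXT : measurable_fun setT (X : Omega -> T) by exact: mX.
have mYT : measurable_fun setT (Y : Omega -> T) by exact: mY.
pose X' : {mfun Omega >-> T} :=
  HB.pack (X : Omega -> T) (isMeasurableFun.Build _ _ _ _ _ mXT).
have mXY : measurable_fun setT ((fun x => (X x, Y x)) : Omega -> (T * T)%type).
  exact: measurable_fun_pair.
pose XY' : {mfun Omega >-> (T * T)%type} :=
  HB.pack ((fun x => (X x, Y x)) : Omega -> (T * T)%type) (isMeasurableFun.Build _ _ _ _ _ mXY).
pose mX' := distribution P X'; pose pi := distribution P XY'.
have piE (Z : set (T * T)) : measurable Z -> (mX' \x nu)%E Z = pi Z.
  apply: (@product_measure_unique _ _ _ _ R mX' nu pi) => A B mA mB.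
  by rewrite /pi /distribution /pushforward/= -XY.
have imX : mX'.-integrable setT (EFin \o (idfun : R -> R)).
  apply/integrableP; split.
    by apply/measurable_EFinP; exact: measurable_id.
  rewrite ge0_integral_distribution//; last first.
    by apply: measurableT_comp => //; apply/measurable_EFinP; exact: measurable_id.
  by have /integrableP[] := iX.
pose f (z : T * T) : R := z.1 * h z.2.
have mf : measurable_fun setT f.
  by apply: measurable_funM => //; exact: measurableT_comp.
have if_ : (mX' \x nu)%E.-integrable setT (EFin \o f).
  exact: (@integrable_prod _ _ T T R mX' nu idfun h imX ih).
have iXY : P.-integrable setT ((EFin \o f) \o XY').
  apply/integrableP; split.
    by apply/measurable_EFinP; exact: measurableT_comp.
  have /integrableP[_] := if_; congr (_ < _)%E.
  rewrite (@eq_measure_integral _ _ _ _ pi)//; last by move=> A mA _; exact: piE.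
  rewrite ge0_integral_distribution//.
  by apply: measurableT_comp => //; exact/measurable_EFinP.
split => //.
transitivity (\int[(mX' \x nu)%E]_z f z); last first.
  rewrite [LHS](@Rintegral_prod _ _ T T R mX' nu idfun h imX ih).
  congr (_ * _); rewrite /Rintegral; congr fine.
  by rewrite integral_distribution//; apply/measurable_EFinP; exact: measurable_id.
rewrite /Rintegral; congr fine.
rewrite (@eq_measure_integral _ _ _ _ pi)//; last by move=> A mA _; exact: piE.
by rewrite integral_distribution//; exact/measurable_EFinP.
Qed.

End independence.

(** * Adapted random variables and Wiener increments *)

Section adapted.
Context d (Omega : measurableType d) (R : realType).
Variable F : R -> set (set Omega).
Hypothesis HF : filtration F.
Implicit Types (t : R) (X Y : Omega -> R).

(** Adaptedness becomes ordinary measurability for a generated sigma-algebra, so that stability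
    under arithmetic operations is inherited. *)
Lemma sub_measurableP t X : 0 <= t ->
  sub_measurable F t X <->
  measurable_fun setT (X : g_sigma_algebraType (F t) -> R).
Proof.
move=> t0; have [sF _ _] := HF; have FE := sigma_algebra_id (sF t t0).
split=> [h _ A mA|h A mA].
  by rewrite setTI; apply: sub_sigma_algebra; exact: h.
by have := h measurableT A mA; rewrite setTI /measurable/= FE.
Qed.

Lemma sub_measurable_measurable t X : 0 <= t -> sub_measurable F t X ->
  measurable_fun setT X.
Proof. by move=> t0 h _ A mA; rewrite setTI; have [_ H _] := HF; apply: (H t) => //; exact: h. Qed.

Lemma sub_measurable_mono s t X : 0 <= s -> s <= t ->
  sub_measurable F s X -> sub_measurable F t X.
Proof. by move=> s0 st h A mA; have [_ _ H] := HF; apply: (H s t) => //; exact: h. Qed.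

Lemma sub_measurableM t X Y : 0 <= t -> sub_measurable F t X ->
  sub_measurable F t Y -> sub_measurable F t (fun x => X x * Y x).
Proof.
move=> t0 /(sub_measurableP _ t0) mX /(sub_measurableP _ t0) mY.
by apply/(sub_measurableP _ t0); exact: measurable_funM.
Qed.

Lemma sub_measurableB t X Y : 0 <= t -> sub_measurable F t X ->
  sub_measurable F t Y -> sub_measurable F t (fun x => X x - Y x).
Proof.
move=> t0 /(sub_measurableP _ t0) mX /(sub_measurableP _ t0) mY.
by apply/(sub_measurableP _ t0); exact: measurable_funB.
Qed.

End adapted.

Section increments.
Context d (Omega : measurableType d) (R : realType) (P : probability Omega R).
Variables (F : R -> set (set Omega)) (m : nat) (w : 'I_m -> R -> Omega -> R).
Hypotheses (HF : filtration F) (Hw : wiener_process P F w).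

Definition incr k (s t : R) (x : Omega) : R := w k t x - w k s x.

Lemma sub_measurable_incr k s t : 0 <= s -> s <= t ->
  sub_measurable F t (incr k s t).
Proof.
move=> s0 st; have [_ aw _ _] := Hw; have t0 := le_trans s0 st.
apply: sub_measurableB => //; first exact: aw.
by apply: sub_measurable_mono st _ => //; exact: aw.
Qed.

Lemma measurable_incr k s t : 0 <= s -> s <= t -> measurable_fun setT (incr k s t).
Proof.
move=> s0 st; apply: (sub_measurable_measurable HF (le_trans s0 st)).
exact: sub_measurable_incr.
Qed.

Lemma incr_indep (k : 'I_m) (s t : R) (X : Omega -> R) : 0 <= s -> s < t -> sub_measurable F s X ->
  forall A B : set R, measurable A -> measurable B ->
  P (X @^-1` A `&` incr k s t @^-1` B) =
  (P (X @^-1` A) * normal_prob 0 (Num.sqrt (t - s)) B)%E.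
Proof.
move=> s0 st hX A B mA mB; have [_ _ hw _] := Hw.
have := hw s t s0 st (X @^-1` A) (fun j => if j == k then B else setT) (hX A mA).
rewrite (bigD1 k)//= eqxx big1 ?mule1; last first.
  by move=> j /negbTE ->; rewrite probability_setT.
move=> <-; last by move=> j; case: ifP.
congr (P (_ `&` _)); apply/seteqP; split => x /=.
  by move=> Bx j; case: eqP => // ->.
by move=> /(_ k); rewrite eqxx.
Qed.

(** For the cross terms between two components of [w]. The product of [X] with the k-th increment
    need not be measurable at time s, so [incr_indep] does not apply to it. On the events fixing [X]
    and the k-th increment separately, the factorisation is the Wiener property; these events form a
    pi-system, and the measures [P] restricted to the l-th event and [P] scaled by [c] agree on what
    it generates. *)
Lemma incr_indep2 (k l : 'I_m) (s t : R) (X : Omega -> R) : k != l -> 0 <= s -> s < t -> sub_measurable F s X ->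
  forall A B : set R, measurable A -> measurable B ->
  P ((fun x => X x * incr k s t x)%R @^-1` A `&` incr l s t @^-1` B) =
  (P ((fun x => X x * incr k s t x)%R @^-1` A) * normal_prob 0 (Num.sqrt (t - s)) B)%E.
Proof.
move=> kl s0 st hX A B mA mB; have [_ _ hw _] := Hw.
have mX := sub_measurable_measurable HF s0 hX.
have mk := measurable_incr k s0 (ltW st).
have ml := measurable_incr l s0 (ltW st).
have mD : measurable (incr l s t @^-1` B) by rewrite -[_ @^-1` _]setTI; exact: ml.
pose G := [set X @^-1` E.1 `&` incr k s t @^-1` E.2 | E in
  [set E : set R * set R | measurable E.1 /\ measurable E.2]].
pose c : {nonneg R} := NngNum (fine_ge0 (measure_ge0 (normal_prob 0 (Num.sqrt (t - s))) B)).
have cE : c%:num%:E = normal_prob 0 (Num.sqrt (t - s)) B.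
  by rewrite /= fineK// fin_num_measure.
have GX : measurable_fun setT (X : g_sigma_algebraType G -> R).
  move=> _ E mE; rewrite setTI; apply: sub_sigma_algebra.
  by exists (E, setT) => //=; rewrite preimage_setT setIT.
have GY : measurable_fun setT (incr k s t : g_sigma_algebraType G -> R).
  move=> _ E mE; rewrite setTI; apply: sub_sigma_algebra.
  by exists (setT, E) => //=; rewrite preimage_setT setTI.
have mM : measurable_fun setT
    ((fun x => X x * incr k s t x) : g_sigma_algebraType G -> R).
  exact: measurable_funM.
have GA : <<s G >> ((fun x => X x * incr k s t x)%R @^-1` A).
  by have := mM measurableT A mA; rewrite setTI.
rewrite [RHS]muleC -cE.
apply: (@g_sigma_algebra_measure_unique _ _ _ G _ (fun=> setT) _ _
  (mrestr P mD) (mscale c P) _ _ _ _ GA).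
- move=> _ [E [mE1 mE2] <-]; apply: measurableI.
  + by rewrite -[_ @^-1` _]setTI; exact: mX.
  + by rewrite -[_ @^-1` _]setTI; exact: mk.
- by move=> _; exists (setT, setT) => //=; rewrite !preimage_setT setIT.
- by rewrite bigcup_const.
- move=> _ _ [E [mE1 mE2] <-] [E' [mE1' mE2'] <-].
  exists (E.1 `&` E'.1, E.2 `&` E'.2); first by split; exact: measurableI.
  by rewrite /= !preimage_setI setIACA.
- move=> _ [E [mE1 mE2] <-].
  rewrite /mrestr /mscale cE; cbv beta; rewrite [RHS]muleC.
  transitivity ((P (X @^-1` E.1) * normal_prob 0 (Num.sqrt (t - s)) E.2) *
    normal_prob 0 (Num.sqrt (t - s)) B)%E; last first.
    by have <- := incr_indep k s0 st hX mE1 mE2; rewrite ?cE.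
  have := hw s t s0 st (X @^-1` E.1)
    (fun j => if j == k then E.2 else if j == l then B else setT) (hX _ mE1).
  rewrite (bigD1 k)//= eqxx (bigD1 l)/= 1?eq_sym// (negbTE kl) eqxx.
  rewrite big1 ?mule1; last first.
    by move=> j /andP[/negbTE -> /negbTE ->]; rewrite probability_setT.
  rewrite muleA => <-; last by move=> j; do 2 case: ifP => //.
  congr (P _); apply/seteqP; split => x /=.
    move=> [[EX Ek] El]; split => // j; case: eqP => [->//|_].
    by case: eqP => // ->.
  move=> [EX EE]; split; first by split => //; have := EE k; rewrite eqxx.
  by have := EE l; rewrite eq_sym (negbTE kl) eqxx.
- by move=> _; rewrite /mrestr; apply: le_lt_trans (probability_le1 _ _) (ltry _); rewrite setTI.
Qed.

End increments.

(** * Isometry for simple processes *)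

Section isometry.
Context d (Omega : measurableType d) (R : realType) (P : probability Omega R).
Variables (F : R -> set (set Omega)) (m : nat) (w : 'I_m -> R -> Omega -> R).
Hypotheses (HF : filtration F) (Hw : wiener_process P F w).
Notation mu := (@lebesgue_measure R).
Notation muP := (mu \x P)%E.
Notation incr := (incr w).

Lemma sqint_bounded_mul (X Y : Omega -> R) : measurable_fun setT X ->
  (exists M : R, forall x, `|X x| <= M) -> sqint P Y ->
  sqint P (fun x => X x * Y x).
Proof.
move=> mX [M XM] sY; have [mY Yy] := sY.
split; first exact: measurable_funM.
apply: le_lt_trans (proj2 (sqintZ M sY)).
apply: ge0_le_integral => //.
- by move=> x _; rewrite lee_fin sqr_ge0.
- by apply/measurable_EFinP; apply: measurable_funX; exact: measurable_funM.
- by apply/measurable_EFinP; apply: measurable_funX; exact: measurable_funM.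
- move=> x _; rewrite lee_fin !exprMn ler_wpM2r ?sqr_ge0//.
  by rewrite -[leLHS]real_normK ?num_real// ler_sqr ?nnegrE// (le_trans _ (XM x)).
Qed.

Lemma sqint_cst (c : R) : sqint P (fun=> c).
Proof.
rewrite (_ : (fun=> c) = (fun=> c * 1)); first exact: sqintZ (sqint1 P).
by apply/funext => x; rewrite mulr1.
Qed.

Lemma dotp1 (X : Omega -> R) : dotp P X (fun=> 1) = \int[P]_x X x.
Proof. by apply: eq_Rintegral => x _; rewrite mulr1. Qed.

Let sqint_integrable (X : Omega -> R) : sqint P X -> P.-integrable setT (EFin \o X).
Proof.
move=> sX; have := sqint_mul sX (sqint1 P).
by congr integrable; apply/funext => x /=; rewrite mulr1.
Qed.

Lemma incr_id k s : incr k s s = fun=> 0.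
Proof. by apply/funext => x; rewrite /incr subrr. Qed.

Section moments.
Variables (s t : R).
Hypotheses (s0 : 0 <= s) (st : s < t).
Let v := Num.sqrt (t - s).
Let v0 : 0 < v. Proof. by rewrite sqrtr_gt0 subr_gt0. Qed.
Let v2 : v ^+ 2 = t - s. Proof. by rewrite sqr_sqrtr// subr_ge0 ltW. Qed.

Let i2 : (normal_prob 0 v).-integrable setT (EFin \o (fun x : R => x ^+ 2)).
Proof. exact: sqint_sqr_integrable (sqint_normal_prob v0). Qed.

Let i1 : (normal_prob 0 v).-integrable setT (EFin \o (idfun : R -> R)).
Proof.
have := sqint_mul (sqint_normal_prob v0) (sqint1 _).
by congr integrable; apply/funext => x /=; rewrite mulr1.
Qed.

Let sub_measurable_cst (c : R) : sub_measurable F s (fun=> c).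
Proof. by apply/(sub_measurableP HF _ s0); exact: measurable_cst. Qed.

Lemma sqint_incr_lt k : sqint P (incr k s t).
Proof.
have mk := measurable_incr HF Hw k s0 (ltW st).
apply: integrable_sqint => //.
have [+ _] := indep_integral (measurable_cst (1 : R)) mk
  (incr_indep Hw k s0 st (sub_measurable_cst 1)) (sqint_integrable (sqint1 P)) i2.
by congr integrable; apply/funext => x /=; rewrite mul1r.
Qed.

Lemma dotp_incr_lt k (X : Omega -> R) : sub_measurable F s X -> sqint P X ->
  dotp P X (incr k s t) = 0.
Proof.
move=> hX sX; have mk := measurable_incr HF Hw k s0 (ltW st).
have [mX _] := sX.
have [_] := indep_integral mX mk (incr_indep Hw k s0 st hX) (sqint_integrable sX) i1.
by rewrite Rintegral_normal_prob_id// mulr0.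
Qed.

Lemma Rintegral_incr2_lt k l (X : Omega -> R) : sub_measurable F s X ->
  (exists M : R, forall x, `|X x| <= M) ->
  \int[P]_x (X x * incr k s t x * incr l s t x) =
  (k == l)%:R * (t - s) * \int[P]_x X x.
Proof.
move=> hX bX.
have mX := sub_measurable_measurable HF s0 hX.
have sX : sqint P X.
  rewrite (_ : X = fun x => X x * 1); first exact: sqint_bounded_mul (sqint1 P).
  by apply/funext => x; rewrite mulr1.
have mk := measurable_incr HF Hw k s0 (ltW st).
have ml := measurable_incr HF Hw l s0 (ltW st).
case: eqVneq => [<-|kl].
  have [_] := indep_integral mX mk (incr_indep Hw k s0 st hX) (sqint_integrable sX) i2.
  rewrite Rintegral_normal_prob_sqr// v2 mul1r mulrC => <-.
  by apply: eq_Rintegral => x _; rewrite -mulrA -expr2.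
have sXk := sqint_bounded_mul mX bX (sqint_incr_lt k).
have [_] := indep_integral (proj1 sXk) ml (incr_indep2 HF Hw kl s0 st hX)
  (sqint_integrable sXk) i1.
by rewrite Rintegral_normal_prob_id// mulr0 !mul0r.
Qed.

End moments.

Lemma sqint_incr k s t : 0 <= s -> s <= t -> sqint P (incr k s t).
Proof.
move=> s0; rewrite le_eqVlt => /predU1P[<-|st]; last exact: sqint_incr_lt.
by rewrite incr_id; exact: sqint0.
Qed.

Lemma dotp_incr k s t X : 0 <= s -> s <= t -> sub_measurable F s X ->
  sqint P X -> dotp P X (incr k s t) = 0.
Proof.
move=> s0; rewrite le_eqVlt => /predU1P[<-|st] hX sX; last exact: dotp_incr_lt.
by rewrite incr_id dotpC dotp0l.
Qed.

Definition bounded_at (s : R) (X : Omega -> R) :=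
  sub_measurable F s X /\ exists M : R, forall x, `|X x| <= M.

Lemma bounded_atM s X Y : 0 <= s -> bounded_at s X -> bounded_at s Y ->
  bounded_at s (fun x => X x * Y x).
Proof.
move=> s0 [hX [M XM]] [hY [K YK]]; split; first exact: sub_measurableM.
by exists (M * K) => x; rewrite normrM ler_pM.
Qed.

Lemma bounded_at_mono s t X : 0 <= s -> s <= t -> bounded_at s X -> bounded_at t X.
Proof. by move=> s0 st [hX bX]; split => //; exact: sub_measurable_mono hX. Qed.

Lemma bounded_at_measurable s X : 0 <= s -> bounded_at s X -> measurable_fun setT X.
Proof. by move=> s0 [hX _]; exact: sub_measurable_measurable hX. Qed.

Lemma sqint_bounded_at s X Y : 0 <= s -> bounded_at s X -> sqint P Y ->
  sqint P (fun x => X x * Y x).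
Proof.
move=> s0 bX; have mX := bounded_at_measurable s0 bX.
by apply: sqint_bounded_mul => //; have [] := bX.
Qed.

Lemma bounded_at_sqint s X : 0 <= s -> bounded_at s X -> sqint P X.
Proof.
move=> s0 bX; rewrite (_ : X = fun x => X x * 1).
  exact: (sqint_bounded_at s0 bX (sqint1 P)).
by apply/funext => x; rewrite mulr1.
Qed.

Lemma Rintegral_incr2 k l s t X : 0 <= s -> s <= t -> bounded_at s X ->
  \int[P]_x (X x * incr k s t x * incr l s t x) =
  (k == l)%:R * (t - s) * \int[P]_x X x.
Proof.
move=> s0; rewrite le_eqVlt => /predU1P[<-|st] [hX bX].
  rewrite subrr mulr0 mul0r incr_id.
  by under eq_Rintegral do rewrite mulr0 mul0r; rewrite Rintegral_cst// mul0r.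
exact: Rintegral_incr2_lt.
Qed.

Lemma dotp_indic_itv_oc (a b c e : R) : a <= c -> c <= e ->
  dotp mu (\1_`]a, b]) (\1_`]c, e]) = if b <= c then 0 else Num.min b e - c.
Proof.
move=> ac ce; rewrite /dotp /Rintegral.
case: (leP b c) => bc.
  rewrite integral0_eq// => x _; rewrite !indicE !mem_setE !in_itv/=.
  case: (ltP c x) => cx; rewrite ?mulr0//=.
  by rewrite (_ : x <= b = false) ?andbF ?mul0r//; apply/negbTE; rewrite -ltNge (le_lt_trans bc).
have cm : c <= Num.min b e by rewrite le_min (ltW bc).
rewrite (_ : (fun _ => _) = (fun x => (\1_`]c, Num.min b e] x)%:E)).
  rewrite integral_indic//= setIT lebesgue_measure_itv/= lte_fin.
  by move: cm; rewrite le_eqVlt => /predU1P[<-|->]; rewrite ?ltxx ?subrr.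
apply/funext => x; rewrite !indicE !mem_setE !in_itv/= le_min.
case: (ltP c x) => cx; rewrite ?mulr0//= (le_lt_trans ac cx)/=.
by do 2 case: (_ <= _); rewrite ?mulr0 ?mulr1.
Qed.

(** The increments are cut at [c] and at the smaller of [b] and [e]. Pieces over disjoint intervals
    are orthogonal, so only the common interval contributes, with its length as variance. *)
Lemma dotp_elem_le k l a b c e X Y : 0 <= a -> a <= b -> a <= c -> c <= e ->
  bounded_at a X -> bounded_at c Y ->
  dotp P (fun x => X x * incr k a b x) (fun x => Y x * incr l c e x) =
  (k == l)%:R * (dotp mu (\1_`]a, b]) (\1_`]c, e]) * dotp P X Y).
Proof.
move=> a0 ab ac ce bX bY.
have c0 := le_trans a0 ac.
have bXc := bounded_at_mono a0 ac bX.
have bXY := bounded_atM c0 bXc bY.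
have s1 u v k' : 0 <= u -> u <= v -> sqint P (fun x => X x * incr k' u v x).
  by move=> u0 uv; apply: (sqint_bounded_at a0 bX); exact: sqint_incr.
have s2 u v k' : 0 <= u -> u <= v -> sqint P (fun x => Y x * incr k' u v x).
  by move=> u0 uv; apply: (sqint_bounded_at c0 bY); exact: sqint_incr.
(* an increment is orthogonal to the past *)
have orth k' l' u v u' v' : a <= u -> u <= v -> v <= u' -> c <= u' -> u' <= v' ->
    dotp P (fun x => X x * incr k' u v x) (fun x => Y x * incr l' u' v' x) = 0.
  move=> au uv vu' cu' uv'; have u0 := le_trans a0 au; have v0 := le_trans u0 uv.
  have u'0 := le_trans v0 vu'.
  have s3 : sqint P (fun x => Y x * (X x * incr k' u v x)).
    by apply: (sqint_bounded_at c0 bY); exact: s1.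
  rewrite -[RHS](dotp_incr l' u'0 uv' _ s3); last first.
    apply: sub_measurableM => //.
      by apply: sub_measurable_mono cu' _ => //; have [] := bY.
    apply: sub_measurableM => //.
      by apply: sub_measurable_mono (le_trans au (le_trans uv vu')) _ => //; have [] := bX.
    by apply: (@sub_measurable_mono _ _ _ _ HF v) => //; exact: (sub_measurable_incr HF Hw).
  by apply: eq_Rintegral => x _; ring.
have orth' k' l' u v u' v' : a <= u -> u <= v -> v' <= u -> c <= u' -> u' <= v' ->
    dotp P (fun x => X x * incr k' u v x) (fun x => Y x * incr l' u' v' x) = 0.
  move=> au uv vu' cu' uv'; have u'0 := le_trans c0 cu'; have v'0 := le_trans u'0 uv'.
  have u0 := le_trans a0 au.
  have s3 : sqint P (fun x => X x * (Y x * incr l' u' v' x)).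
    by apply: (sqint_bounded_at a0 bX); exact: s2.
  rewrite -[RHS](dotp_incr k' u0 uv _ s3); last first.
    apply: sub_measurableM => //.
      by apply: sub_measurable_mono au _ => //; have [] := bX.
    apply: sub_measurableM => //.
      apply: sub_measurable_mono (le_trans cu' (le_trans uv' vu')) _ => //.
      by have [] := bY.
    by apply: (@sub_measurable_mono _ _ _ _ HF v') => //; exact: (sub_measurable_incr HF Hw).
  by apply: eq_Rintegral => x _; ring.
rewrite dotp_indic_itv_oc//; case: (leP b c) => bc.
  by rewrite mul0r mulr0; exact: orth.
have cb := ltW bc; set g := Num.min b e.
have cg : c <= g by rewrite le_min cb.
have gb : g <= b by rewrite ge_min lexx.
have ge : g <= e by rewrite ge_min lexx orbT.
have split1 : (fun x => X x * incr k a b x) = (fun x => X x * incr k a c x +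
    (X x * incr k c g x + X x * incr k g b x)).
  by apply/funext => x; rewrite /incr; ring.
have split2 : (fun x => Y x * incr l c e x) =
    (fun x => Y x * incr l c g x + Y x * incr l g e x).
  by apply/funext => x; rewrite /incr; ring.
have g0 := le_trans c0 cg; have ag := le_trans ac cg.
rewrite split1 dotpDl; last 3 first.
- exact: s1.
- by apply: sqintD; exact: s1.
- exact: s2.
rewrite orth// add0r split2 dotpDl; last 3 first.
- exact: s1.
- exact: s1.
- by apply: sqintD; exact: s2.
rewrite !dotpDr; try exact: s1; try exact: s2.
rewrite (orth _ _ c g g e)// (orth' _ _ g b c g)//.
(* Since [g] is [b] or [e], one of these two increments is over an empty interval. *)
have -> : dotp P (fun x => X x * incr k g b x) (fun x => Y x * incr l g e x) = 0.
  rewrite /g; case: (leP b e) => be.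
    rewrite incr_id (_ : (fun x => X x * 0) = (fun=> 0)) ?dotp0l//.
    by apply/funext => x; rewrite mulr0.
  rewrite incr_id dotpC (_ : (fun x => Y x * 0) = (fun=> 0)) ?dotp0l//.
  by apply/funext => x; rewrite mulr0.
rewrite !addr0 mulrA -Rintegral_incr2//.
by apply: eq_Rintegral => x _; ring.
Qed.

Lemma dotp_elem k l a b c e X Y : 0 <= a -> a <= b -> 0 <= c -> c <= e ->
  bounded_at a X -> bounded_at c Y ->
  dotp P (fun x => X x * incr k a b x) (fun x => Y x * incr l c e x) =
  (k == l)%:R * dotp muP (fun z => \1_`]a, b] z.1 * X z.2)
                         (fun z => \1_`]c, e] z.1 * Y z.2).
Proof.
move=> a0 ab c0 ce bX bY.
have sX : sqint P X.
  exact: bounded_at_sqint a0 bX.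
have sY : sqint P Y.
  exact: bounded_at_sqint c0 bY.
have i1 := sqint_indic_itv a b false false.
have i2 := sqint_indic_itv c e false false.
rewrite (@dotp_prod _ _ _ _ R mu P \1_`]a, b] \1_`]c, e] X Y)//.
case: (leP a c) => ac; first exact: dotp_elem_le.
by rewrite dotpC eq_sym (dotpC mu) (dotpC P X Y) dotp_elem_le// ltW.
Qed.

Section simple_integrals.
Implicit Types (S : simple_process F) (t : R).

Definition sp_trunc S t (z : R * Omega) : R := sp_value S z.1 z.2 * \1_`[0, t] z.1.

(** Stopping at [t] keeps each term elementary. One triple has to describe both the integral and the
    integrand, so that [dotp_elem] can compare them; if [t] precedes the cell, the interval is the
    empty one at the grid point, where the coefficient is known to be adapted. *)
Lemma sp_term S k t (j : nat) : 0 <= t -> exists a b X,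
  [/\ 0 <= a, a <= b, bounded_at a X,
      (fun x => sp_coef S j x * (w k (Num.min t (sp_grid S j.+1)) x
                                 - w k (Num.min t (sp_grid S j)) x)) =
      (fun x => X x * incr k a b x) &
      (fun z : R * Omega => sp_coef S j z.2 * \1_(`]sp_grid S j, sp_grid S j.+1]) z.1
                           * \1_`[0, t] z.1) =
      (fun z => \1_`]a, b] z.1 * X z.2)].
Proof.
move=> t0.
have g0 : forall i, 0 <= sp_grid S i.
  elim => [|i ih]; first exact: sp_grid_ge0.
  exact: le_trans ih (sp_grid_nd S i).
have gj := sp_grid_nd S j.
have bX : bounded_at (sp_grid S j) (sp_coef S j).
  by split; [exact: sp_coef_measurable|exact: sp_coef_bounded].
have [tg|gt] := leP t (sp_grid S j).
  exists (sp_grid S j), (sp_grid S j), (sp_coef S j); split => //.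
    by apply/funext => x /=; rewrite (min_l (le_trans tg gj)) /incr !subrr.
  apply/funext => z; rewrite !indicE !mem_setE !in_itv/=.
  case: (ltP (sp_grid S j) z.1) => gz /=; last by rewrite mulr0 !mul0r.
  rewrite (_ : (z.1 <= t) = false); last by rewrite leNgt (le_lt_trans tg gz).
  by rewrite andbF mulr0 mul0r.
exists (sp_grid S j), (Num.min t (sp_grid S j.+1)), (sp_coef S j); split => //.
  by rewrite le_min (ltW gt).
apply/funext => z; rewrite !indicE !mem_setE !in_itv/= le_min.
case: (ltP (sp_grid S j) z.1) => gz /=; last by rewrite mulr0 !mul0r.
rewrite (ltW (le_lt_trans (g0 j) gz))/= mulrC [sp_coef _ _ _ * _]mulrC mulrA.
by do 2 case: (_ <= _) => /=; rewrite ?mulr0 ?mul0r ?mul1r.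
Qed.

Let sqint_elem k a b X : 0 <= a -> a <= b -> bounded_at a X ->
  sqint P (fun x => X x * incr k a b x).
Proof. by move=> a0 ab bX; apply: (sqint_bounded_at a0 bX); exact: sqint_incr. Qed.

Let sqint_elem_prod (a b : R) X : 0 <= a -> bounded_at a X ->
  sqint muP (fun z => \1_`]a, b] z.1 * X z.2).
Proof.
move=> a0 bX.
apply: (@sqint_prod _ _ _ _ R mu P \1_`]a, b] X); first exact: sqint_indic_itv.
exact: bounded_at_sqint a0 bX.
Qed.

Let sp_integralE S k t : sp_integral (w k) S t = fun x => \sum_(j < sp_size S)
  (fun x => sp_coef S j x * (w k (Num.min t (sp_grid S j.+1)) x
                                 - w k (Num.min t (sp_grid S j)) x)) x.
Proof. by apply/funext => x. Qed.

Let sp_truncE S t : sp_trunc S t = fun z => \sum_(j < sp_size S)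
  (fun z : R * Omega => sp_coef S j z.2 * \1_(`]sp_grid S j, sp_grid S j.+1]) z.1
                           * \1_`[0, t] z.1) z.
Proof. by apply/funext => z; rewrite /sp_trunc /sp_value mulr_suml. Qed.

Lemma sqint_sp_integral S k t : 0 <= t -> sqint P (sp_integral (w k) S t).
Proof.
move=> t0; rewrite sp_integralE; apply: sqint_sum => j.
by have [a [b [X [a0 ab bX -> _]]]] := sp_term S k j t0; exact: sqint_elem.
Qed.

Lemma sqint_sp_trunc S (k : 'I_m) t : 0 <= t -> sqint muP (sp_trunc S t).
Proof.
move=> t0; rewrite sp_truncE; apply: sqint_sum => j.
by have [a [b [X [a0 ab bX _ ->]]]] := sp_term S k j t0; exact: sqint_elem_prod.
Qed.

Lemma dotp_sp_integral S S' k l t t' : 0 <= t -> 0 <= t' ->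
  dotp P (sp_integral (w k) S t) (sp_integral (w l) S' t') =
  (k == l)%:R * dotp muP (sp_trunc S t) (sp_trunc S' t').
Proof.
move=> t0 t'0; rewrite !sp_integralE !sp_truncE.
have h1 S0 k0 s : 0 <= s -> forall j : nat,
  sqint P (fun x => sp_coef S0 j x * (w k0 (Num.min s (sp_grid S0 j.+1)) x
                                 - w k0 (Num.min s (sp_grid S0 j)) x)).
  by move=> s0 j; have [a [b [X [a0 ab bX -> _]]]] := sp_term S0 k0 j s0; exact: sqint_elem.
have h2 S0 s : 0 <= s -> forall j : nat,
  sqint muP (fun z : R * Omega => sp_coef S0 j z.2 *
     \1_(`]sp_grid S0 j, sp_grid S0 j.+1]) z.1 * \1_`[0, s] z.1).
  by move=> s0 j; have [a [b [X [a0 ab bX _ ->]]]] := sp_term S0 k j s0; exact: sqint_elem_prod.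
rewrite dotp_suml; [|by move=> j; exact: h1|by apply: sqint_sum => j; exact: h1].
rewrite dotp_suml; [|by move=> j; exact: h2|by apply: sqint_sum => j; exact: h2].
rewrite mulr_sumr; apply: eq_bigr => j _.
rewrite dotp_sumr; [|by move=> i; exact: h1|exact: h1].
rewrite dotp_sumr; [|by move=> i; exact: h2|exact: h2].
rewrite mulr_sumr; apply: eq_bigr => i _.
have [a [b [X [a0 ab bX -> ->]]]] := sp_term S k j t0.
have [c [e [Y [c0 ce bY -> ->]]]] := sp_term S' l i t'0.
exact: dotp_elem.
Qed.

Lemma dotp_sp_integral1 S k t : 0 <= t -> dotp P (sp_integral (w k) S t) (fun=> 1) = 0.
Proof.
move=> t0; rewrite sp_integralE dotp_suml; last 2 first.
- by move=> j; have [a [b [X [a0 ab bX -> _]]]] := sp_term S k j t0; exact: sqint_elem.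
- exact: sqint1.
apply: big1 => j _; have [a [b [X [a0 ab bX -> _]]]] := sp_term S k j t0.
rewrite dotp1.
rewrite -[RHS](@dotp_incr k a b X)//; first by have [] := bX.
exact: bounded_at_sqint a0 bX.
Qed.

End simple_integrals.

End isometry.

(** * Itô isometry *)

Section ito_isometry.
Context d (Omega : measurableType d) (R : realType) (P : probability Omega R).
Notation mu := (@lebesgue_measure R).
Notation muP := (mu \x P)%E.

Definition trunc (h : R -> Omega -> R) (t : R) (z : R * Omega) : R :=
  h z.1 z.2 * \1_`[0, t] z.1.

Lemma expectationE (X : Omega -> R) : ('E_P[X] = \int[P]_x (X x)%:E)%E.
Proof. by rewrite unlock. Qed.

Lemma integral_trunc_sqr h t : measurable_fun setT (trunc h t) ->
  (\int[muP]_z (trunc h t z ^+ 2)%:E =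
   \int[mu]_(s in `[0%R, t]) 'E_P[fun x => (h s x ^+ 2)%R])%E.
Proof.
move=> mh.
have mh2 : measurable_fun setT (fun z => (trunc h t z ^+ 2)%:E).
  exact/measurable_EFinP/measurable_funX.
have p2 z : (0 <= (trunc h t z ^+ 2)%:E)%E by rewrite lee_fin sqr_ge0.
rewrite [LHS](@fubini_tonelli1 _ _ _ _ R mu P (fun z => (trunc h t z ^+ 2)%:E) mh2 p2).
rewrite [RHS]integral_mkcond /fubini_F; apply: eq_integral => s _.
rewrite patchE /trunc/= indicE expectationE; case: ifP => _ /=.
  by apply: eq_integral => x _; rewrite mulr1.
by apply: integral0_eq => x _; rewrite mulr0 expr0n.
Qed.

Variables (F : R -> set (set Omega)).
Hypothesis HF : filtration F.

Lemma measurable_trunc h t : ito_integrand P F t h -> measurable_fun setT (trunc h t).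
Proof.
move=> [mh _ _].
have mD : measurable (`[0, t] `*` [set: Omega] : set (R * Omega)).
  exact: measurableX.
have := measurable_restrictT _ mD; rewrite -/(measurable_fun _ _) => E.
have /E := mh; congr measurable_fun; apply/funext => z.
rewrite /trunc patchE indicE in_setX in_setT andbT.
by case: (_ \in _); rewrite ?mulr1 ?mulr0.
Qed.

Lemma sqint_trunc h t : ito_integrand P F t h -> sqint muP (trunc h t).
Proof.
move=> hh; have mh := measurable_trunc hh; split => //.
by rewrite integral_trunc_sqr//; have [] := hh.
Qed.

Lemma dotp_trunc f g t t' : ito_integrand P F t f -> ito_integrand P F t' g ->
  let D := `[0, Num.min t t']%classic in
  mu.-integrable D (EFin \o (fun s => dotp P (f s) (g s))) /\
  dotp muP (trunc f t) (trunc g t') = \int[mu]_(s in D) dotp P (f s) (g s).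
Proof.
move=> hf hg D; have mD : measurable D by exact: measurable_itv.
have ifg := sqint_mul (sqint_trunc hf) (sqint_trunc hg).
have [iF FE] := integrable_fine (integrable_fubini_F ifg).
have E : (fun s => dotp P (f s) (g s)) \_ D = fine \o
    fubini_F P (EFin \o (fun z => trunc f t z * trunc g t' z)).
  apply/funext => s; rewrite /fubini_F /dotp /Rintegral patchE /trunc /D /=.
  rewrite mem_setE in_itv/= le_min !indicE !mem_setE !in_itv/=.
  case: (0 <= s) => /=; last by rewrite integral0_eq// => x _; rewrite !mulr0.
  case: (s <= t) => /=; last by rewrite integral0_eq// => x _; rewrite !mulr0 mul0r.
  case: (s <= t') => /=; last by rewrite integral0_eq// => x _; rewrite !mulr0.
  by congr fine; apply: eq_integral => x _; rewrite !mulr1.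
split; first by apply/integrable_mkcond => //; rewrite restrict_EFin E.
rewrite [RHS]Rintegral_mkcond E /Rintegral [in RHS]FE.
by rewrite integral12_prod_meas1.
Qed.

Variables (m : nat) (w : 'I_m -> R -> Omega -> R).
Hypothesis Hw : wiener_process P F w.

Let approx k f t I : 0 <= t -> is_ito_integral P F (w k) f t I ->
  sqint P I /\ exists S : nat -> simple_process F,
   ((fun r => \int[P]_x ((I x - sp_integral (w k) (S r) t x) ^+ 2)%:E) @ \oo --> 0)%E /\
   ((fun r => \int[muP]_z ((trunc f t z - sp_trunc (S r) t z) ^+ 2)%:E) @ \oo --> 0)%E.
Proof.
move=> t0 [hf mI [S [Sf SI]]].
have sS r := sqint_sp_integral HF Hw (S r) k t0.
have SI' : ((fun r => \int[P]_x ((I x - sp_integral (w k) (S r) t x) ^+ 2)%:E) @ \oo --> 0)%E.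
  by under eq_fun do rewrite -expectationE; exact: SI.
split.
  (* Convergence to 0 makes some mean-square distance finite, so [I] is a simple integral plus a
     square-integrable error. *)
  have /fine_cvgP[[r _ /(_ r (leqnn r)) h] _] := SI'.
  have -> : I = fun x => (I x - sp_integral (w k) (S r) t x) + sp_integral (w k) (S r) t x.
    by apply/funext => x; rewrite subrK.
  apply: sqintD => //; split; last by rewrite ltey_eq h.
  by apply: measurable_funB => //; have [] := sS r.
exists S; split => //.
rewrite (_ : (fun r => _) = fun r => \int[mu]_(s in `[0%R, t])
  'E_P[fun x => ((f s x - sp_value (S r) s x) ^+ 2)%R])%E; first exact: Sf.
apply/funext => r.
have E : (fun z => trunc f t z - sp_trunc (S r) t z) =
    trunc (fun s x => f s x - sp_value (S r) s x) t.
  by apply/funext => z; rewrite /trunc /sp_trunc mulrBl.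
rewrite -integral_trunc_sqr -E//.
apply: measurable_funB; first exact: measurable_trunc.
by have [] := sqint_sp_trunc P w HF (S r) k t0.
Qed.

Lemma sqint_ito k f t I : 0 <= t -> is_ito_integral P F (w k) f t I -> sqint P I.
Proof. by move=> t0 /(approx t0)[]. Qed.

(** Stated for two components and two times, because the covariances of the noise at different times
    are what the second-moment argument works with. *)
Lemma dotp_ito k l f g t t' I I' : 0 <= t -> 0 <= t' ->
  is_ito_integral P F (w k) f t I -> is_ito_integral P F (w l) g t' I' ->
  dotp P I I' = (k == l)%:R * dotp muP (trunc f t) (trunc g t').
Proof.
move=> t0 t'0 HI HI'.
have [sI [S [SI Sf]]] := approx t0 HI; have [sI' [S' [SI' Sf']]] := approx t'0 HI'.
have sf : sqint muP (trunc f t) by apply: sqint_trunc; have [] := HI.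
have sg : sqint muP (trunc g t') by apply: sqint_trunc; have [] := HI'.
have sS r := sqint_sp_integral HF Hw (S r) k t0.
have sS' r := sqint_sp_integral HF Hw (S' r) l t'0.
have sT r := sqint_sp_trunc P w HF (S r) k t0.
have sT' r := sqint_sp_trunc P w HF (S' r) k t'0.
have c1 := cvg_dotp sI sI' sS sS' SI SI'.
have c2 : (k == l)%:R * dotp muP (sp_trunc (S r) t) (sp_trunc (S' r) t')
    @[r --> \oo] --> (k == l)%:R * dotp muP (trunc f t) (trunc g t').
  by apply: cvgMr; exact: cvg_dotp.
rewrite -(cvg_lim _ c1)//; apply: cvg_lim => //.
rewrite (_ : (fun r => _) = fun r => (k == l)%:R *
  dotp muP (sp_trunc (S r) t) (sp_trunc (S' r) t')); first exact: c2.
by apply/funext => r; exact: (dotp_sp_integral HF Hw).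
Qed.

Lemma dotp_ito1 k f t I : 0 <= t -> is_ito_integral P F (w k) f t I ->
  dotp P I (fun=> 1) = 0.
Proof.
move=> t0 HI; have [sI [S [SI _]]] := approx t0 HI.
have sS r := sqint_sp_integral HF Hw (S r) k t0.
have c0 : ((fun r : nat => \int[P]_x ((1 - 1 : R) ^+ 2)%:E) @ \oo --> 0)%E.
  under eq_fun do rewrite subrr expr0n/= integral0.
  exact: cvg_cst.
have c1 := cvg_dotp sI (sqint1 P) sS (fun=> sqint1 P) SI c0.
rewrite -(cvg_lim _ c1)//; apply: cvg_lim => //.
rewrite (_ : (fun r => _) = fun=> 0); first exact: cvg_cst.
by apply/funext => r; exact: (dotp_sp_integral1 HF Hw).
Qed.

End ito_isometry.

(** * Uniqueness from second-order defects *)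

Section discrete_gronwall.
Variables (R : realType) (J : finType).

Lemma norm_sum_mul_le (I : finType) (a x : I -> R) (X : R) :
  (forall i, `|x i| <= X) -> `|\sum_i a i * x i| <= (\sum_i `|a i|) * X.
Proof.
move=> xX; rewrite (le_trans (ler_norm_sum _ _ _))// mulr_suml ler_sum// => i _.
by rewrite normrM ler_wpM2l.
Qed.

Lemma ler_sum_norm (I : finType) (x : I -> R) i : `|x i| <= \sum_j `|x j|.
Proof. by rewrite (bigD1 i)//= lerDl sumr_ge0. Qed.

(* Summing the defects along the subdivision of [0, t] in n steps leaves
   O(1/n). *)
Lemma second_order_zero (S C : R) (L : J -> J -> R) (e : J -> R -> R) :
  (forall i s t, 0 <= s -> s <= t -> t <= S ->
    `|e i t - e i s - (t - s) * \sum_l L i l * e l s| <= C * (t - s) ^+ 2) ->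
  (forall i, e i 0 = 0) ->
  forall i t, 0 <= t -> t <= S -> e i t = 0.
Proof.
move=> H e0 i t t0 tS.
pose eps r := \sum_j `|e j r|.
pose A := \sum_j \sum_l `|L j l|.
pose C' := \sum_(j : J) C.
have A0 : 0 <= A by apply: sumr_ge0 => j _; exact: sumr_ge0.
have C0 : 0 <= C' * t ^+ 2.
  rewrite /C' mulr_suml; apply: sumr_ge0 => j _.
  by have := H j 0 t (lexx _) t0 tS; rewrite subr0; exact: le_trans.
have step s r : 0 <= s -> s <= r -> r <= S ->
    eps r <= (1 + A * (r - s)) * eps s + C' * (r - s) ^+ 2.
  move=> s0 sr rS.
  have h0 : 0 <= r - s by rewrite subr_ge0.
  have : eps r <= \sum_j (`|e j s| + ((r - s) * (\sum_l `|L j l|) * eps s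
                          + C * (r - s) ^+ 2)).
    apply: ler_sum => j _.
    rewrite -[e j r](subrK (e j s)) addrC (le_trans (ler_normD _ _))// lerD2l.
    rewrite -[e j r - e j s](subrK ((r - s) * \sum_l L j l * e l s)) addrC.
    rewrite (le_trans (ler_normD _ _))// lerD//; last exact: H.
    rewrite normrM ger0_norm// -mulrA ler_wpM2l// norm_sum_mul_le// => l.
    exact: (ler_sum_norm (fun l => e l s)).
  move/le_trans; apply; rewrite !big_split/= -mulr_suml -mulr_sumr -/A -mulr_suml -/(eps s) -/C'.
  by rewrite le_eqVlt; apply/orP; left; apply/eqP; ring.
(* Each step of length h = t / n multiplies the error by at most 1 + A h and adds C' h^2; the k
   added terms are all given the largest growth factor. *)
have bound n k : (0 < n)%N -> (k <= n)%N ->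
    eps (k%:R * (t / n%:R)) <=
    k%:R * (C' * (t / n%:R) ^+ 2) * (1 + A * (t / n%:R)) ^+ k.
  move=> n0; set h := t / n%:R.
  have nh : n%:R * h = t by rewrite /h mulrC divfK// pnatr_eq0 -lt0n.
  have h0 : 0 <= h by rewrite divr_ge0.
  have Ch : 0 <= C' * h ^+ 2.
    by rewrite /h expr_div_n mulrA mulr_ge0// invr_ge0 exprn_ge0.
  have x1 : 1 <= 1 + A * h by rewrite lerDl mulr_ge0.
  elim: k => [_|k ih kn].
    by rewrite !mul0r /eps big1// => j _; rewrite e0 normr0.
  have kh : k.+1%:R * h - k%:R * h = h by rewrite -mulrBl -natr1 addrAC subrr add0r mul1r.
  have := @step (k%:R * h) (k.+1%:R * h); rewrite kh => /(_ _ _ _)/le_trans; apply.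
  - by rewrite mulr_ge0.
  - by rewrite ler_wpM2r// ler_nat.
  - by rewrite (le_trans _ tS)// -nh ler_wpM2r// ler_nat.
  have := ih (ltnW kn); set E := eps _ => hE.
  apply: (@le_trans _ _ ((1 + A * h) *
    (k%:R * (C' * h ^+ 2) * (1 + A * h) ^+ k) + C' * h ^+ 2)).
    by rewrite lerD2r ler_wpM2l// (le_trans _ x1).
  rewrite -natr1 [leRHS](_ : _ = (1 + A * h) *
    (k%:R * (C' * h ^+ 2) * (1 + A * h) ^+ k) + C' * h ^+ 2 * (1 + A * h) ^+ k.+1).
    by rewrite lerD2l ler_peMr// exprn_ege1.
  by rewrite [_ ^+ k.+1]exprS; ring.
(* At k = n the added terms total C' t^2 / n, and (1 + A t / n)^n <= exp(A t). *)
have lim n : (0 < n)%N -> eps t <= C' * t ^+ 2 * expR (A * t) / n%:R.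
  move=> n0; have n0' : n%:R != 0 :> R by rewrite pnatr_eq0 -lt0n.
  have := bound n n n0 (leqnn _); rewrite mulrC divfK// => /le_trans; apply.
  rewrite (_ : n%:R * _ = C' * t ^+ 2 / n%:R); last by field.
  rewrite [leRHS]mulrAC ler_wpM2l ?divr_ge0//.
  rewrite (_ : A * t = (A * (t / n%:R)) * n%:R); last by field.
  rewrite expRM_natr lerXn2r ?nnegrE ?expR_ge0 ?expR_ge1Dx//.
  by rewrite addr_ge0// mulr_ge0// divr_ge0.
have eps0 : eps t <= 0.
  apply/ler_addgt0Pr => x x0; rewrite add0r.
  have [n nx] : exists n, (C' * t ^+ 2 * expR (A * t)) / x < n.+1%:R.
    by exists (Num.truncn `|C' * t ^+ 2 * expR (A * t) / x|);
       rewrite (le_lt_trans (ler_norm _))// truncnS_gt.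
  apply: (le_trans (lim n.+1 _)) => //.
  by rewrite ler_pdivrMr// -ler_pdivrMl// [leLHS]mulrC ltW.
apply/eqP; rewrite -normr_le0 (le_trans _ eps0)//.
exact: (ler_sum_norm (fun j => e j t)).
Qed.

End discrete_gronwall.

(** * Second-order estimate for two-time covariances *)

Section second_moment_kernel.
Variables (R : realType) (J : finType).
Notation mu := (@lebesgue_measure R).

(** The integrand is frozen at [r]. With [dl] of order t - s this produces the second-order defects;
    with [r] = 0 it gives Lipschitz bounds. *)
Lemma Rintegral_increment_le (f : R -> R) (T s t r dl : R) :
  mu.-integrable `[0, T] (EFin \o f) -> 0 <= s -> s <= t -> t <= T ->
  (forall v, s < v -> v <= t -> `|f v - r| <= dl) ->
  `|(\int[mu]_(v in `[0, t]) f v) - (\int[mu]_(v in `[0, s]) f v) - (t - s) * r|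
  <= (t - s) * dl.
Proof.
move=> if_ s0 st tT fr.
have it : mu.-integrable `[0, t] (EFin \o f).
  by apply: integrableS if_ => //; apply: subset_itvl; rewrite bnd_simp.
rewrite Rintegral_itvB ?bnd_simp//.
have ist : mu.-integrable `]s, t] (EFin \o f).
  by apply: integrableS if_ => //; apply: subset_itv; rewrite bnd_simp.
have fm : fine (mu `]s, t]) = t - s.
  rewrite lebesgue_measure_itv/= lte_fin.
  by move: st; rewrite le_eqVlt => /predU1P[->|->]; rewrite ?ltxx ?subrr.
have ic (k : R) : mu.-integrable `]s, t] (EFin \o (fun=> k)).
  apply/integrableP; split; first exact: measurable_cst.
  rewrite integral_cst//= lebesgue_measure_itv/=; case: ifP => _; last by rewrite mule0 ltry.
  by rewrite -EFinB -EFinM ltry.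
rewrite (mulrC (t - s) r) -fm -Rintegral_cst// -RintegralB//.
have ifr : mu.-integrable `]s, t] (EFin \o (fun x => f x - r)).
  exact: integrableB ist (ic r).
rewrite (le_trans (le_normr_Rintegral _ _))//.
rewrite mulrC -Rintegral_cst//; apply: le_Rintegral => //.
  exact: (integrable_norm ifr).
by move=> x /=; rewrite in_itv/= => /andP[]; exact: fr.
Qed.

Lemma Rintegral_increment_bound (f : R -> R) (T s t dl : R) :
  mu.-integrable `[0, T] (EFin \o f) -> 0 <= s -> s <= t -> t <= T ->
  (forall v, s < v -> v <= t -> `|f v| <= dl) ->
  `|(\int[mu]_(v in `[0, t]) f v) - (\int[mu]_(v in `[0, s]) f v)| <= dl * (t - s).
Proof.
move=> if_ s0 st tT fdl; rewrite mulrC.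
have E D : D - (t - s) * 0 = D by rewrite mulr0 subr0.
rewrite -[X in `|X|]E; apply: (Rintegral_increment_le if_) => // v sv vt.
by rewrite subr0 fdl.
Qed.

(** [K i j s t] and [mm i j s t] stand for E[phi_i(s) phi_j(t)] and E[phi_i(s) M_j(t)], with M the
    stochastic-integral part, [e] for the mean of phi and [c] for its initial value. [H1] expands
    the first factor of [mm] by the stochastic equation, [H2] the second factor of [K]. *)
Variables (T B : R) (a : J -> J -> R) (q : J -> J -> (J * J) -> R).
Variables (c : J -> R) (e : J -> R -> R) (K mm : J -> J -> R -> R -> R).

Let G i j s := K i j s s.
Let Q i j v := \sum_l q i j l * K l.1 l.2 v v.
Notation "'I0' f t" := (\int[mu]_(v in `[0, t]) f v)
  (at level 10, f at level 9, t at level 9).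

Hypothesis KB : forall i j s t, 0 <= s -> s <= T -> 0 <= t -> t <= T ->
  `|K i j s t| <= B.
Hypothesis mB : forall i j s t, 0 <= s -> s <= T -> 0 <= t -> t <= T ->
  `|mm i j s t| <= B.
Hypothesis iK : forall i j s, 0 <= s -> s <= T ->
  mu.-integrable `[0, T] (EFin \o (K i j s)).
Hypothesis im : forall i j s, 0 <= s -> s <= T ->
  mu.-integrable `[0, T] (EFin \o (mm i j ^~ s)).
Hypothesis iQ : forall i j, mu.-integrable `[0, T] (EFin \o (Q i j)).
Hypothesis Ksym : forall i j s t, K i j s t = K j i t s.
Hypothesis H1 : forall i j s t, 0 <= s -> s <= T -> 0 <= t -> t <= T ->
  mm i j s t = \sum_l a i l * I0 (mm l j ^~ t) s + I0 (Q i j) (Num.min s t).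
Hypothesis H2 : forall i j s t, 0 <= s -> s <= T -> 0 <= t -> t <= T ->
  K i j s t = c j * e i s + \sum_l a j l * I0 (K i l s) t + mm i j s t.

Let A := \sum_i \sum_l `|a i l|.
Let qc := \sum_i \sum_j \sum_l `|q i j l|.

Let A0 : 0 <= A. Proof. by apply: sumr_ge0 => j _; exact: sumr_ge0. Qed.
Let qc0 : 0 <= qc.
Proof. by do 2 (apply: sumr_ge0 => ? _); exact: sumr_ge0. Qed.

Let sum_a i (x : J -> R) X : 0 <= X -> (forall l, `|x l| <= X) ->
  `|\sum_l a i l * x l| <= A * X.
Proof.
move=> X0 /(norm_sum_mul_le (a i))/le_trans; apply; rewrite ler_wpM2r//.
by rewrite /A [leRHS](bigD1 i)//= lerDl sumr_ge0// => j _; exact: sumr_ge0.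
Qed.

Let sum_q i j (x : J * J -> R) X : 0 <= X -> (forall l, `|x l| <= X) ->
  `|\sum_l q i j l * x l| <= qc * X.
Proof.
move=> X0 /(norm_sum_mul_le (q i j))/le_trans; apply; rewrite ler_wpM2r//.
rewrite /qc [leRHS](bigD1 i)//= [X in _ <= X + _](bigD1 j)//= -addrA lerDl addr_ge0//.
  by apply: sumr_ge0 => l _; exact: sumr_ge0.
by do 2 (apply: sumr_ge0 => ? _); exact: sumr_ge0.
Qed.

(* The noise over ]s, t] is uncorrelated with the state at time s. *)
Let orth i j s t : 0 <= s -> s <= t -> t <= T -> mm i j s t = mm i j s s.
Proof.
move=> s0 st tT; apply/eqP; rewrite -subr_eq0; apply/eqP.
have sT := le_trans st tT; have t0 := le_trans s0 st.
pose y l v := mm l j v t - mm l j v s.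
rewrite -/(y i s).
have iy l : mu.-integrable `[0, T] (EFin \o (y l)).
  exact: integrableB (im l j t0 tT) (im l j s0 sT).
have iS f u : u <= T -> mu.-integrable `[0, T] (EFin \o f) ->
    mu.-integrable `[0, u] (EFin \o f).
  by move=> uT; apply: integrableS => //; apply: subset_itvl; rewrite bnd_simp.
(* For v <= s the minima of v with t and with s are both v, so the [Q] terms of [H1] cancel and [y]
   solves a homogeneous linear equation. *)
have yE l v : 0 <= v -> v <= s -> y l v = \sum_k a l k * I0 (y k) v.
  move=> v0 vs; have vT := le_trans vs sT.
  rewrite /y !H1// (min_l (le_trans vs st)) (min_l vs) opprD addrACA subrr addr0.
  rewrite -sumrB; apply: eq_bigr => k _; rewrite -mulrBr -RintegralB//.
  - exact: iS (im k j t0 tT).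
  - exact: iS (im k j s0 sT).
have B0 : 0 <= B by exact: le_trans (KB i i s0 sT s0 sT).
have yB l v : 0 <= v -> v <= s -> `|y l v| <= 2 * B.
  move=> v0 vs; have vT := le_trans vs sT.
  rewrite (le_trans (ler_normB _ _))// mulr2n mulrDl mul1r lerD//; exact: mB.
have yL l u v : 0 <= u -> u <= v -> v <= s -> `|y l v - y l u| <= A * (2 * B) * (v - u).
  move=> u0 uv vs; have v0 := le_trans u0 uv; have us := le_trans uv vs.
  rewrite !yE// -sumrB; under eq_bigr do rewrite -mulrBr.
  rewrite -mulrA sum_a ?mulr_ge0 ?subr_ge0// => k.
  apply: (Rintegral_increment_bound (iy k)) => //; first exact: le_trans vs sT.
  move=> x ux xv; rewrite yB//; first by rewrite (le_trans u0)// ltW.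
  exact: le_trans vs.
apply: (@second_order_zero _ _ s (A * (A * (2 * B))) a y) => //.
- move=> l u v u0 uv vs; have v0 := le_trans u0 uv; have us := le_trans uv vs.
  rewrite (yE l v)// (yE l u)// mulr_sumr -!sumrB.
  under eq_bigr do rewrite -mulrBr mulrCA -mulrBr.
  rewrite (_ : _ * (v - u) ^+ 2 = A * ((v - u) * (A * (2 * B) * (v - u)))); last by ring.
  rewrite sum_a//; first by rewrite !mulr_ge0 ?subr_ge0.
  move=> k; apply: (Rintegral_increment_le (iy k)) => //.
    exact: le_trans vs sT.
  move=> x ux xv; rewrite (le_trans (yL k u x _ _ _))//.
  + exact: ltW.
  + exact: le_trans vs.
  + by rewrite ler_wpM2l ?mulr_ge0// lerD2r.
- move=> l; rewrite yE//; apply: big1 => k _.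
  by rewrite set_itv1 Rintegral_set1 mulr0.
Qed.

Let B0T (i : J) : 0 <= B \/ T < 0.
Proof.
case: (ltP T 0) => [|T0]; first by right.
by left; apply: le_trans (KB i i (lexx 0) T0 (lexx 0) T0).
Qed.

(** The increment of the diagonal is the sum of two one-sided increments, which yield the drift
    terms, and of the covariance [E] of the increment of the state. Up to O(h^2), [E] is the
    correlation [D] of the final state with the new noise, and [D] is the integral of [Q] over ]s,
    t]. *)
Lemma second_moment_estimate : exists C : R, forall i j s t,
  0 <= s -> s <= t -> t <= T ->
  `|G i j t - G i j s - (t - s) *
    ((\sum_l a i l * G l j s) + (\sum_l a j l * G i l s) + Q i j s)|
  <= C * (t - s) ^+ 2.
Proof.
(* Lipschitz constants: [C1] for [K] when its second time moves past the first, [C3] for [D], [C4]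
   for [E], [C5] for the diagonal [G]; [C6] bounds the change of [K k n r v] when r goes from s to
   t, for v between them. *)
pose C1 := A * B; pose C3 := A * (2 * B) + qc * B.
pose C4 := A * (2 * B) + C3; pose C5 := 2 * C1 + C4; pose C6 := 2 * C1 + C5.
exists (2 * (A * C1) + A * C6 + A * C3 + qc * C5) => i j s t s0 st tT.
have T0 : 0 <= T by rewrite (le_trans s0)// (le_trans st).
have B0 : 0 <= B by case: (B0T i) => // /lt_geF; rewrite T0.
have C10 : 0 <= C1 by rewrite mulr_ge0.
have C30 : 0 <= C3 by rewrite addr_ge0// !mulr_ge0.
have C40 : 0 <= C4 by rewrite addr_ge0// !mulr_ge0.
have C50 : 0 <= C5 by rewrite addr_ge0// !mulr_ge0.
have C60 : 0 <= C6 by rewrite addr_ge0// !mulr_ge0.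
have t0 := le_trans s0 st; have sT := le_trans st tT.
set h := t - s; have h0 : 0 <= h by rewrite subr_ge0.
have vle v : s < v -> v <= t -> (0 <= v) * (v <= T) * (v - s <= h) * (s <= v) * (t - v <= h).
  move=> sv vt; rewrite (le_trans s0 (ltW sv)) (le_trans vt tT) lerD2r vt (ltW sv).
  by rewrite /h lerD2l lerN2 (ltW sv).
have dK k l u v : 0 <= u -> u <= v -> v <= T -> K k l u v - G k l u =
    \sum_n a l n * (I0 (K k n u) v - I0 (K k n u) u).
  move=> u0 uv vT; have v0 := le_trans u0 uv; have uT := le_trans uv vT.
  rewrite /G !H2// (orth k l u0 uv vT) opprD addrACA subrr addr0 opprD addrACA subrr add0r.
  by rewrite -sumrB; apply: eq_bigr => n _; rewrite -mulrBr.
have dK1 k l u v : 0 <= u -> u <= v -> v <= T -> `|K k l u v - G k l u| <= C1 * (v - u).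
  move=> u0 uv vT; rewrite dK// /C1 -mulrA sum_a ?mulr_ge0 ?subr_ge0// => n.
  have uT := le_trans uv vT.
  apply: (Rintegral_increment_bound (iK k n u0 uT)) => // x ux xv.
  by rewrite KB// ?(le_trans xv)// (le_trans u0)// ltW.
have dK2 k l : `|K k l s t - G k l s - h * \sum_n a l n * G k n s| <= A * C1 * h ^+ 2.
  rewrite dK// mulr_sumr -sumrB; under eq_bigr do rewrite mulrCA -mulrBr.
  rewrite (_ : A * C1 * _ = A * (h * (C1 * h))); last by ring.
  rewrite sum_a ?mulr_ge0// => n.
  apply: (Rintegral_increment_le (iK k n s0 sT)) => // v sv vt.
  apply: (le_trans (dK1 k n s v s0 (ltW sv) (le_trans vt tT))).
  by rewrite ler_wpM2l// lerD2r.
(* correlation of the state at the end of ]u, v] with the noise over ]u, v] *)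
pose D k l u v := mm k l v v - mm k l v u.
have DE k l u v : 0 <= u -> u <= v -> v <= T -> D k l u v =
    \sum_n a k n * (I0 (fun r => mm n l r v - mm n l r u) v
                    - I0 (fun r => mm n l r v - mm n l r u) u)
    + (I0 (Q k l) v - I0 (Q k l) u).
  move=> u0 uv vT; have v0 := le_trans u0 uv; have uT := le_trans uv vT.
  have iS f x : x <= T -> mu.-integrable `[0, T] (EFin \o f) ->
      mu.-integrable `[0, x] (EFin \o f).
    by move=> xT; apply: integrableS => //; apply: subset_itvl; rewrite bnd_simp.
  have iB n x : 0 <= x -> x <= T -> I0 (fun r => mm n l r v - mm n l r u) x =
      I0 (mm n l ^~ v) x - I0 (mm n l ^~ u) x.
    move=> x0 xT; rewrite RintegralB//; first exact: iS (im n l v0 vT).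
    exact: iS (im n l u0 uT).
  (* Subtracting this vanishing difference turns the integrals over [0, v] into integrals over ]u,
     v]. *)
  have : mm k l u v - mm k l u u = 0 by rewrite (orth k l u0 uv vT) subrr.
  rewrite /D !H1// !minxx (min_l uv) (min_r uv) => E.
  rewrite -[LHS]subr0 -[X in _ - X = _]E.
  under [in RHS]eq_bigr do rewrite !iB//.
  rewrite [X in _ = X + _](_ : _ = (\sum_n a k n * I0 (mm n l ^~ v) v)
     - (\sum_n a k n * I0 (mm n l ^~ u) v)
     - (\sum_n a k n * I0 (mm n l ^~ v) u) + \sum_n a k n * I0 (mm n l ^~ u) u).
    by ring.
  by rewrite -!sumrB -big_split/=; apply: eq_bigr => n _; ring.
have iy k l u v : 0 <= u -> u <= T -> 0 <= v -> v <= T ->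
    mu.-integrable `[0, T] (EFin \o (fun r => mm k l r v - mm k l r u)).
  by move=> u0 uT v0 vT; exact: integrableB (im k l v0 vT) (im k l u0 uT).
have QB k l v : 0 <= v -> v <= T -> `|Q k l v| <= qc * B.
  by move=> v0 vT; apply: sum_q => // n; exact: KB.
have D1 k l u v : 0 <= u -> u <= v -> v <= T -> `|D k l u v| <= C3 * (v - u).
  move=> u0 uv vT; have v0 := le_trans u0 uv; have uT := le_trans uv vT.
  rewrite DE// (le_trans (ler_normD _ _))// mulrDl lerD//.
    rewrite -mulrA sum_a ?mulr_ge0 ?subr_ge0// => n.
    apply: (Rintegral_increment_bound (iy n l u v u0 uT v0 vT)) => // x ux xv.
    have x0 := le_trans u0 (ltW ux); have xT := le_trans xv vT.
    by rewrite (le_trans (ler_normB _ _))// mulr2n mulrDl mul1r lerD//; exact: mB.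
  apply: (Rintegral_increment_bound (iQ k l)) => // x ux xv.
  by rewrite QB// ?(le_trans xv vT)// (le_trans u0 (ltW ux)).
have D2 k l : `|D k l s t - (I0 (Q k l) t - I0 (Q k l) s)| <= A * C3 * h ^+ 2.
  rewrite DE// addrK (_ : A * C3 * _ = A * (C3 * h * h)); last by ring.
  rewrite sum_a ?mulr_ge0// => n.
  apply: (Rintegral_increment_bound (iy n l s t s0 sT t0 tT)) => // v sv vt.
  have v0 := le_trans s0 (ltW sv); have vT := le_trans vt tT.
  rewrite (orth n l v0 vt tT) (le_trans (D1 n l s v s0 (ltW sv) vT))//.
  by rewrite ler_wpM2l// lerD2r.
(* covariance of the increment over ]u, v] *)
pose E k l u v := K k l v v - K k l v u - K k l u v + K k l u u.
have iKt k l u v : 0 <= u -> u <= T -> 0 <= v -> v <= T ->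
    mu.-integrable `[0, T] (EFin \o (fun r => K k l v r - K k l u r)).
  by move=> u0 uT v0 vT; exact: integrableB (iK k l v0 vT) (iK k l u0 uT).
have EE k l u v : 0 <= u -> u <= v -> v <= T -> E k l u v =
    \sum_n a l n * (I0 (fun r => K k n v r - K k n u r) v
                    - I0 (fun r => K k n v r - K k n u r) u) + D k l u v.
  move=> u0 uv vT; have v0 := le_trans u0 uv; have uT := le_trans uv vT.
  have iS f x : x <= T -> mu.-integrable `[0, T] (EFin \o f) ->
      mu.-integrable `[0, x] (EFin \o f).
    by move=> xT; apply: integrableS => //; apply: subset_itvl; rewrite bnd_simp.
  have iB n x : x <= T -> I0 (fun r => K k n v r - K k n u r) x =
      I0 (K k n v) x - I0 (K k n u) x.
    move=> xT; rewrite RintegralB//; first exact: iS (iK k n v0 vT).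
    exact: iS (iK k n u0 uT).
  under eq_bigr do rewrite !iB//.
  rewrite [X in _ = X + _](_ : _ = (\sum_n a l n * I0 (K k n v) v)
     - (\sum_n a l n * I0 (K k n u) v)
     - (\sum_n a l n * I0 (K k n v) u) + \sum_n a l n * I0 (K k n u) u).
    by rewrite /E /D !H2// (orth k l u0 uv vT); ring.
  by rewrite -!sumrB -big_split/=; apply: eq_bigr => n _; ring.
have E1 k l u v : 0 <= u -> u <= v -> v <= T -> `|E k l u v| <= C4 * (v - u).
  move=> u0 uv vT; have v0 := le_trans u0 uv; have uT := le_trans uv vT.
  rewrite EE// (le_trans (ler_normD _ _))// mulrDl lerD//; last exact: D1.
  rewrite -mulrA sum_a ?mulr_ge0 ?subr_ge0// => n.
  apply: (Rintegral_increment_bound (iKt k n u v u0 uT v0 vT)) => // x ux xv.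
  have x0 := le_trans u0 (ltW ux); have xT := le_trans xv vT.
  by rewrite (le_trans (ler_normB _ _))// mulr2n mulrDl mul1r lerD//; exact: KB.
have GE k l u v : G k l v - G k l u =
    (K k l u v - G k l u) + (K l k u v - G l k u) + E k l u v.
  by rewrite /G /E (Ksym l k u v) (Ksym l k u u); ring.
have G1 k l u v : 0 <= u -> u <= v -> v <= T -> `|G k l v - G k l u| <= C5 * (v - u).
  move=> u0 uv vT; rewrite GE (le_trans (ler_normD _ _))// /C5 mulrDl lerD ?E1//.
  by rewrite (le_trans (ler_normD _ _))// mulr2n !mulrDl !mul1r lerD ?dK1.
have E2 k l : `|E k l s t - D k l s t| <= A * C6 * h ^+ 2.
  rewrite EE// addrK (_ : A * C6 * _ = A * (C6 * h * h)); last by ring.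
  rewrite sum_a ?mulr_ge0// => n.
  apply: (Rintegral_increment_bound (iKt k n s t s0 sT t0 tT)) => // v sv vt.
  have v0 := le_trans s0 (ltW sv); have vT := le_trans vt tT.
  have -> : K k n t v - K k n s v = (K n k v t - G n k v) + (G n k v - G n k s)
     - (K k n s v - G k n s).
    by rewrite (Ksym n k v t) /G (Ksym n k s s); ring.
  apply: le_trans (_ : C1 * h + C5 * h + C1 * h <= _); last by rewrite /C6; lra.
  rewrite (le_trans (ler_normB _ _))// lerD//; last first.
    apply: (le_trans (dK1 k n s v s0 (ltW sv) vT)).
    by rewrite ler_wpM2l// lerD2r.
  rewrite (le_trans (ler_normD _ _))// lerD//.
    apply: (le_trans (dK1 n k v t v0 vt tT)).
    by rewrite ler_wpM2l// lerD2l lerN2 ltW.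
  apply: (le_trans (G1 n k s v s0 (ltW sv) vT)).
  by rewrite ler_wpM2l// lerD2r.
have Q2 : `|I0 (Q i j) t - I0 (Q i j) s - h * Q i j s| <= qc * C5 * h ^+ 2.
  rewrite (_ : _ * h ^+ 2 = h * (qc * (C5 * h))); last by ring.
  apply: (Rintegral_increment_le (iQ i j)) => // v sv vt.
  have v0 := le_trans s0 (ltW sv); have vT := le_trans vt tT.
  rewrite /Q -sumrB; under eq_bigr do rewrite -mulrBr.
  rewrite sum_q ?mulr_ge0// => n.
  apply: (le_trans (G1 n.1 n.2 s v s0 (ltW sv) vT)).
  by rewrite ler_wpM2l// lerD2r.
rewrite GE (_ : \sum_l a i l * G l j s = \sum_l a i l * G j l s); last first.
  by apply: eq_bigr => l _; rewrite /G Ksym.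
have := dK2 i j; have := dK2 j i; have := D2 i j; have := E2 i j.
move: Q2.
set x1 := I0 _ t; set x2 := I0 _ s; set x3 := \sum_l a i l * _; set x4 := \sum_l a j l * _.
rewrite !ler_norml => /andP[q1 q2] /andP[e1 e2] /andP[d1 d2] /andP[k1 k2] /andP[k3 k4].
by apply/andP; split; lra.
Qed.

End second_moment_kernel.

(** * Second moments of a linear stochastic equation *)

Lemma Rintegral_sum d (T : measurableType d) (R : realType)
    (mu : {measure set T -> \bar R}) (D : set T) (I : Type) (s : seq I)
    (f : I -> T -> R) : measurable D ->
  (forall i, mu.-integrable D (EFin \o f i)) ->
  mu.-integrable D (EFin \o (fun x => \sum_(i <- s) f i x)) /\
  \int[mu]_(x in D) (\sum_(i <- s) f i x) = \sum_(i <- s) \int[mu]_(x in D) f i x.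
Proof.
move=> mD if_; elim: s => [|i s [ih1 ih2]].
  split; last by under eq_Rintegral do rewrite big_nil; rewrite big_nil Rintegral_cst// mul0r.
  rewrite (_ : EFin \o _ = cst 0%E); first exact: integrable0.
  by apply/funext => x /=; rewrite big_nil.
split.
  rewrite (_ : EFin \o _ = (EFin \o f i) \+ (EFin \o (fun x => (\sum_(i <- s) f i x)%R)))%E.
    exact: integrableD.
  by apply/funext => x /=; rewrite big_cons.
by under eq_Rintegral do rewrite big_cons; rewrite RintegralD// ih2 big_cons.
Qed.

Lemma integrable_scale d (T : measurableType d) (R : realType)
    (mu : {measure set T -> \bar R}) (D : set T) (k : R) (f : T -> R) :
  measurable D -> mu.-integrable D (EFin \o f) ->
  mu.-integrable D (EFin \o (fun x => k * f x)).
Proof. by move=> mD if_; exact: (integrableZl mD k if_). Qed.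

Lemma Rintegral_probability_cst d (T : measurableType d) (R : realType)
    (P : probability T R) (r : R) : \int[P]_x r = r.
Proof. by rewrite /Rintegral integral_cst//= probability_setT mule1. Qed.

Section linear_sde.
Context d (Omega : measurableType d) (R : realType) (P : probability Omega R).
Variables (F : R -> set (set Omega)) (m : nat) (w : 'I_m -> R -> Omega -> R).
Hypotheses (HF : filtration F) (Hw : wiener_process P F w).
Notation mu := (@lebesgue_measure R).
Notation muP := (mu \x P)%E.

Variables (J : finType) (a : J -> J -> R) (b : 'I_m -> J -> J -> R) (c : J -> R).
Variable phi : J -> R -> Omega -> R.

Definition drift i (s : R) (x : Omega) : R := \sum_j a i j * phi j s x.
Definition noise k i (s : R) (x : Omega) : R := \sum_j b k i j * phi j s x.

Hypothesis phi_int : forall t : R, 0 <= t -> forall i, ito_integrand P F t (phi i).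
Hypothesis phi_sde : forall t : R, 0 <= t -> exists I : 'I_m -> J -> Omega -> R,
  (forall k i, is_ito_integral P F (w k) (noise k i) t (I k i)) /\
  forall i, {ae P, forall x,
    phi i t x = c i + \int[mu]_(s in `[0, t]) drift i s x + \sum_k I k i x}.

(** Moving 0 <= t under the existential lets a choice fix the integrals at every time, with a dummy
    value at negative ones. *)
Let I_ex (t : R) : exists I : 'I_m -> J -> Omega -> R, 0 <= t ->
  (forall k i, is_ito_integral P F (w k) (noise k i) t (I k i)) /\
  forall i, {ae P, forall x,
    phi i t x = c i + \int[mu]_(s in `[0, t]) drift i s x + \sum_k I k i x}.
Proof.
case: (leP 0 t) => t0; last by exists (fun _ _ _ => 0).
by have [I HI] := phi_sde t0; exists I.
Qed.

Let It (t : R) := sval (cid (I_ex t)).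
Let ItP t : 0 <= t ->
  (forall k i, is_ito_integral P F (w k) (noise k i) t (It t k i)) /\
  forall i, {ae P, forall x,
    phi i t x = c i + \int[mu]_(s in `[0, t]) drift i s x + \sum_k It t k i x}.
Proof. exact: (svalP (cid (I_ex t))). Qed.

Let M i t x : R := \sum_k It t k i x.
Let U i t x : R := \int[mu]_(s in `[0, t]) drift i s x.
Let K i j s t : R := dotp P (phi i s) (phi j t).
Let mm i j s t : R := dotp P (phi i s) (M j t).

Let sM i t : 0 <= t -> sqint P (M i t).
Proof.
move=> t0; apply: sqint_sum => k.
by have [h _] := ItP t0; exact: (sqint_ito HF Hw t0 (h k i)).
Qed.

Let struncphi i t : 0 <= t -> sqint muP (trunc (phi i) t).
Proof. by move=> t0; exact: (sqint_trunc (phi_int t0 i)). Qed.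

Let struncdrift i t : 0 <= t -> sqint muP (trunc (drift i) t).
Proof.
move=> t0; rewrite (_ : trunc _ _ = fun z => \sum_j a i j * trunc (phi j) t z).
  by apply: sqint_sum => j; apply: sqintZ; exact: struncphi.
by apply/funext => z; rewrite /trunc /drift mulr_suml; apply: eq_bigr => j _; rewrite mulrA.
Qed.

Let sU i t : 0 <= t -> sqint P (U i t).
Proof. by move=> t0; exact: (sqint_time_integral t0 (struncdrift i t0)). Qed.

Let mphi i t : 0 <= t -> measurable_fun setT (phi i t).
Proof.
move=> t0; have [_ h _] := phi_int t0 i.
exact: (sub_measurable_measurable HF t0 (h t t0 (lexx t))).
Qed.

Let phiE i t : 0 <= t -> {ae P, forall x, phi i t x = c i + U i t x + M i t x}.
Proof. by move=> t0; have [_] := ItP t0; exact. Qed.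

Let scUM i t : 0 <= t -> sqint P (fun x => c i + U i t x + M i t x).
Proof.
move=> t0; apply: sqintD; last exact: sM.
by apply: sqintD; [exact: sqint_cst|exact: sU].
Qed.

Lemma sqint_sde i t : 0 <= t -> sqint P (phi i t).
Proof. by move=> t0; exact: (sqint_ae (mphi i t0) (phiE i t0) (scUM i t0)). Qed.

Let dotp_phi i t X : 0 <= t -> sqint P X ->
  dotp P (phi i t) X = c i * dotp P X (fun=> 1) + dotp P (U i t) X + dotp P (M i t) X.
Proof.
move=> t0 sX; have [mX _] := sX.
rewrite (dotp_ae (mphi i t0) (proj1 (scUM i t0)) mX (phiE i t0)).
have sc := sqint_cst P (c i).
rewrite dotpDl//; [|by apply: sqintD => //; exact: sU|exact: sM].
rewrite dotpDl//; last exact: sU.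
congr (_ + _ + _); rewrite (dotpC P X) -dotpZl//; last exact: sqint1.
by apply: eq_Rintegral => x _; rewrite mulr1.
Qed.

Let iphi X t i : 0 <= t -> sqint P X ->
  mu.-integrable `[0, t] (EFin \o (fun s => dotp P (phi i s) X)).
Proof.
by move=> t0 sX; have [] := dotp_time_integral (struncphi i t0) sX.
Qed.

Let dotp_drift i s X : 0 <= s -> sqint P X ->
  dotp P (drift i s) X = \sum_l a i l * dotp P (phi l s) X.
Proof.
move=> s0 sX; rewrite /drift dotp_suml//; last first.
  by move=> l; apply: sqintZ; exact: sqint_sde.
by apply: eq_bigr => l _; rewrite dotpZl//; exact: sqint_sde.
Qed.

Let dotp_U i t X : 0 <= t -> sqint P X ->
  dotp P (U i t) X = \sum_l a i l * \int[mu]_(s in `[0, t]) dotp P (phi l s) X.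
Proof.
move=> t0 sX; have [_ ->] := dotp_time_integral (struncdrift i t0) sX.
transitivity (\int[mu]_(s in `[0, t]) \sum_l a i l * dotp P (phi l s) X).
  apply: eq_Rintegral => s; rewrite inE/= in_itv/= => /andP[s0 _].
  exact: dotp_drift.
have mD : measurable (`[0, t]%classic : set (measurableTypeR R)) by exact: measurable_itv.
have il l : mu.-integrable `[0, t] (EFin \o (fun s => a i l * dotp P (phi l s) X)).
  by apply: integrable_scale => //; exact: iphi.
have [_ ->] := Rintegral_sum (index_enum J) mD il.
by apply: eq_bigr => l _; rewrite RintegralZl//; exact: iphi.
Qed.

Let Q i j v : R := \sum_k dotp P (noise k i v) (noise k j v).

Let noise_int k i t : 0 <= t -> ito_integrand P F t (noise k i).
Proof. by move=> t0; have [h _] := ItP t0; have [] := h k i. Qed.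

(** The minimum comes from the isometry, since the truncated integrands overlap up to the earlier
    time only; integrals against distinct components of [w] are orthogonal. *)
Let iQ_min i j s t : 0 <= s -> 0 <= t ->
  mu.-integrable `[0, Num.min s t] (EFin \o (Q i j)) /\
  dotp P (M i s) (M j t) = \int[mu]_(v in `[0, Num.min s t]) Q i j v.
Proof.
move=> s0 t0; have [hs _] := ItP s0; have [ht _] := ItP t0.
have ik k : mu.-integrable `[0, Num.min s t]
    (EFin \o (fun v => dotp P (noise k i v) (noise k j v))).
  by have [] := dotp_trunc (noise_int k i s0) (noise_int k j t0).
have mD : measurable (`[0, Num.min s t]%classic : set (measurableTypeR R)).
  exact: measurable_itv.
have [iS ->] := Rintegral_sum (index_enum 'I_m) mD ik.
split => //.
have sI u k l : 0 <= u -> sqint P (It u k l).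
  by move=> u0; have [h _] := ItP u0; exact: (sqint_ito HF Hw u0 (h k l)).
rewrite /M dotp_suml//; last exact: sM; last by move=> k; exact: sI.
apply: eq_bigr => k _.
rewrite dotp_sumr//; [|by move=> l; exact: sI|exact: sI].
rewrite (bigD1 k)//= (dotp_ito HF Hw s0 t0 (hs k i) (ht k j)) eqxx mul1r.
rewrite big1 ?addr0; last first.
  move=> l /negbTE lk.
  by rewrite (dotp_ito HF Hw s0 t0 (hs k i) (ht l j)) eq_sym lk mul0r.
by have [] := dotp_trunc (noise_int k i s0) (noise_int k j t0).
Qed.

Let dotp_M1 i t : 0 <= t -> dotp P (M i t) (fun=> 1) = 0.
Proof.
move=> t0; have [h _] := ItP t0.
rewrite /M dotp_suml//; [|by move=> k; exact: (sqint_ito HF Hw t0 (h k i))|exact: sqint1].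
by apply: big1 => k _; exact: (dotp_ito1 HF Hw t0 (h k i)).
Qed.

Let q i j (l : J * J) : R := \sum_k b k i l.1 * b k j l.2.

Let QE i j v : 0 <= v -> Q i j v = \sum_l q i j l * K l.1 l.2 v v.
Proof.
move=> v0.
have s1 l : sqint P (phi l v) by exact: sqint_sde.
have s2 k i' : sqint P (noise k i' v).
  by apply: sqint_sum => l; exact: sqintZ.
rewrite /Q /q; under [RHS]eq_bigr do rewrite mulr_suml.
rewrite exchange_big/=; apply: eq_bigr => k _.
have NE i' X : sqint P X -> dotp P (noise k i' v) X = \sum_l b k i' l * dotp P (phi l v) X.
  move=> sX; rewrite /noise dotp_suml//; last by move=> l; exact: sqintZ.
  by apply: eq_bigr => l _; rewrite dotpZl.
rewrite NE//.
transitivity (\sum_l \sum_l' b k i l * b k j l' * K l l' v v); last first.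
  by rewrite pair_big.
apply: eq_bigr => l _; rewrite dotpC NE// mulr_sumr; apply: eq_bigr => l' _.
by rewrite mulrA dotpC.
Qed.

Lemma second_moment_H1 i j s t : 0 <= s -> 0 <= t ->
  mm i j s t = \sum_l a i l * (\int[mu]_(v in `[0, s]) mm l j v t) +
    \int[mu]_(v in `[0, Num.min s t]) Q i j v.
Proof.
move=> s0 t0; rewrite /mm dotp_phi//; last exact: sM.
rewrite (dotpC _ _ (fun=> 1)) -(dotpC P (M j t)) dotp_M1// mulr0 add0r.
by rewrite dotp_U//; [have [_ ->] := iQ_min i j s0 t0|exact: sM].
Qed.

Lemma second_moment_H2 i j s t : 0 <= s -> 0 <= t ->
  K i j s t = c j * dotp P (phi i s) (fun=> 1) +
    \sum_l a j l * (\int[mu]_(v in `[0, t]) K i l s v) + mm i j s t.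
Proof.
move=> s0 t0; have sp := sqint_sde i s0.
rewrite /K dotpC dotp_phi// dotp_U// (dotpC P (M j t)).
congr (_ + _ + _); apply: eq_bigr => l _; congr (_ * _).
by apply: eq_Rintegral => v _; rewrite dotpC.
Qed.

Let mean0 i : dotp P (phi i 0) (fun=> 1) = c i.
Proof.
rewrite dotp_phi//; last exact: sqint1.
rewrite dotp_M1// addr0 dotp_U//; last exact: sqint1.
rewrite big1 ?addr0; last by move=> l _; rewrite set_itv1 Rintegral_set1 mulr0.
by rewrite dotp1 Rintegral_probability_cst mulr1.
Qed.

Lemma second_moment0 i j : dotp P (phi i 0) (phi j 0) = c i * c j.
Proof.
have z f : \int[mu]_(v in `[0, 0]) f v = 0 by rewrite set_itv1 Rintegral_set1.
rewrite -/(K i j 0 0) second_moment_H2// second_moment_H1// minxx z addr0 mean0.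
rewrite !big1 ?addr0; first by rewrite mulrC.
- by move=> l _; rewrite z mulr0.
- by move=> l _; rewrite z mulr0.
Qed.

Variable T : R.
Hypothesis T0 : 0 <= T.

Let M_bound i t : 0 <= t -> t <= T -> dotp P (M i t) (M i t) <= dotp P (M i T) (M i T).
Proof.
move=> t0 tT; have [_ ->] := iQ_min i i t0 t0; have [iQ ->] := iQ_min i i T0 T0.
move: iQ; rewrite !minxx => iQ.
have Q0 v : 0 <= Q i i v by apply: sumr_ge0 => k _; exact: dotp_ge0.
have it : mu.-integrable `[0, t] (EFin \o (Q i i)).
  by apply: integrableS iQ => //; apply: subset_itvl; rewrite bnd_simp.
rewrite -subr_ge0 Rintegral_itvB ?bnd_simp//.
by apply: Rintegral_ge0 => v _; exact: Q0.
Qed.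

Let trunc_bound i t : 0 <= t -> t <= T ->
  dotp muP (trunc (drift i) t) (trunc (drift i) t) <=
  dotp muP (trunc (drift i) T) (trunc (drift i) T).
Proof.
move=> t0 tT; apply: le_Rintegral => //.
- exact: sqint_mul (struncdrift i t0) (struncdrift i t0).
- exact: sqint_mul (struncdrift i T0) (struncdrift i T0).
move=> z _; rewrite /trunc -!expr2 !exprMn ler_wpM2l ?sqr_ge0//.
rewrite !indicE !mem_setE !in_itv/=; case: (0 <= z.1) => //=.
by case: (leP z.1 t) => // zt; rewrite ?(le_trans zt tT)// expr0n sqr_ge0.
Qed.

Let U_bound i t : 0 <= t -> t <= T -> dotp P (U i t) (U i t) <=
  T * dotp muP (trunc (drift i) T) (trunc (drift i) T).
Proof.
move=> t0 tT.
apply: (le_trans (dotp_time_integral_le t0 (struncdrift i t0))).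
by rewrite ler_pM ?dotp_ge0//; exact: trunc_bound.
Qed.

(** The drift part is bounded by Cauchy-Schwarz in time; the stochastic part has, by the isometry, a
    second moment nondecreasing in t. The factor 3 is that of the square of a sum of three terms,
    and summing over i makes the bound uniform. *)
Lemma second_moment_bounded : exists B : R, forall i t, 0 <= t -> t <= T ->
  dotp P (phi i t) (phi i t) <= B /\ dotp P (M i t) (M i t) <= B.
Proof.
pose u i := T * dotp muP (trunc (drift i) T) (trunc (drift i) T).
pose v i := dotp P (M i T) (M i T).
have u0 i : 0 <= u i by rewrite mulr_ge0 ?dotp_ge0.
have v0 i : 0 <= v i by exact: dotp_ge0.
pose B i := 3 * (c i ^+ 2 + u i + v i).
have B0 i : 0 <= B i by rewrite mulr_ge0// !addr_ge0 ?sqr_ge0.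
exists (\sum_i B i) => i t t0 tT.
have Bi : B i <= \sum_i B i by rewrite (bigD1 i)//= lerDl sumr_ge0.
have hM := M_bound i t0 tT; have hU := U_bound i t0 tT.
split; last first.
  apply: (le_trans hM); apply: le_trans Bi; rewrite /B.
  by have := sqr_ge0 (c i); have := u0 i; have := v0 i; rewrite /v; lra.
apply: le_trans Bi; rewrite /B.
have sc := sqint_cst P (c i); have sU' := sU i t0; have sM' := sM i t0.
have -> : dotp P (phi i t) (phi i t) =
    dotp P (fun x => c i + U i t x + M i t x) (fun x => c i + U i t x + M i t x).
  have m1 := mphi i t0; have [m2 _] := scUM i t0.
  by rewrite (dotp_ae m1 m2 m1 (phiE i t0)) dotpC (dotp_ae m1 m2 m2 (phiE i t0)).
have scU := sqintD sc sU'.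
rewrite dotpDl//; last exact: scUM.
rewrite (dotpDr scU sM' scU) (dotpDr scU sM' sM').
rewrite (dotpDl sc sU' scU) (dotpDl sc sU' sM') (dotpDr sc sU' sc) (dotpDr sc sU' sU') (dotpDr sc sU' sM').
rewrite (dotpC P (U i t) (fun=> c i)).
rewrite !(dotpC P (M i t) (U i t)) !(dotpC P (M i t) (fun=> c i)).
have := dotp_norm_le sc sU'; have := dotp_norm_le sc sM'; have := dotp_norm_le sU' sM'.
have -> : dotp P (fun=> c i) (fun=> c i) = c i ^+ 2.
  by rewrite /dotp Rintegral_probability_cst expr2.
rewrite !ler_norml => /andP[_ h1] /andP[_ h2] /andP[_ h3].
rewrite -/(u i) in hU; rewrite -/(v i) in hM; lra.
Qed.

Lemma sde_second_moment : exists C : R, forall i j s t, 0 <= s -> s <= t -> t <= T ->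
  `|dotp P (phi i t) (phi j t) - dotp P (phi i s) (phi j s) - (t - s) *
    ((\sum_l a i l * dotp P (phi l s) (phi j s)) +
     (\sum_l a j l * dotp P (phi i s) (phi l s)) +
     \sum_l (\sum_k b k i l.1 * b k j l.2) * dotp P (phi l.1 s) (phi l.2 s))|
  <= C * (t - s) ^+ 2.
Proof.
have [B HB] := second_moment_bounded.
have QI i j t : 0 <= t -> {in `[0, t]%classic, Q i j =1
    (fun v => \sum_l q i j l * K l.1 l.2 v v)}.
  by move=> t0 v; rewrite inE/= in_itv/= => /andP[v0 _]; exact: QE.
apply: (@second_moment_estimate R J T B a q c (fun i s => dotp P (phi i s) (fun=> 1)) K mm).
- move=> i j s t s0 sT t0 tT.
  rewrite (le_trans (dotp_norm_le (sqint_sde i s0) (sqint_sde j t0)))//.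
  by have [h1 _] := HB i s s0 sT; have [h2 _] := HB j t t0 tT; lra.
- move=> i j s t s0 sT t0 tT.
  rewrite (le_trans (dotp_norm_le (sqint_sde i s0) (sM j t0)))//.
  by have [h1 _] := HB i s s0 sT; have [_ h2] := HB j t t0 tT; lra.
- move=> i j s s0 sT; have := iphi j T0 (sqint_sde i s0).
  by congr integrable; apply/funext => v /=; rewrite /K dotpC.
- by move=> i j s s0 sT; exact: iphi (sM j s0).
- move=> i j; have [+ _] := iQ_min i j T0 T0; rewrite minxx.
  by apply: eq_integrable => // v vT /=; rewrite (QI i j T).
- by move=> i j s t; rewrite /K dotpC.
- move=> i j s t s0 sT t0 tT; rewrite second_moment_H1//; congr (_ + _).
  by apply: eq_Rintegral; apply: QI; rewrite le_min s0.
- by move=> i j s t s0 sT t0 tT; exact: second_moment_H2.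
Qed.

End linear_sde.

(** * Euclidean and operator norms, Kronecker products *)

Section operator_norm.
Variable R : realType.

Definition vdot n (u v : 'cV[R]_n) : R := \sum_i u i 0 * v i 0.

Lemma vdotC n (u v : 'cV[R]_n) : vdot u v = vdot v u.
Proof. by apply: eq_bigr => i _; rewrite mulrC. Qed.

Lemma sqr_l2norm n (u : 'cV[R]_n) : l2norm u ^+ 2 = vdot u u.
Proof.
rewrite sqr_sqrtr; last by apply: sumr_ge0 => i _; rewrite sqr_ge0.
by apply: eq_bigr => i _; rewrite expr2.
Qed.

Lemma l2norm_ge0 n (u : 'cV[R]_n) : 0 <= l2norm u.
Proof. exact: sqrtr_ge0. Qed.

(** Lagrange's identity: the double sum of the squares (u_i v_j - u_j v_i)^2 is twice the defect. *)
Lemma vdot_cauchy_schwarz n (u v : 'cV[R]_n) : `|vdot u v| <= l2norm u * l2norm v.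
Proof.
rewrite -ler_sqr ?nnegrE ?mulr_ge0 ?l2norm_ge0// real_normK ?num_real//.
rewrite exprMn !sqr_l2norm -subr_ge0.
have : 0 <= \sum_i \sum_j (u i 0 * v j 0 - u j 0 * v i 0) ^+ 2.
  by do 2 (apply: sumr_ge0 => ? _); rewrite sqr_ge0.
have -> : \sum_i \sum_j (u i 0 * v j 0 - u j 0 * v i 0) ^+ 2 =
    \sum_i \sum_j ((u i 0 * u i 0) * (v j 0 * v j 0) +
      (v i 0 * v i 0) * (u j 0 * u j 0) - 2 * ((u i 0 * v i 0) * (u j 0 * v j 0))).
  by do 2 (apply: eq_bigr => ? _); ring.
under eq_bigr do rewrite sumrB big_split/= -!mulr_sumr.
rewrite sumrB big_split/= -!mulr_suml -mulr_sumr -mulr_suml -!/(vdot _ _).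
rewrite (_ : _ - _ = 2 * (vdot u u * vdot v v - vdot u v ^+ 2)); last by ring.
by rewrite pmulr_rge0.
Qed.

Lemma l2normZ n (k : R) (u : 'cV[R]_n) : l2norm (k *: u) = `|k| * l2norm u.
Proof.
rewrite /l2norm -sqrtr_sqr -sqrtrM ?sqr_ge0// mulr_sumr; congr Num.sqrt.
by apply: eq_bigr => i _; rewrite mxE exprMn.
Qed.

Lemma l2norm_eq0 n (u : 'cV[R]_n) : l2norm u = 0 -> u = 0.
Proof.
move=> u0; have : vdot u u = 0 by rewrite -sqr_l2norm u0 expr0n.
move/psumr_eq0P => H; apply/matrixP => i j; rewrite (ord1 j) mxE.
by apply/eqP; rewrite -sqrf_eq0 expr2 H// => k _; rewrite -expr2 sqr_ge0.
Qed.

Lemma l2norm0 n : l2norm (0 : 'cV[R]_n) = 0.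
Proof. by rewrite -(scale0r 0) l2normZ normr0 mul0r. Qed.

Section opnorm.
Variables (m n : nat).
Implicit Type M : 'M[R]_(m, n).

Let rowv M i : 'cV[R]_n := \col_j M i j.

(** [sup] is meaningful only on a nonempty bounded set; Cauchy-Schwarz on each row gives the
    Frobenius norm as a bound. *)
Lemma opnorm_has_sup M :
  has_sup [set l2norm (M *m x) | x in [set x : 'cV[R]_n | l2norm x <= 1]].
Proof.
split; first by exists (l2norm (M *m 0)), 0 => //=; rewrite l2norm0.
exists (Num.sqrt (\sum_i l2norm (rowv M i) ^+ 2)) => _ [x /= x1 <-].
rewrite ler_sqrt ?sumr_ge0// => [|i _]; last by rewrite sqr_ge0.
apply: ler_sum => i _.
have -> : (M *m x) i 0 = vdot (rowv M i) x.
  by rewrite mxE; apply: eq_bigr => j _; rewrite !mxE.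
rewrite -[leLHS]real_normK ?num_real// ler_sqr ?nnegrE ?l2norm_ge0//.
by rewrite (le_trans (vdot_cauchy_schwarz _ _))// ler_piMr// l2norm_ge0.
Qed.

Lemma l2norm_mulmx M x : l2norm (M *m x) <= opnorm M * l2norm x.
Proof.
have := l2norm_ge0 x; rewrite le_eqVlt => /predU1P[/esym x0|x0].
  by rewrite x0 (l2norm_eq0 x0) mulmx0 l2norm0 mulr0.
rewrite -ler_pdivrMr//; have ix : 0 <= (l2norm x)^-1 by rewrite invr_ge0 ltW.
have -> : l2norm (M *m x) / l2norm x = l2norm (M *m ((l2norm x)^-1 *: x)).
  by rewrite -scalemxAr l2normZ ger0_norm// mulrC.
apply: (sup_upper_bound (opnorm_has_sup M)); exists ((l2norm x)^-1 *: x) => //=.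
by rewrite l2normZ ger0_norm// mulVf// gt_eqF.
Qed.

Lemma opnorm_ge0 M : 0 <= opnorm M.
Proof.
apply: (sup_upper_bound (opnorm_has_sup M)); exists 0; rewrite /= ?l2norm0//.
by rewrite mulmx0 l2norm0.
Qed.

Lemma opnorm_le M c : 0 <= c -> (forall x, l2norm (M *m x) <= c * l2norm x) ->
  opnorm M <= c.
Proof.
move=> c0 H; apply: ge_sup; first by have [] := opnorm_has_sup M.
by move=> _ [x /= x1 <-]; rewrite (le_trans (H x))// ler_piMr.
Qed.

Lemma vdot_mulmx_le M u v : `|vdot u (M *m v)| <= opnorm M * l2norm u * l2norm v.
Proof.
rewrite (le_trans (vdot_cauchy_schwarz _ _))// [opnorm M * _]mulrC -mulrA.
by rewrite ler_wpM2l ?l2norm_ge0// l2norm_mulmx.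
Qed.

Lemma opnorm_le_vdot M c : 0 <= c ->
  (forall u v, `|vdot u (M *m v)| <= c * l2norm u * l2norm v) -> opnorm M <= c.
Proof.
move=> c0 H; apply: opnorm_le => // x.
have := l2norm_ge0 (M *m x); rewrite le_eqVlt => /predU1P[<-|x0].
  by rewrite mulr_ge0// l2norm_ge0.
rewrite -(ler_pM2l x0) -expr2 sqr_l2norm mulrCA mulrA.
by apply: le_trans (H _ _); exact: ler_norm.
Qed.

Lemma opnorm_entry M i j : `|M i j| <= opnorm M.
Proof.
have := vdot_mulmx_le M (delta_mx i 0) (delta_mx j 0).
have l1 k (l : 'I_k) : l2norm (delta_mx l 0 : 'cV[R]_k) = 1.
  rewrite /l2norm (bigD1 l)//= mxE !eqxx expr1n big1 ?addr0 ?sqrtr1// => a /negbTE al.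
  by rewrite mxE al expr0n.
rewrite !l1 !mulr1; apply: le_trans; rewrite le_eqVlt; apply/orP; left; apply/eqP.
congr (`|_|); rewrite /vdot (bigD1 i)//= big1 ?addr0; last first.
  by move=> a /negbTE ai; rewrite mxE ai mul0r.
rewrite !mxE !eqxx mul1r (bigD1 j)//= big1 ?addr0 ?mxE ?eqxx ?mulr1// => a /negbTE aj.
by rewrite mxE aj mulr0.
Qed.

Lemma opnorm0 : opnorm (0 : 'M[R]_(m, n)) = 0.
Proof.
apply/eqP; rewrite eq_le opnorm_ge0 andbT; apply: opnorm_le => // x.
by rewrite mul0mx l2norm0 mul0r.
Qed.

Lemma vdotDr k (u v w : 'cV[R]_k) : vdot u (v + w) = vdot u v + vdot u w.
Proof. by rewrite -big_split; apply: eq_bigr => i _; rewrite mxE mulrDr. Qed.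

Lemma opnormD M M' : opnorm (M + M') <= opnorm M + opnorm M'.
Proof.
apply: opnorm_le_vdot => [|u v]; first by rewrite addr_ge0 ?opnorm_ge0.
rewrite mulmxDl vdotDr (le_trans (ler_normD _ _))// !mulrDl lerD//; exact: vdot_mulmx_le.
Qed.

Lemma opnorm_sum I (s : seq I) (f : I -> 'M[R]_(m, n)) :
  opnorm (\sum_(i <- s) f i) <= \sum_(i <- s) opnorm (f i).
Proof.
elim: s => [|i s ih]; first by rewrite !big_nil opnorm0.
by rewrite !big_cons (le_trans (opnormD _ _))// lerD2l.
Qed.

End opnorm.

Lemma vdot_trmx m n (M : 'M[R]_(m, n)) u v : vdot u (M *m v) = vdot (M^T *m u) v.
Proof.
rewrite /vdot; under eq_bigr do rewrite mxE mulr_sumr.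
rewrite exchange_big/=; apply: eq_bigr => j _; rewrite mxE mulr_suml.
by apply: eq_bigr => i _; rewrite mxE; ring.
Qed.

Lemma opnorm_trmx_le m n (M : 'M[R]_(m, n)) : opnorm M^T <= opnorm M.
Proof.
apply: opnorm_le_vdot => [|u v]; first exact: opnorm_ge0.
rewrite vdot_trmx trmxK vdotC (le_trans (vdot_mulmx_le _ _ _))//.
by rewrite -!mulrA [l2norm v * _]mulrC.
Qed.

Lemma sum_mxtens m n (f : 'I_(m * n) -> R) :
  \sum_k f k = \sum_i \sum_j f (mxtens_index (i, j)).
Proof.
rewrite pair_big/= (reindex (@mxtens_index m n))/=; first by apply: eq_bigr => -[].
by exists (@mxtens_unindex m n) => i _; rewrite ?mxtens_indexK ?mxtens_unindexK.
Qed.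

(** The Kronecker product applies [Y] to each block [zk k] and then [X] across the blocks at every
    fixed inner index j; the squared norm of a vector is the sum over blocks in either direction. *)
Lemma opnorm_tens m n (X : 'M[R]_m) (Y : 'M[R]_n) :
  opnorm (X *t Y) <= opnorm X * opnorm Y.
Proof.
apply: opnorm_le => [|z]; first by rewrite mulr_ge0 ?opnorm_ge0.
rewrite -ler_sqr ?nnegrE ?mulr_ge0 ?opnorm_ge0 ?l2norm_ge0//.
pose zk k : 'cV[R]_n := \col_l z (mxtens_index (k, l)) 0.
pose y j : 'cV[R]_m := \col_k (Y *m zk k) j 0.
have E1 : l2norm ((X *t Y) *m z) ^+ 2 = \sum_j l2norm (X *m y j) ^+ 2.
  under eq_bigr do rewrite sqr_l2norm.
  rewrite sqr_l2norm /vdot sum_mxtens exchange_big/=; apply: eq_bigr => j _.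
  apply: eq_bigr => i _.
  suff -> : ((X *t Y) *m z) (mxtens_index (i, j)) 0 = (X *m y j) i 0 by [].
  rewrite !mxE sum_mxtens; apply: eq_bigr => k _; rewrite !mxE mulr_sumr.
  by apply: eq_bigr => l _; rewrite tensmxE !mxE mulrA.
have E2 : \sum_j l2norm (y j) ^+ 2 = \sum_k l2norm (Y *m zk k) ^+ 2.
  under eq_bigr do rewrite sqr_l2norm.
  under [RHS]eq_bigr do rewrite sqr_l2norm.
  by rewrite exchange_big/=; apply: eq_bigr => k _; apply: eq_bigr => j _; rewrite !mxE.
have E3 : l2norm z ^+ 2 = \sum_k l2norm (zk k) ^+ 2.
  rewrite sqr_l2norm /vdot sum_mxtens; apply: eq_bigr => k _.
  by rewrite sqr_l2norm; apply: eq_bigr => l _; rewrite mxE.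
have S p q (M : 'M[R]_(p, q)) x : l2norm (M *m x) ^+ 2 <= opnorm M ^+ 2 * l2norm x ^+ 2.
  by rewrite -exprMn ler_sqr ?nnegrE ?mulr_ge0 ?opnorm_ge0 ?l2norm_ge0// l2norm_mulmx.
rewrite E1 !exprMn E3.
apply: (@le_trans _ _ (opnorm X ^+ 2 * \sum_j l2norm (y j) ^+ 2)).
  by rewrite mulr_sumr; exact: ler_sum.
rewrite E2 -mulrA ler_wpM2l ?sqr_ge0// mulr_sumr.
exact: ler_sum.
Qed.

End operator_norm.

(** * Linear differential equations: local defects and decay *)

Section linear_ode.
Variable R : realType.
Notation mu := (@lebesgue_measure R).

Definition lin_ode (J : finType) (L : J -> J -> R) (z : J -> R -> R) :=
  (forall i, {within `[0, +oo[, continuous (z i)}) /\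
  forall i (t : R), 0 < t -> is_derive t 1 (z i) (\sum_l L i l * z l t).

Lemma within_itvcy_cc (f : R -> R) (S T : R) : 0 <= S ->
  {within `[0, +oo[, continuous f} -> {within `[S, T], continuous f}.
Proof.
move=> S0; apply: continuous_subspaceW => x /=; rewrite !in_itv/= andbT => /andP[Sx _].
exact: le_trans Sx.
Qed.

Lemma within_bounded (f : R -> R) (T : R) : {within `[0, T], continuous f} ->
  exists B, forall t, 0 <= t -> t <= T -> `|f t| <= B.
Proof.
move=> cf; case: (leP 0 T) => T0; last first.
  by exists 0 => t t0 /(le_trans t0); rewrite leNgt T0.
have [c1 _ H1] := EVT_max T0 cf; have [c2 _ H2] := EVT_min T0 cf.
exists (`|f c1| + `|f c2|) => t t0 tT.
have tI : t \in `[0, T]%R by rewrite in_itv/= t0.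
have := H1 t tI; have := H2 t tI; have := ler_norm (f c1).
have := ler_norm (- f c2); rewrite normrN => h1 h2 h3 h4.
have := normr_ge0 (f c1); have := normr_ge0 (f c2) => h5 h6.
by rewrite ler_norml; apply/andP; split; lra.
Qed.

(** The mean value theorem is used twice: it makes [z] Lipschitz on [0, T], and then the derivative
    at an intermediate time differs by O(t - s) from the right-hand side at s. It covers s = 0,
    where only continuity is known. *)
Lemma lin_ode_second_order (J : finType) (L : J -> J -> R) (z : J -> R -> R) (T : R) :
  lin_ode L z -> exists C : R, forall i s t, 0 <= s -> s <= t -> t <= T ->
  `|z i t - z i s - (t - s) * \sum_l L i l * z l s| <= C * (t - s) ^+ 2.
Proof.
move=> [cz dz].
have [B HB] : exists B, forall i t, 0 <= t -> t <= T -> `|z i t| <= B.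
  have bz i : exists B, forall t, 0 <= t -> t <= T -> `|z i t| <= B.
    by apply: within_bounded; exact: within_itvcy_cc.
  pose b i := sval (cid (bz i)).
  exists (\sum_i `|b i|) => i t t0 tT.
  rewrite (le_trans (svalP (cid (bz i)) t t0 tT))//.
  by rewrite (le_trans (ler_norm _))// (ler_sum_norm b).
pose A := \sum_i \sum_l `|L i l|.
have sumL i (x : J -> R) X : 0 <= X -> (forall l, `|x l| <= X) ->
    `|\sum_l L i l * x l| <= A * X.
  move=> X0 /(norm_sum_mul_le (L i))/le_trans; apply; rewrite ler_wpM2r//.
  by rewrite /A [leRHS](bigD1 i)//= lerDl sumr_ge0// => j _; exact: sumr_ge0.
have A0 : 0 <= A by apply: sumr_ge0 => i _; exact: sumr_ge0.
have mvt i s t : 0 <= s -> s < t -> exists2 c, s < c < t &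
    z i t - z i s = (\sum_l L i l * z l c) * (t - s).
  move=> s0 st.
  have [c cst ->] := @MVT _ (z i) (fun x => \sum_l L i l * z l x) s t st
    (fun x xI => dz i x (le_lt_trans s0 (proj1 (andP xI)))) (within_itvcy_cc s0 (cz i)).
  by exists c => //; move: cst; rewrite in_itv.
have lip i s t : 0 <= s -> s <= t -> t <= T -> `|z i t - z i s| <= A * B * (t - s).
  move=> s0 st tT.
  have B0 : 0 <= B by apply: le_trans (HB i t (le_trans s0 st) tT).
  move: st; rewrite le_eqVlt => /predU1P[->|st]; first by rewrite !subrr normr0 mulr0.
  have [c /andP[sc ct] ->] := mvt i s t s0 st.
  rewrite normrM [`|t - s|]ger0_norm ?subr_ge0 ?(ltW st)// ler_wpM2r ?subr_ge0 ?(ltW st)//.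
  by apply: sumL => // l; apply: HB; [exact: le_trans s0 (ltW sc)|exact: le_trans (ltW ct) tT].
exists (A * (A * B)) => i s t s0 st tT.
have B0 : 0 <= B by apply: le_trans (HB i t (le_trans s0 st) tT).
move: st; rewrite le_eqVlt => /predU1P[->|st].
  by rewrite !subrr mul0r subr0 normr0 expr0n mulr0.
have [c /andP[sc ct] ->] := mvt i s t s0 st.
have ts0 : 0 <= t - s by rewrite subr_ge0 ltW.
rewrite [(t - s) * _]mulrC -mulrBl normrM [`|t - s|]ger0_norm//.
rewrite [leRHS](_ : _ = A * (A * B * (t - s)) * (t - s)); last by ring.
rewrite ler_wpM2r// -sumrB; under eq_bigr do rewrite -mulrBr.
rewrite sumL ?mulr_ge0// => l.
rewrite (le_trans (lip l s c s0 (ltW sc) (le_trans (ltW ct) tT)))//.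
by rewrite ler_wpM2l ?mulr_ge0// lerD2r ltW.
Qed.

Lemma is_derive_expRl (k t : R) : is_derive t 1 (fun x => expR (k * x)) (k * expR (k * t)).
Proof.
have d1 : is_derive t 1 (fun x : R => k * x) k.
  by apply: is_derive_eq; rewrite /GRing.scale/= mulr1.
by rewrite mulrC; exact: is_derive1_comp.
Qed.

Lemma continuous_expRl (k : R) : continuous (fun x => expR (k * x)).
Proof.
move=> x; apply: differentiable_continuous; apply/derivable1_diffP.
by have [] := is_derive_expRl k x.
Qed.

(** [u] and [v] are the real and imaginary parts of a solution of f' = (a + i b) f + (p + i q). In
    the derivative of |f|^2 the rotation by b cancels, and Young's inequality gives 2 (u p + v q) <=
    - a |f|^2 + (p^2 + q^2) / (- a). *)
Lemma decay_step (u v p q : R -> R) (a b C c : R) : a < 0 -> 0 < c -> 0 <= C ->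
  {within `[0, +oo[, continuous u} -> {within `[0, +oo[, continuous v} ->
  (forall t : R, 0 < t -> is_derive t 1 u (a * u t - b * v t + p t)) ->
  (forall t : R, 0 < t -> is_derive t 1 v (a * v t + b * u t + q t)) ->
  (forall t, 0 <= t -> p t ^+ 2 + q t ^+ 2 <= C * expR (- c * t)) ->
  exists C' c', [/\ 0 < c', 0 <= C' &
    forall t, 0 <= t -> u t ^+ 2 + v t ^+ 2 <= C' * expR (- c' * t)].
Proof.
move=> a0 c0 C0 cu cv du dv pq.
pose al := - a / 2; pose c' := Num.min c al.
have al0 : 0 < al by rewrite divr_gt0// oppr_gt0.
have c'0 : 0 < c' by rewrite lt_min c0.
have c'c : c' <= c by rewrite ge_min lexx.
have c'al : c' <= al by rewrite ge_min lexx orbT.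
pose K := u 0 ^+ 2 + v 0 ^+ 2 + C / (al * - a).
have K0 : 0 <= K by rewrite !addr_ge0 ?sqr_ge0// divr_ge0// mulr_ge0 ?ltW// oppr_gt0.
exists K, c'; split => // t t0.
(* [f] is nonincreasing and starts at most at 0, hence the bound by [K]. In its derivative the terms
   in u^2 + v^2 are absorbed because al + c' + a <= 0, and the forcing because al K >= C / (- a),
   which is the reason for the last term of [K]. *)
pose f (x : R) : R := expR (al * x) * (expR (c' * x) * (u x ^+ 2 + v x ^+ 2) - K).
have df (x : R) : 0 < x -> is_derive x 1 f
    (al * f x + expR (al * x) * (c' * (expR (c' * x) * (u x ^+ 2 + v x ^+ 2)) +
      expR (c' * x) * (2 * a * (u x ^+ 2 + v x ^+ 2) + 2 * (u x * p x + v x * q x)))).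
  move=> x0; have := du x x0; have := dv x x0.
  have := is_derive_expRl al x; have := is_derive_expRl c' x => d1 d2 d3 d4.
  by rewrite /f; apply: is_derive_eq; rewrite /GRing.scale/=; ring.
have cf : {within `[0, +oo[, continuous f}.
  have ce k : {within `[0, +oo[, continuous (fun x : R => expR (k * x))}.
    by apply: continuous_subspaceT; exact: continuous_expRl.
  move=> x; apply: cvgM; first exact: ce.
  apply: cvgB; last exact: cvg_cst.
  apply: cvgM; first exact: ce.
  by apply: cvgD; rewrite expr2; apply: cvgM; (exact: cu || exact: cv).
have := @ler0_derive1_nincry _ f 0 _ _ cf 0 t (lexx _) t0 => H.
have {H} : f t <= f 0.
  apply: H => x; rewrite in_itv/= andbT => x0; first by have [] := df x x0.
  rewrite derive1E; have d := df x x0; rewrite derive_val /f.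
  set E := expR (c' * x); set G := expR (al * x); set V := u x ^+ 2 + v x ^+ 2.
  rewrite [leLHS](_ : _ = G * (al * (E * V - K) + c' * (E * V) +
    E * (2 * a * V + 2 * (u x * p x + v x * q x)))); last by ring.
  rewrite pmulr_rle0 ?expR_gt0//.
  have E0 : 0 < E by exact: expR_gt0.
  have EC : E * (p x ^+ 2 + q x ^+ 2) <= C.
    apply: (@le_trans _ _ (E * (C * expR (- c * x)))).
      by apply: ler_wpM2l; [exact: ltW|apply: pq; exact: ltW].
    rewrite mulrCA -expRD ler_piMr// expR_le1 -mulrDl pmulr_lle0//.
    by rewrite subr_le0.
  have V0 : 0 <= V by rewrite addr_ge0 ?sqr_ge0.
  have S : - a * (2 * (u x * p x + v x * q x)) <=
      a ^+ 2 * V + (p x ^+ 2 + q x ^+ 2).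
    have := sqr_ge0 (a * u x + p x); have := sqr_ge0 (a * v x + q x).
    by rewrite /V; nra.
  have al2 : a = - 2 * al by rewrite /al; lra.
  have EV0 : 0 <= E * V by rewrite mulr_ge0// ltW.
  have na0 : 0 < - a by rewrite oppr_gt0.
  have KC : C <= - a * (al * K).
    have -> : C = - a * (al * (C / (al * - a))).
      by field; rewrite (lt_eqF a0) (gt_eqF al0).
    rewrite ler_pM2l// ler_pM2l// /K lerDr addr_ge0 ?sqr_ge0//.
  rewrite -(ler_pM2l na0) mulr0.
  rewrite [leLHS](_ : _ = - a * (al + c' + 2 * a) * (E * V) - - a * (al * K) +
     E * (- a * (2 * (u x * p x + v x * q x)))); last by ring.
  have h1 : E * (- a * (2 * (u x * p x + v x * q x))) <= a ^+ 2 * (E * V) + C.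
    apply: (le_trans (ler_wpM2l (ltW E0) S)).
    by rewrite mulrDr mulrCA lerD2l.
  have h2 : - a * (al + c' + 2 * a) * (E * V) + a ^+ 2 * (E * V) <= 0.
    rewrite -mulrDl mulr_le0_ge0// [leLHS](_ : _ = - a * (al + c' + a)); last by ring.
    by rewrite pmulr_rle0//; lra.
  lra.
rewrite {2}/f !mulr0 expR0 !mul1r => ft.
have {ft} : f t <= 0.
  apply: (le_trans ft); rewrite /K opprD addrA subrr add0r oppr_le0.
  by rewrite divr_ge0// mulr_ge0 ?ltW// oppr_gt0.
rewrite pmulr_rle0 ?expR_gt0// subr_le0 mulNr expRN ler_pdivlMr ?expR_gt0//.
by rewrite mulrC.
Qed.

End linear_ode.

(** * Decay of solutions with a Hurwitz generator *)

Section hurwitz.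
Variable R : realType.
Notation mu := (@lebesgue_measure R).
Notation Re := complex.Re.
Notation Im := complex.Im.

Lemma Re_sum I (s : seq I) (f : I -> R[i]) :
  Re (\sum_(i <- s) f i) = \sum_(i <- s) Re (f i).
Proof.
elim: s => [|i s ih]; first by rewrite !big_nil.
by rewrite !big_cons -ih; case: (f i) => a b; case: (\sum_(_ <- _) _).
Qed.

Lemma Im_sum I (s : seq I) (f : I -> R[i]) :
  Im (\sum_(i <- s) f i) = \sum_(i <- s) Im (f i).
Proof.
elim: s => [|i s ih]; first by rewrite !big_nil.
by rewrite !big_cons -ih; case: (f i) => a b; case: (\sum_(_ <- _) _).
Qed.

Lemma ReDM (x y z : R[i]) : Re (x + y * z) = Re y * Re z - Im y * Im z + Re x.
Proof. by case: x y z => ? ? [? ?] [? ?] /=; ring. Qed.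

Lemma ImDM (x y z : R[i]) : Im (x + y * z) = Re y * Im z + Im y * Re z + Im x.
Proof. by case: x y z => ? ? [? ?] [? ?] /=; ring. Qed.

Lemma is_derive_comb (J : finType) (al : J -> R) (z : J -> R -> R) (dz : J -> R) (t : R) :
  (forall k, is_derive t 1 (z k) (dz k)) ->
  is_derive t 1 (fun x => \sum_k al k * z k x) (\sum_k al k * dz k).
Proof.
move=> dzk.
have H (s : seq J) : is_derive t 1 (fun x => \sum_(k <- s) al k * z k x)
    (\sum_(k <- s) al k * dz k).
  elim: s => [|k s ih].
    rewrite big_nil (_ : (fun _ => _) = fun=> 0); first exact: is_derive_cst.
    by apply/funext => x; rewrite big_nil.
  rewrite big_cons (_ : (fun _ => _) =
    (fun x => al k * z k x) + (fun x => \sum_(i <- s) al i * z i x)).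
    by apply: is_deriveD; exact: is_deriveZ (dzk k).
  by apply/funext => x; rewrite big_cons.
exact: H.
Qed.

Section decay.
Variables (N : nat) (G : 'M[R]_N) (z : 'I_N -> R -> R).
Hypothesis zode : lin_ode (fun l k => G k l) z.
Let GC := map_mx (real_complex R) G.

(** [zode] says that the row vector x of the functions [z] solves x' = x G; [u M e] and [v M e] are
    the real and imaginary parts of the entry e of x M. *)
Let u (M : 'M[R[i]]_N) e t := \sum_k Re (M k e) * z k t.
Let v (M : 'M[R[i]]_N) e t := \sum_k Im (M k e) * z k t.

Let decays (M : 'M[R[i]]_N) := forall e, exists C c, [/\ 0 < c, 0 <= C &
  forall t, 0 <= t -> u M e t ^+ 2 + v M e t ^+ 2 <= C * expR (- c * t)].

Let ccomb (al : 'I_N -> R) : {within `[0, +oo[, continuous (fun t => \sum_k al k * z k t)}.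
Proof.
have [cz _] := zode.
have H (s : seq 'I_N) :
    {within `[0, +oo[, continuous (fun t => \sum_(k <- s) al k * z k t)}.
  elim: s => [|k s ih].
    rewrite (_ : (fun _ => _) = fun=> 0); first by move=> x; exact: cvg_cst.
    by apply/funext => x; rewrite big_nil.
  rewrite (_ : (fun _ => _) = fun x => al k * z k x + \sum_(i <- s) al i * z i x).
    by move=> x; apply: cvgD; [apply: cvgMr; exact: cz|exact: ih].
  by apply/funext => x; rewrite big_cons.
exact: H.
Qed.

(* With f = x M, the equation x' = x G reads f' = lambda f + x (G - lambda) M. *)
Let decays_step (M : 'M[R[i]]_N) (lam : R[i]) : Re lam < 0 ->
  decays ((GC - lam%:M) *m M) -> decays M.
Proof.
move=> lam0 dM e; have [C [c [c0 C0 H]]] := dM e.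
have GE l : (GC *m M) l e = ((GC - lam%:M) *m M) l e + lam * M l e.
  have -> : GC *m M = (GC - lam%:M) *m M + lam *: M.
    by rewrite mulmxBl mul_scalar_mx subrK.
  by rewrite mxE [X in _ + X]mxE.
have GR l : Re ((GC *m M) l e) = \sum_k G l k * Re (M k e).
  rewrite mxE Re_sum; apply: eq_bigr => k _; rewrite mxE.
  by case: (M k e) => x y /=; rewrite mul0r subr0.
have GI l : Im ((GC *m M) l e) = \sum_k G l k * Im (M k e).
  rewrite mxE Im_sum; apply: eq_bigr => k _; rewrite mxE.
  by case: (M k e) => x y /=; rewrite mul0r addr0.
have swap (al : 'I_N -> R) t : \sum_k al k * (\sum_l G l k * z l t) =
    \sum_l (\sum_k G l k * al k) * z l t.
  under eq_bigr do rewrite mulr_sumr.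
  rewrite exchange_big/=; apply: eq_bigr => l _; rewrite mulr_suml.
  by apply: eq_bigr => k _; ring.
apply: (decay_step (p := u ((GC - lam%:M) *m M) e) (q := v ((GC - lam%:M) *m M) e)
  (b := Im lam) lam0 c0 C0 _ _ _ _ H).
- exact: ccomb.
- exact: ccomb.
- move=> t t0; have [_ dz] := zode.
  have d := is_derive_comb (fun k => Re (M k e)) (dz ^~ t ^~ t0).
  apply: (is_derive_eq d); rewrite swap /u /v !mulr_sumr -sumrB -big_split/=.
  by apply: eq_bigr => l _; rewrite -GR GE ReDM; ring.
- move=> t t0; have [_ dz] := zode.
  have d := is_derive_comb (fun k => Im (M k e)) (dz ^~ t ^~ t0).
  apply: (is_derive_eq d); rewrite swap /u /v !mulr_sumr -!big_split/=.
  by apply: eq_bigr => l _; rewrite -GI GE ImDM; ring.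
Qed.

Let decays_prod (s : seq R[i]) (M : 'M[R[i]]_N) : (forall lam, lam \in s -> Re lam < 0) ->
  decays (foldr (fun lam X => (GC - lam%:M) *m X) M s) -> decays M.
Proof.
elim: s M => [//|lam s ih] M hs /= H.
apply: ih; first by move=> x xs; apply: hs; rewrite inE xs orbT.
by apply: decays_step H; apply: hs; rewrite inE eqxx.
Qed.

Hypothesis hurw : forall lam : R[i], eigenvalue GC lam -> Re lam < 0.

(* Cayley-Hamilton: the product of the G - lambda_j is the zero matrix. *)
Lemma hurwitz_decay l : exists C c, [/\ 0 < c, 0 <= C &
  forall t, 0 <= t -> z l t ^+ 2 <= C * expR (- c * t)].
Proof.
have d1 : decays 1%:M.
  have [s Hs] := closed_field_poly_normal (char_poly GC).
  rewrite (monicP (char_poly_monic GC)) scale1r in Hs.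
  apply: (@decays_prod s).
    move=> lam ls; apply: hurw; rewrite eigenvalue_root_char Hs root_prod_XsubC.
    exact: ls.
  suff -> : foldr (fun lam X => (GC - lam%:M) *m X) 1%:M s = 0.
    move=> e; exists 0, 1; split => // t t0.
    rewrite /u /v !big1 ?expr0n ?mul0r ?addr0// => k _; by rewrite mxE mul0r.
  (* Cayley-Hamilton is applied in positive dimension; in dimension 0 every matrix is 0. *)
  clear -Hs; case: N GC s Hs => [|N'] GC' s Hs; first by apply/matrixP => -[].
  rewrite -[RHS](Cayley_Hamilton GC') Hs rmorph_prod.
  elim: s {Hs} => [|lam s ih]; first by rewrite big_nil.
  by rewrite big_cons -ih /= rmorphB/= horner_mx_X horner_mx_C.
have [C [c [c0 C0 H]]] := d1 l; exists C, c; split => // t t0.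
apply: le_trans (H t t0).
rewrite (_ : u 1%:M l t = z l t); first by rewrite lerDl sqr_ge0.
rewrite /u (bigD1 l)//= mxE eqxx/= mul1r big1 ?addr0// => k /negbTE kl.
by rewrite mxE kl/= mul0r.
Qed.

(** [hurwitz_decay] bounds the square, so the function itself is dominated by a multiple of the
    exponential density of rate c / 2. *)
Lemma hurwitz_integrable l : mu.-integrable `[0, +oo[ (EFin \o z l).
Proof.
have [C [c [c0 C0 H]]] := hurwitz_decay l; have [cz _] := zode.
have mz : measurable_fun `[(0 : R), +oo[%classic (z l).
  by apply: subspace_continuous_measurable_fun => //; exact: cz.
have c20 : 0 < c / 2 by rewrite divr_gt0.
have ie := integrable_exponential_pdf c20.
have ie' : mu.-integrable `[0, +oo[
    (fun x => (Num.sqrt C / (c / 2))%:E * (exponential_pdf (c / 2) x)%:E)%E.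
  by apply: integrableZl => //; exact: integrableS ie.
apply: le_integrable ie' => //; first exact/measurable_EFinP.
move=> t; rewrite /= in_itv/= andbT => t0.
rewrite lee_fin [leRHS]ger0_norm; last first.
  apply: mulr_ge0; first by rewrite divr_ge0 ?sqrtr_ge0 ?(ltW c20).
  exact: exponential_pdf_ge0 (ltW c20) t.
rewrite exponential_pdfE//=.
rewrite mulrA divfK ?gt_eqF// -sqrtr_sqr.
rewrite (le_trans (_ : _ <= Num.sqrt (C * expR (- c * t))))//.
  by rewrite ler_sqrt ?H// mulr_ge0// expR_ge0.
rewrite sqrtrM// ler_wpM2l ?sqrtr_ge0//.
rewrite (_ : expR (- c * t) = expR (- (c / 2 * t)) ^+ 2).
  by rewrite sqrtr_sqr ger0_norm ?expR_ge0// -mulNr.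
rewrite -expRM_natr; congr expR; lra.
Qed.

End decay.

End hurwitz.

(* The integral of a nonnegative function is a supremum over the simple
   functions below it, so it is monotone on non-measurable functions too. *)
Lemma le_integral_ge0 d (T : measurableType d) (R : realType)
    (mu : {measure set T -> \bar R}) (D : set T) (f g : T -> \bar R) :
  (forall x, D x -> (0 <= f x)%E) -> (forall x, D x -> (f x <= g x)%E) ->
  (\int[mu]_(x in D) f x <= \int[mu]_(x in D) g x)%E.
Proof.
move=> f0 fg.
have g0 x : D x -> (0 <= g x)%E by move=> Dx; exact: le_trans (f0 x Dx) (fg x Dx).
rewrite !ge0_integralE//=; apply: le_ereal_sup => _ [h /= hf <-]; exists h => //= x.
apply: (le_trans (hf x)); rewrite !patchE; case: ifPn => // xD.
by apply: fg; rewrite inE in xD.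
Qed.

(** [g] may fail to be measurable, so the constant is not pulled out of its integral: [f], which is
    measurable, is divided by it instead. This forces k = 0 to be treated apart. *)
Lemma le_integral_scaled d (T : measurableType d) (R : realType)
    (mu : {measure set T -> \bar R}) (D : set T) (f : T -> R) (k : R) (g : T -> \bar R) :
  measurable D -> measurable_fun D f -> 0 <= k -> (forall x, D x -> 0 <= f x) ->
  (forall x, D x -> (0 <= g x)%E) -> (forall x, D x -> ((f x)%:E <= k%:E * g x)%E) ->
  (\int[mu]_(x in D) (f x)%:E <= k%:E * \int[mu]_(x in D) g x)%E.
Proof.
move=> mD mf; rewrite le_eqVlt => /predU1P[<-|k0] f0 g0 fg.
  rewrite mul0e integral0_eq// => x Dx; apply/eqP; rewrite eq_le.
  by have := fg x Dx; rewrite mul0e => ->; rewrite lee_fin f0.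
have -> : (\int[mu]_(x in D) (f x)%:E = k%:E * \int[mu]_(x in D) (k^-1 * f x)%:E)%E.
  rewrite -ge0_integralZl//.
  - by apply: eq_integral => x _; rewrite -EFinM mulrA divff ?mul1r// gt_eqF.
  - by apply/measurable_EFinP; exact: measurable_funM.
  - by move=> x Dx; rewrite lee_fin mulr_ge0 ?f0// invr_ge0 ltW.
  - by rewrite lee_fin ltW.
rewrite lee_wpmul2l ?lee_fin ?(ltW k0)//; apply: le_integral_ge0 => x Dx.
  by rewrite lee_fin mulr_ge0 ?f0// invr_ge0 ltW.
by rewrite EFinM lee_pdivrMl// fg.
Qed.

(** * Integrals and series of matrices, convergence of the Gramian series *)

Section matrix_series.
Variables (R : realType) (n : nat).

Lemma cvg_mx_entry (M : nat -> 'M[R]_n) (Q : 'M[R]_n) :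
  (forall i j, M r i j @[r --> \oo] --> Q i j) -> M r @[r --> \oo] --> Q.
Proof.
move=> H; apply/cvgrPdist_le => /= e e0; near=> r.
rewrite /Num.Def.normr/= mx_normrE (bigmax_le _ (ltW e0))//= => i _.
rewrite !mxE/=; move: i; near: r; apply: filter_forall => /= i.
by have /cvgrPdist_le := H i.1 i.2; exact.
Unshelve. all: by end_near. Qed.

Lemma cvg_opnorm_series (M : nat -> 'M[R]_n) (c : R) :
  (forall r, \sum_(1 <= i < r.+1) opnorm (M i) <= c) ->
  exists Q : 'M[R]_n, (fun r => \sum_(1 <= i < r.+1) M i) @ \oo --> Q.
Proof.
move=> Hc.
have S i j : cvgn (series (fun k => M k.+1 i j)).
  apply: normed_cvg; apply: nondecreasing_is_cvgn.
    apply/nondecreasing_seqP => r; rewrite /normed_series_of seriesSr lerDl.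
    exact: normr_ge0.
  exists c => _ [r _ <-]; apply: le_trans (Hc r); rewrite big_add1/= /normed_series_of /series/=.
  by apply: ler_sum => k _; exact: opnorm_entry.
exists (\matrix_(i, j) limn (series (fun k => M k.+1 i j))).
apply: cvg_mx_entry => i j; rewrite mxE.
rewrite (_ : (fun r => _) = series (fun k => M k.+1 i j)); first exact: S.
by apply/funext => r; rewrite big_add1/= summxE /series.
Qed.

Notation mu := (@lebesgue_measure R).

Lemma mxintegral_vdot (D : set R) (Z : R -> 'M[R]_n) (u v : 'cV[R]_n) :
  measurable (D : set (measurableTypeR R)) -> mxintegrable D Z ->
  mu.-integrable D (EFin \o (fun t => vdot u (Z t *m v))) /\
  vdot u (mxintegral D Z *m v) = \int[mu]_(t in D) vdot u (Z t *m v).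
Proof.
move=> mD iZ.
have E (X : 'M[R]_n) : vdot u (X *m v) = \sum_i \sum_j (u i 0 * v j 0) * X i j.
  apply: eq_bigr => i _; rewrite mxE mulr_sumr; apply: eq_bigr => j _; ring.
have i2 i j : mu.-integrable D (EFin \o (fun t => (u i 0 * v j 0) * Z t i j)).
  by apply: integrable_scale => //; exact: iZ.
have h1 i := Rintegral_sum (index_enum 'I_n) mD (i2 i).
have [h2 h3] := Rintegral_sum (index_enum 'I_n) mD (fun i => proj1 (h1 i)).
split.
  by rewrite (_ : (fun t => _) = fun t => \sum_i \sum_j (u i 0 * v j 0) * Z t i j)//;
     apply/funext => t; exact: E.
rewrite E; under [RHS]eq_Rintegral do rewrite E.
rewrite h3; apply: eq_bigr => i _; rewrite (proj2 (h1 i)); apply: eq_bigr => j _.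
by rewrite RintegralZl ?mxE//; exact: iZ.
Qed.

(** Pairing with u and v turns the matrix integral into a scalar one. [g] is extended-real because
    it will be the expectation of a squared norm, which may be infinite. *)
Lemma opnorm_mxintegral_le (D : set R) (Z : R -> 'M[R]_n) (k : R) (g : R -> \bar R) :
  measurable (D : set (measurableTypeR R)) -> mxintegrable D Z -> 0 <= k ->
  (forall t, D t -> (0 <= g t)%E) ->
  (forall t, D t -> forall u v, (`|vdot u (Z t *m v)|%:E <= (k * l2norm u * l2norm v)%:E * g t)%E) ->
  ((opnorm (mxintegral D Z))%:E <= k%:E * \int[mu]_(t in D) g t)%E.
Proof.
move=> mD iZ k0 g0 H.
have B u v : (`|vdot u (mxintegral D Z *m v)|%:E <=
    (k * l2norm u * l2norm v)%:E * \int[mu]_(t in D) g t)%E.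
  have [iv ->] := mxintegral_vdot u v mD iZ.
  have /integrableP[/measurable_EFinP mv _] := iv.
  rewrite EFin_normr_Rintegral// (le_trans (le_abse_integral _ _ _))//.
    exact/measurable_EFinP.
  apply: le_integral_scaled => //.
  - exact: measurableT_comp.
  - by rewrite !mulr_ge0 ?l2norm_ge0.
  - by move=> t Dt; exact: H.
have : (0 <= \int[mu]_(t in D) g t)%E by exact: integral_ge0.
case: (\int[mu]_(t in D) g t)%E B => [G|//|//] B G0.
  rewrite -EFinM lee_fin; apply: opnorm_le_vdot; first by rewrite mulr_ge0.
  move=> u v; have := B u v; rewrite -EFinM lee_fin => /le_trans; apply.
  by rewrite le_eqVlt; apply/orP; left; apply/eqP; ring.
(* The integral of [g] is infinite here. If k = 0 the right-hand side is still 0, by the convention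
   that 0 times infinity is 0, and [B] then shows that the matrix integral vanishes. *)
move: k0; rewrite le_eqVlt => /predU1P[k0|k0]; last by rewrite gt0_muley ?lte_fin// leey.
rewrite -k0 mul0e lee_fin; apply: opnorm_le_vdot => // u v.
by have := B u v; rewrite -k0 !mul0r mul0e lee_fin.
Qed.

Lemma total_norm_partial (D : set R) (Z : nat -> R -> 'M[R]_n) (r : nat) :
  (\sum_(1 <= i < r) \int[mu]_(t in D) (opnorm (Z i t))%:E <= total_norm D Z)%E.
Proof.
apply: nneseries_lim_ge => k _ _; apply: integral_ge0 => t _.
by rewrite lee_fin opnorm_ge0.
Qed.

Lemma total_norm_ge0 (D : set R) (Z : nat -> R -> 'M[R]_n) : (0 <= total_norm D Z)%E.
Proof.
apply: nneseries_ge0 => k _ _; apply: integral_ge0 => t _.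
by rewrite lee_fin opnorm_ge0.
Qed.

Lemma mxintegrable_total_norm (D : set R) (Z : nat -> R -> 'M[R]_n) (i : nat) :
  measurable (D : set (measurableTypeR R)) ->
  (forall a b, measurable_fun D (fun t => Z i t a b)) ->
  (1 <= i)%N -> (total_norm D Z < +oo)%E -> mxintegrable D (Z i).
Proof.
move=> mD mZ i1 Zy a b; apply/integrableP; split.
  by apply/measurable_EFinP; exact: mZ.
apply: (@le_lt_trans _ _ (\int[mu]_(t in D) (opnorm (Z i t))%:E)%E).
  apply: le_integral_ge0 => t _ /=; first by rewrite lee_fin.
  by rewrite lee_fin opnorm_entry.
apply: le_lt_trans Zy; apply: le_trans (total_norm_partial D Z i.+1).
rewrite big_nat_recr//= leeDr// sume_ge0// => k _.
by apply: integral_ge0 => t _; rewrite lee_fin opnorm_ge0.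
Qed.

Lemma opnorm_mxintegral_sum_le (D : set R) (Z : nat -> R -> 'M[R]_n) (r : nat) :
  measurable (D : set (measurableTypeR R)) ->
  (forall i, (1 <= i)%N -> mxintegrable D (Z i)) ->
  ((\sum_(1 <= i < r) opnorm (mxintegral D (Z i)))%:E <= total_norm D Z)%E.
Proof.
move=> mD iZ; apply: le_trans (total_norm_partial D Z r).
rewrite -sumEFin !big_nat; apply: lee_sum => i /andP[i1 _].
rewrite -[leRHS]mul1e; apply: (opnorm_mxintegral_le mD (iZ i i1)) => //.
  by move=> t _; rewrite lee_fin opnorm_ge0.
move=> t _ u v; rewrite -EFinM lee_fin mul1r.
by rewrite (le_trans (vdot_mulmx_le _ _ _))// [leRHS]mulrC mulrA.
Qed.

Lemma gramian_exists_total_norm (D : set R) (Z : nat -> R -> 'M[R]_n) :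
  measurable (D : set (measurableTypeR R)) ->
  (forall i a b, (1 <= i)%N -> measurable_fun D (fun t => Z i t a b)) ->
  (total_norm D Z < +oo)%E -> gramian_exists D Z.
Proof.
move=> mD mZ Zy.
have iZ i : (1 <= i)%N -> mxintegrable D (Z i).
  by move=> i1; apply: mxintegrable_total_norm => // a b; exact: mZ.
split => //; apply: (@cvg_opnorm_series _ (fine (total_norm D Z))) => r.
rewrite -lee_fin fineK; first exact: opnorm_mxintegral_sum_le.
by rewrite ge0_fin_numE// total_norm_ge0.
Qed.

(* y_i <= g sum_k z_k y_(i-k) with g sum_k z_k < 1 bounds the sum of the y_i. *)
Lemma gramian_exists_convolution (D : set R) (Zd : nat -> R -> 'M[R]_n)
    (gain tot : \bar R) (z : nat -> R) :
  (0 <= gain)%E -> (tot < +oo)%E -> (gain * tot < 1)%E ->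
  (forall i, 0 <= z i) -> (forall r, ((\sum_(1 <= i < r) z i)%:E <= tot)%E) ->
  (forall i, (1 <= i)%N -> mxintegrable D (Zd i)) ->
  (forall i, (2 <= i)%N -> ((opnorm (mxintegral D (Zd i)))%:E <=
    gain * (\sum_(1 <= k < i) z k * opnorm (mxintegral D (Zd (i - k)%N)))%:E)%E) ->
  gramian_exists D Zd.
Proof.
move=> g0 ty gt1 z0 zt iZ H; split => //.
pose y i := opnorm (mxintegral D (Zd i)).
have y0 i : 0 <= y i by exact: opnorm_ge0.
have tot0 : (0 <= tot)%E by have := zt 0%N; rewrite big_geq.
(* If [tot] is 0 the gain may be infinite; but then all z_k vanish, and so do the y_i with i >= 2.
   If [tot] is positive the gain is finite and rho is the product of the two. *)
have [rho [rho0 rho1 Hrho]] : exists rho : R, [/\ 0 <= rho, rho < 1 &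
    forall r, \sum_(2 <= i < r.+1) y i <= rho * \sum_(1 <= i < r) y i].
  move: tot0; rewrite le_eqVlt => /predU1P[tot0|tot0].
    have zz k : (1 <= k)%N -> z k = 0.
      move=> k1; apply/eqP; rewrite eq_le z0 andbT.
      have := zt k.+1; rewrite -tot0 lee_fin big_nat_recr//=; apply: le_trans.
      by rewrite lerDr sumr_ge0.
    exists 0; split => // r; rewrite mul0r big_nat; apply: sumr_le0 => i /andP[i2 _].
    have := H i i2; rewrite big_nat big1 ?mule0 ?lee_fin// => k /andP[k1 _].
    by rewrite zz// mul0r.
  have tf : tot \is a fin_num by rewrite ge0_fin_numE// ltW.
  have gf : gain \is a fin_num.
    rewrite ge0_fin_numE// ltey; apply/eqP => gy; move: gt1.
    by rewrite gy gt0_mulye// ltNge leey.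
  pose t := fine tot; pose g := fine gain.
  have t0 : 0 <= t by apply: fine_ge0; rewrite ltW.
  have gR0 : 0 <= g by exact: fine_ge0.
  exists (g * t); split; first by rewrite mulr_ge0.
    by rewrite -lte_fin EFinM !fineK.
  move=> r; set Y := \sum_(1 <= i < r) y i.
  have Y0 : 0 <= Y by exact: sumr_ge0.
  (* The sums are exchanged and i is shifted by k; the inner sum then runs over an initial segment
     of the range of [Y], and the terms left out are nonnegative. *)
  have conv : \sum_(2 <= i < r.+1) \sum_(1 <= k < i) z k * y (i - k)%N <=
      (\sum_(1 <= k < r) z k) * Y.
    have W i : (2 <= i < r.+1)%N -> \sum_(1 <= k < i) z k * y (i - k)%N =
        \sum_(1 <= k < r | (k < i)%N) z k * y (i - k)%N.
      by move=> /andP[_ ir]; rewrite (big_nat_widen _ _ r).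
    rewrite (eq_big_nat _ _ W) (exchange_big_dep_nat predT)//= mulr_suml.
    rewrite big_nat [leRHS]big_nat; apply: ler_sum => k /andP[k1 kr].
    rewrite -mulr_sumr ler_wpM2l//.
    rewrite (_ : \sum_(2 <= i < r.+1 | _) _ = \sum_(k.+1 <= i < r.+1) y (i - k)%N); last first.
      by rewrite (big_nat_widenl k.+1 2).
    rewrite -(add1n k) big_addn.
    under eq_bigr do rewrite addnK.
    rewrite /Y (@big_cat_nat _ _ _ (r.+1 - k)%N 1 r)//=.
    - by rewrite lerDl sumr_ge0.
    - by rewrite subn_gt0 ltnS ltnW.
    - by rewrite leq_subLR -add1n leq_add2r.
  apply: (@le_trans _ _ (g * \sum_(2 <= i < r.+1) \sum_(1 <= k < i) z k * y (i - k)%N)).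
    rewrite mulr_sumr !big_nat; apply: ler_sum => i /andP[i2 _].
    by rewrite -lee_fin EFinM fineK//; exact: H.
  rewrite -mulrA ler_wpM2l// (le_trans conv)// ler_wpM2r//.
  by rewrite -lee_fin fineK//.
(* Partial sums s satisfy s <= y_1 + rho s, whence this bound. *)
apply: (@cvg_opnorm_series _ (y 1%N / (1 - rho))) => r.
rewrite ler_pdivlMr ?subr_gt0// -/(y _).
case: r => [|r]; first by rewrite big_geq// mul0r; exact: y0.
have h := Hrho r.+1; rewrite big_ltn// -/(y 1%N).
have : \sum_(1 <= i < r.+1) y i <= y 1%N + \sum_(2 <= i < r.+2) y i.
  rewrite -big_ltn// [leRHS]big_nat_recr//= lerDl; exact: y0.
have : 0 <= \sum_(2 <= i < r.+2) y i by exact: sumr_ge0.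
move: h; set S := \sum_(2 <= i < _) _; set S' := \sum_(1 <= i < _) _.
rewrite -/(y _) => h1 h2 h3.
have : rho * S' <= rho * (y 1%N + S) by rewrite ler_wpM2l.
by nra.
Qed.

End matrix_series.

(** * The dual Lyapunov equation in coordinates *)

Section lyapunov_entries.
Variables (R : realType) (n m : nat).
Variables (A : 'M[R]_n) (N : 'I_m -> 'M[R]_n).
Notation mu := (@lebesgue_measure R).

Lemma blockrow_tens q (K : 'I_q -> 'M[R]_n) (X : 'M[R]_n) :
  blockrow K *m ((1%:M : 'M[R]_q) *t X) *m (blockrow K)^T =
  \sum_k K k *m X *m (K k)^T.
Proof.
apply/matrixP => i j; rewrite summxE mxE sum_mxtens; apply: eq_bigr => k _.
rewrite mxE; apply: eq_bigr => b _; rewrite !mxE sum_mxtens mxtens_indexK/=.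
congr (_ * _); rewrite (bigD1 k)//= [X in _ + X]big1 ?addr0.
  by apply: eq_bigr => a _; rewrite tensmxE !mxE mxtens_indexK/= eqxx mul1r.
move=> l /negbTE lk; apply: big1 => a _.
by rewrite tensmxE !mxE lk mul0r mulr0.
Qed.

(** The matrix of L^* acting on entries. By [kron_generatorE] it is the transpose of the Kronecker
    generator, which is why the decay argument is set up with row vectors. *)
Definition lyap_coef (r l : 'I_n * 'I_n) : R :=
  A l.1 r.1 * (l.2 == r.2)%:R + (l.1 == r.1)%:R * A l.2 r.2 +
  \sum_k N k l.1 r.1 * N k l.2 r.2.

Lemma kron_generatorE r l :
  kron_generator A N (mxtens_index l) (mxtens_index r) = lyap_coef r l.
Proof.
case: r l => [r1 r2] [l1 l2].
rewrite /kron_generator !mxE !mxtens_indexK/= summxE; congr (_ + _).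
by apply: eq_bigr => k _; rewrite tensmxE.
Qed.

Lemma lyap_dualE (X : 'M[R]_n) (r : 'I_n * 'I_n) :
  lyap_dual A N X r.1 r.2 = \sum_l lyap_coef r l * X l.1 l.2.
Proof.
rewrite /lyap_dual blockrow_tens 2!mxE summxE /lyap_coef.
under [RHS]eq_bigr do rewrite 2!mulrDl.
rewrite 2!big_split/= -(pair_bigA _ (fun i j => A i r.1 * (j == r.2)%:R * X i j))/=.
rewrite -(pair_bigA _ (fun i j => (i == r.1)%:R * A j r.2 * X i j))/=.
rewrite -(pair_bigA _ (fun i j => (\sum_k N k i r.1 * N k j r.2) * X i j))/=.
congr (_ + _ + _).
- rewrite mxE; apply: eq_bigr => i _; rewrite (bigD1 r.2)//= big1 ?addr0.
    by rewrite mxE eqxx mulr1.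
  by move=> j /negbTE jr; rewrite jr mulr0 mul0r.
- rewrite mxE [RHS](bigD1 r.1)//= [X in _ = _ + X]big1 ?addr0.
    by apply: eq_bigr => j _; rewrite eqxx mul1r mulrC.
  by move=> i /negbTE ir; apply: big1 => j _; rewrite ir !mul0r.
- transitivity (\sum_k \sum_i \sum_j N k i r.1 * N k j r.2 * X i j).
    apply: eq_bigr => k _; rewrite mxE exchange_big/=; apply: eq_bigr => j _.
    rewrite !mxE mulr_suml; apply: eq_bigr => i _; rewrite !mxE; ring.
  rewrite exchange_big/=; apply: eq_bigr => i _; rewrite exchange_big/=.
  by apply: eq_bigr => j _; rewrite mulr_suml.
Qed.

Lemma within_continuous_coord (D : set R) (Z : R -> 'M[R]_n) i j :
  {within D, continuous Z} -> {within D, continuous (fun t => Z t i j)}.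
Proof.
move=> cZ t; have h := @coord_continuous _ _ _ i j (Z t).
exact: (@cvg_comp _ _ _ Z (fun M : 'M[R]_n => M i j) _ _ _ (cZ t) h).
Qed.

Lemma ode_solution_measurable (L : 'M[R]_n -> 'M[R]_n) (Z0 : 'M[R]_n)
    (Z : R -> 'M[R]_n) (D : set R) i j :
  ode_solution L Z0 Z -> D `<=` `[0, +oo[ ->
  measurable_fun (D : set (measurableTypeR R)) (fun t => Z t i j).
Proof.
move=> [_ cZ _] DS; apply: (measurable_funS _ DS) => //.
apply: subspace_continuous_measurable_fun => //; exact: within_continuous_coord.
Qed.

Lemma ode_solution_integrable (L : 'M[R]_n -> 'M[R]_n) (Z0 : 'M[R]_n)
    (Z : R -> 'M[R]_n) (T : R) : ode_solution L Z0 Z -> mxintegrable `[0, T] Z.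
Proof.
move=> [_ cZ _] i j; apply: continuous_compact_integrable.
  exact: segment_compact.
by apply: within_itvcy_cc => //; exact: within_continuous_coord.
Qed.

Lemma ode_solution_lin_ode (Z0 : 'M[R]_n) (Z : R -> 'M[R]_n) :
  ode_solution (lyap_dual A N) Z0 Z ->
  lin_ode lyap_coef (fun r t => Z t r.1 r.2).
Proof.
move=> [_ cZ dZ]; split => [r|r t t0]; first exact: within_continuous_coord.
have [/derivable_mxP dd dE] := dZ t t0.
rewrite -lyap_dualE -dE derive_mx; last by case: (dZ t t0).
by rewrite mxE; apply: DeriveDef; first exact: dd.
Qed.

Lemma ode_solution_hurwitz_integrable (Z0 : 'M[R]_n) (Z : R -> 'M[R]_n) :
  kron_generator_hurwitz A N -> ode_solution (lyap_dual A N) Z0 Z ->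
  mxintegrable `[0, +oo[ Z.
Proof.
move=> hurw /ode_solution_lin_ode [cz dz] i j.
pose z (k : 'I_(n * n)) t := Z t (mxtens_unindex k).1 (mxtens_unindex k).2.
have zode : lin_ode (fun l k => kron_generator A N k l) z.
  split => [k|k t t0]; first exact: cz.
  have := dz (mxtens_unindex k) t t0; rewrite sum_mxtens.
  congr (is_derive _ _ _ _); rewrite pair_big/=; apply: eq_bigr => l _.
  rewrite -(mxtens_unindexK k) -surjective_pairing /z.
  by rewrite kron_generatorE mxtens_unindexK mxtens_indexK.
have := hurwitz_integrable zode hurw (mxtens_index (i, j)).
by rewrite /z mxtens_indexK.
Qed.

End lyapunov_entries.

(** * Solutions of the dual equation as second moments *)

Section dual_representation.
Context d (Omega : measurableType d) (R : realType) (P : probability Omega R).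
Variables (F : R -> set (set Omega)) (n m : nat).
Variables (A : 'M[R]_n) (N : 'I_m -> 'M[R]_n) (w : 'I_m -> R -> Omega -> R).
Variable Phi : R -> Omega -> 'M[R]_n.
Hypotheses (HF : filtration F) (Hw : wiener_process P F w).
Hypothesis HPhi : dual_fundamental_solution P F A N w Phi.
Notation mu := (@lebesgue_measure R).

Let J := ('I_n * 'I_n)%type.
(** Left multiplication by the transpose of [M], as a matrix on pairs (row, column); it makes the
    equation of [Phi] a linear stochastic equation for the vector of its entries. *)
Let lmul (M : 'M[R]_n) (r l : J) : R := M l.1 r.1 * (l.2 == r.2)%:R.
Let phi (r : J) t x : R := Phi t x r.1 r.2.
Let id1 (r : J) : R := (r.1 == r.2)%:R.

Let sum_lmul (M : 'M[R]_n) (g : J -> R) r :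
  \sum_l lmul M r l * g l = \sum_i M i r.1 * g (i, r.2).
Proof.
transitivity (\sum_i \sum_j lmul M r (i, j) * g (i, j)).
  by rewrite pair_bigA; apply: eq_bigr => -[].
apply: eq_bigr => i _; rewrite (bigD1 r.2)//= big1 ?addr0.
  by rewrite /lmul/= eqxx mulr1.
by move=> j /negbTE jr; rewrite /lmul/= jr mulr0 mul0r.
Qed.

Let lmulE (M X : 'M[R]_n) r : (M^T *m X) r.1 r.2 = \sum_l lmul M r l * X l.1 l.2.
Proof. by rewrite sum_lmul mxE; apply: eq_bigr => i _; rewrite mxE. Qed.

Let phi_int t : 0 <= t -> forall r, ito_integrand P F t (phi r).
Proof. by move=> t0 r; have [_ h _] := HPhi; exact: h. Qed.

Let phi_sde t : 0 <= t -> exists I : 'I_m -> J -> Omega -> R,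
  (forall k r, is_ito_integral P F (w k) (noise (fun k => lmul (N k)) phi k r) t (I k r)) /\
  forall r, {ae P, forall x, phi r t x =
    id1 r + \int[mu]_(s in `[0, t]) drift (lmul A) phi r s x + \sum_k I k r x}.
Proof.
move=> t0; have [_ _ /(_ t t0)[I [hI hE]]] := HPhi.
exists (fun k r x => I k x r.1 r.2); split => [k r|r].
  rewrite (_ : noise _ _ _ _ = fun v x => ((N k)^T *m Phi v x) r.1 r.2)//.
  by apply/funext => v; apply/funext => x; rewrite lmulE.
apply: filterS hE => x; rewrite /phi => ->; rewrite !mxE summxE; congr (_ + _ + _).
by apply: eq_Rintegral => s _; rewrite lmulE.
Qed.

Let G r s t := dotp P (phi r t) (phi s t).

(** Left multiplication mixes rows only. With the columns [c] and [e] fixed, the generator of the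
    second moments therefore reduces to L^* on the row indices. *)
Let second_moment_lyap (g : J -> J -> R) (i j c e : 'I_n) :
  (\sum_l lmul A (i, c) l * g l (j, e)) + (\sum_l lmul A (j, e) l * g (i, c) l) +
  \sum_l (\sum_k lmul (N k) (i, c) l.1 * lmul (N k) (j, e) l.2) * g l.1 l.2 =
  \sum_l lyap_coef A N (i, j) l * g (l.1, c) (l.2, e).
Proof.
pose f1 (a b : 'I_n) := A a i * (b == j)%:R * g (a, c) (b, e).
pose f2 (a b : 'I_n) := (a == i)%:R * A b j * g (a, c) (b, e).
pose f3 (a b : 'I_n) := (\sum_k N k a i * N k b j) * g (a, c) (b, e).
have -> : \sum_l lyap_coef A N (i, j) l * g (l.1, c) (l.2, e) =
    \sum_a \sum_b f1 a b + \sum_a \sum_b f2 a b + \sum_a \sum_b f3 a b.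
  rewrite !pair_bigA -!big_split/=; apply: eq_bigr => l _.
  by rewrite /lyap_coef/= 2!mulrDl.
rewrite !sum_lmul/=; congr (_ + _ + _).
- apply: eq_bigr => a _; rewrite (bigD1 j)//= big1 ?addr0.
    by rewrite /f1 eqxx mulr1.
  by move=> b /negbTE bj; rewrite /f1 bj mulr0 mul0r.
- rewrite [RHS](bigD1 i)//= [X in _ = _ + X]big1 ?addr0.
    by apply: eq_bigr => b _; rewrite /f2 eqxx mul1r.
  by move=> a /negbTE ai; apply: big1 => b _; rewrite /f2 ai !mul0r.
- transitivity (\sum_k \sum_l1 lmul (N k) (i, c) l1 *
      \sum_l2 lmul (N k) (j, e) l2 * g l1 l2).
    transitivity (\sum_k \sum_l1 \sum_l2 lmul (N k) (i, c) l1 *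
        (lmul (N k) (j, e) l2 * g l1 l2)).
      under eq_bigr do rewrite mulr_suml.
      rewrite exchange_big/=; apply: eq_bigr => k _; rewrite pair_bigA/=.
      by apply: eq_bigr => l _; rewrite mulrA.
    by apply: eq_bigr => k _; apply: eq_bigr => l1 _; rewrite mulr_sumr.
  transitivity (\sum_k \sum_a \sum_b N k a i * N k b j * g (a, c) (b, e)).
    apply: eq_bigr => k _; rewrite sum_lmul/=; apply: eq_bigr => a _.
    by rewrite sum_lmul/= mulr_sumr; apply: eq_bigr => b _; rewrite mulrA.
  rewrite exchange_big/=; apply: eq_bigr => a _; rewrite exchange_big/=.
  by apply: eq_bigr => b _; rewrite /f3 mulr_suml.
Qed.

(* The second moments of Phi and the entries of Z satisfy the same linear
   second-order estimate with the same initial value. *)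
Lemma dual_representation (X0 : 'M[R]_n) (Z : R -> 'M[R]_n) (t : R) i j :
  ode_solution (lyap_dual A N) X0 Z -> 0 <= t ->
  Z t i j = \sum_(r : 'I_n * 'I_n) X0 r.1 r.2 *
    dotp P (fun x => Phi t x i r.1) (fun x => Phi t x j r.2).
Proof.
move=> HZ t0; have [Z00 _ _] := HZ.
(* [V] is E[Phi(s) X0 Phi(s)^T] entrywise; its defect is the combination, weighted by [X0], of those
   of the second moments. *)
pose V (q : J) s := \sum_(r : J) X0 r.1 r.2 * G (q.1, r.1) (q.2, r.2) s.
have [C1 H1] := sde_second_moment HF Hw phi_int phi_sde t0.
have [C2 H2] := lin_ode_second_order t (ode_solution_lin_ode HZ).
pose K := \sum_(r : J) `|X0 r.1 r.2|.
have K0 : 0 <= K by exact: sumr_ge0.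
pose e (q : J) s := V q s - Z s q.1 q.2.
suff : e (i, j) t = 0 by move/eqP; rewrite subr_eq0 => /eqP <-.
apply: (@second_order_zero _ _ t (K * C1 + C2) (lyap_coef A N) e) => //; last first.
  move=> [a b]; apply/eqP; rewrite /e/= Z00 subr_eq0; apply/eqP.
  rewrite /V/= -(pair_bigA _ (fun c e => X0 c e * G (a, c) (b, e) 0))/=.
  rewrite (bigD1 a)//= [X in _ + X]big1 ?addr0; last first.
    move=> c ca; apply: big1 => k _.
    by rewrite /G (second_moment0 HF Hw phi_int phi_sde)/id1/= eq_sym (negbTE ca) mul0r mulr0.
  rewrite (bigD1 b)//= big1 ?addr0; last first.
    move=> k kb; rewrite /G (second_moment0 HF Hw phi_int phi_sde)/id1/=.
    by rewrite [b == k]eq_sym (negbTE kb) !mulr0.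
  by rewrite /G (second_moment0 HF Hw phi_int phi_sde)/id1/= !eqxx !mulr1.
move=> q s s' s0 ss' s't.
have -> : e q s' - e q s - (s' - s) * \sum_l lyap_coef A N q l * e l s =
    (V q s' - V q s - (s' - s) * \sum_l lyap_coef A N q l * V l s) -
    (Z s' q.1 q.2 - Z s q.1 q.2 - (s' - s) * \sum_l lyap_coef A N q l * Z s l.1 l.2).
  rewrite /e; under eq_bigr do rewrite mulrBr.
  by rewrite sumrB; ring.
rewrite (le_trans (ler_normB _ _))// [leRHS]mulrDl lerD//; last exact: H2.
have VE : \sum_l lyap_coef A N q l * V l s = \sum_(r : J) X0 r.1 r.2 *
    \sum_l lyap_coef A N q l * G (l.1, r.1) (l.2, r.2) s.
  rewrite /V; under eq_bigr do rewrite mulr_sumr.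
  rewrite exchange_big/=; apply: eq_bigr => r _; rewrite mulr_sumr.
  by apply: eq_bigr => l _; ring.
rewrite VE /V mulr_sumr -!sumrB -mulrA.
under eq_bigr do rewrite [_ * (_ * _)]mulrCA -!mulrBr.
apply: norm_sum_mul_le => r; have := H1 (q.1, r.1) (q.2, r.2) s s' s0 ss' s't.
rewrite -/(G _ _ _) (second_moment_lyap (fun a b => G a b s)).
by rewrite -surjective_pairing.
Qed.

Lemma dual_representation_vdot (X0 : 'M[R]_n) (Z : R -> 'M[R]_n) (t : R) (u v : 'cV[R]_n) :
  ode_solution (lyap_dual A N) X0 Z -> 0 <= t ->
  P.-integrable setT
    (EFin \o (fun x => vdot u (Phi t x *m X0 *m (Phi t x)^T *m v))) /\
  vdot u (Z t *m v) = \int[P]_x vdot u (Phi t x *m X0 *m (Phi t x)^T *m v).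
Proof.
move=> HZ t0.
pose k (q r : J) := u q.1 0 * v q.2 0 * X0 r.1 r.2.
pose h (q r : J) x := Phi t x q.1 r.1 * Phi t x q.2 r.2.
have E (W : 'M[R]_n) : vdot u (W *m v) = \sum_(q : J) u q.1 0 * v q.2 0 * W q.1 q.2.
  rewrite -(pair_bigA _ (fun i j => u i 0 * v j 0 * W i j))/=.
  apply: eq_bigr => i _; rewrite mxE mulr_sumr; apply: eq_bigr => j _; ring.
have E1 x : vdot u (Phi t x *m X0 *m (Phi t x)^T *m v) =
    \sum_(q : J) \sum_(r : J) k q r * h q r x.
  rewrite E; apply: eq_bigr => q _.
  rewrite -(pair_bigA _ (fun i j => k q (i, j) * h q (i, j) x))/= exchange_big/=.
  rewrite mxE mulr_sumr; apply: eq_bigr => j _; rewrite !mxE mulr_suml mulr_sumr.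
  by apply: eq_bigr => i _; rewrite /k /h/=; ring.
have sq r : sqint P (phi r t) by exact: (sqint_sde HF Hw phi_int phi_sde).
have ih q r : P.-integrable setT (EFin \o (fun x => h q r x)).
  exact: (sqint_mul (sq (q.1, r.1)) (sq (q.2, r.2))).
have ikh q r : P.-integrable setT (EFin \o (fun x => k q r * h q r x)).
  exact: integrable_scale.
have h1 q := Rintegral_sum (index_enum J) measurableT (ikh q).
have [h2 h3] := Rintegral_sum (index_enum J) measurableT (fun q => proj1 (h1 q)).
split.
  rewrite (_ : (fun x => vdot _ _) = fun x => \sum_q \sum_r k q r * h q r x)//.
  exact/funext.
under eq_Rintegral do rewrite E1.
rewrite h3 E; apply: eq_bigr => q _; rewrite (proj2 (h1 q)).
rewrite (dual_representation q.1 q.2 HZ t0) mulr_sumr; apply: eq_bigr => r _.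
by rewrite RintegralZl// /k mulrA.
Qed.

(** With W = Phi K, the bilinear form of Phi K Y K^T Phi^T at (u, v) is that of [Y] at (W^T u, W^T
    v); each argument contributes one factor [opnorm W], hence the square in the expectation. *)
Lemma dual_solution_bound q (K : 'M[R]_(n, q)) (Y : 'M[R]_q) (Z : R -> 'M[R]_n)
    (t : R) (u v : 'cV[R]_n) :
  ode_solution (lyap_dual A N) (K *m Y *m K^T) Z -> 0 <= t ->
  (`|vdot u (Z t *m v)|%:E <= (opnorm Y * l2norm u * l2norm v)%:E *
    'E_P[fun x => (opnorm (Phi t x *m K) ^+ 2)%R])%E.
Proof.
move=> HZ t0; have [iv ->] := dual_representation_vdot u v HZ t0.
have /integrableP[/measurable_EFinP mv _] := iv.
rewrite EFin_normr_Rintegral// (le_trans (le_abse_integral _ _ _))//.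
  exact/measurable_EFinP.
rewrite expectationE; apply: le_integral_scaled => //.
- exact: measurableT_comp.
- by rewrite !mulr_ge0 ?l2norm_ge0 ?opnorm_ge0.
- by move=> x _; rewrite lee_fin sqr_ge0.
move=> x _; rewrite -EFinM lee_fin.
set W := Phi t x *m K.
have -> : Phi t x *m (K *m Y *m K^T) *m (Phi t x)^T *m v = W *m (Y *m (W^T *m v)).
  by rewrite /W trmx_mul !mulmxA.
rewrite vdot_trmx (le_trans (vdot_mulmx_le _ _ _))//.
have le y : l2norm (W^T *m y) <= opnorm W * l2norm y.
  by rewrite (le_trans (l2norm_mulmx _ _))// ler_wpM2r ?l2norm_ge0// opnorm_trmx_le.
rewrite [leRHS](_ : _ = opnorm Y * (opnorm W * l2norm u) * (opnorm W * l2norm v)); last by ring.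
by rewrite ler_pM ?mulr_ge0 ?opnorm_ge0 ?l2norm_ge0// ler_wpM2l ?opnorm_ge0.
Qed.

End dual_representation.

(** * Existence of the Gramians *)

(** Treats both horizons at once. They differ in why the dual solutions are integrable over [D], by
    continuity on a compact interval or by Hurwitz decay, so this integrability is made a
    hypothesis. *)
Lemma gramians_exist (R : realType) (n m p : nat)
  (A : 'M[R]_n) (B : 'M[R]_(n, m)) (C : 'M[R]_(p, n))
  (N : 'I_m -> 'M[R]_n) (H : 'I_n -> 'M[R]_n)
  (d : measure_display) (Omega : measurableType d) (P : probability Omega R)
  (F : R -> set (set Omega)) (w : 'I_m -> R -> Omega -> R)
  (Phi : R -> Omega -> 'M[R]_n) (D : set R) (Z Zd : nat -> R -> 'M[R]_n) :
  filtration F -> wiener_process P F w ->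
  dual_fundamental_solution P F A N w Phi ->
  reach_family A B N H D Z -> obs_family A C N H D Z Zd ->
  measurable (D : set (measurableTypeR R)) -> D `<=` `[0, +oo[ ->
  (forall i Z0, ode_solution (lyap_dual A N) Z0 (Zd i) -> mxintegrable D (Zd i)) ->
  (total_norm D Z < +oo)%E ->
  (mean_square_gain P D H Phi * total_norm D Z < 1)%E ->
  gramian_exists D Z /\ gramian_exists D Zd.
Proof.
move=> HF Hw HPhi [Z1 Zi] [Zd1 Zdi] mD D0 iode Zy gain1.
have mZ i a b : (1 <= i)%N -> measurable_fun (D : set (measurableTypeR R)) (fun t => Z i t a b).
  case: i => [//|[|i]] _; first exact: (ode_solution_measurable _ _ Z1 D0).
  exact: (ode_solution_measurable _ _ (Zi i.+2 isT) D0).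
have gZ := gramian_exists_total_norm mD mZ Zy.
split => //; have [iZ _] := gZ.
have iZd i : (1 <= i)%N -> mxintegrable D (Zd i).
  by case: i => [//|[|i]] _; [exact: iode Zd1|exact: iode (Zdi i.+2 isT)].
have E0 t : D t -> (0 <= 'E_P[fun x => (opnorm (Phi t x *m
    blockrow (fun j => (H j)^T)) ^+ 2)%R])%E.
  by move=> _; rewrite expectationE; apply: integral_ge0 => x _; rewrite lee_fin sqr_ge0.
apply: (@gramian_exists_convolution _ _ _ _ (mean_square_gain P D H Phi)
  (total_norm D Z) (fun k => opnorm (mxintegral D (Z k)))) => //.
- exact: integral_ge0.
- by move=> i; exact: opnorm_ge0.
- by move=> r; exact: opnorm_mxintegral_sum_le.
move=> i i2; set Y := \sum_(1 <= k < i) mxintegral D (Z k) *t mxintegral D (Zd (i - k)%N).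
apply: (@le_trans _ _ ((opnorm Y)%:E * mean_square_gain P D H Phi)%E).
  apply: opnorm_mxintegral_le => //.
  - by apply: iZd; exact: ltnW.
  - exact: opnorm_ge0.
  - move=> t Dt u v; apply: (dual_solution_bound HF Hw HPhi u v (Zdi i i2)).
    by have := D0 t Dt; rewrite /= in_itv/= andbT.
rewrite muleC lee_wpmul2l//; first exact: integral_ge0.
rewrite lee_fin (le_trans (opnorm_sum _ _))//.
by apply: ler_sum => k _; exact: opnorm_tens.
Qed.

Theorem proposition3p4 (R : realType) (n m p : nat) (T : R)
  (A : 'M[R]_n) (B : 'M[R]_(n, m)) (C : 'M[R]_(p, n))
  (N : 'I_m -> 'M[R]_n) (H : 'I_n -> 'M[R]_n)
  (d : measure_display) (Omega : measurableType d) (P : probability Omega R)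
  (F : R -> set (set Omega)) (w : 'I_m -> R -> Omega -> R)
  (Phi : R -> Omega -> 'M[R]_n)
  (ZT ZdT Zoo Zdoo : nat -> R -> 'M[R]_n)
  (T_gt0 : 0 < T)
  (F_filtration : filtration F)
  (w_wiener : wiener_process P F w)
  (Phi_sol : dual_fundamental_solution P F A N w Phi)
  (ZT_def : reach_family A B N H `[0, T] ZT)
  (ZdT_def : obs_family A C N H `[0, T] ZT ZdT)
  (Zoo_def : reach_family A B N H `[0, +oo[ Zoo)
  (Zdoo_def : obs_family A C N H `[0, +oo[ Zoo Zdoo) :
  ((total_norm `[0%R, T] ZT < +oo)%E ->
   (mean_square_gain P `[0%R, T] H Phi * total_norm `[0%R, T] ZT < 1)%E ->
   gramian_exists `[0%R, T] ZT /\ gramian_exists `[0%R, T] ZdT) /\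
  (kron_generator_hurwitz A N ->
   (total_norm `[0%R, +oo[ Zoo < +oo)%E ->
   (mean_square_gain P `[0%R, +oo[ H Phi * total_norm `[0%R, +oo[ Zoo < 1)%E ->
   gramian_exists `[0%R, +oo[ Zoo /\ gramian_exists `[0%R, +oo[ Zdoo).
Proof.
split=> [Zy gain1|hurw Zy gain1].
- apply: (gramians_exist F_filtration w_wiener Phi_sol ZT_def ZdT_def _ _ _ Zy gain1) => //.
    by move=> t; rewrite /= !in_itv/= andbT => /andP[].
  by move=> i Z0; exact: ode_solution_integrable.
- apply: (gramians_exist F_filtration w_wiener Phi_sol Zoo_def Zdoo_def _ _ _ Zy gain1) => //.
  by move=> i Z0; exact: ode_solution_hurwitz_integrable.
Qed.
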